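(* Let $D\subseteq\mathbb{C}^n$ be a bounded domain and let $\Omega\subseteq\mathbb{C}^n$ be a bounded, convex, $d$-balanced domain, $d=(d_1,\dots,d_n)$. Then for every $a\in D$, $$\left(S^{\Omega}_{d,D}(a)\right)^{L}\leq h_{D}^{c}(a),$$ where $L=\max_{1\leq i\leq n}d_i$.
   Context: Let $n\geq 2$ and let $d=(d_1,\dots,d_n)$ be an $n$-tuple of positive integers. A domain $\Omega\subseteq\mathbb{C}^n$ is $d$-balanced if for each $z=(z_1,\dots,z_n)\in\Omega$ and each $\lambda\in\mathbb{C}$ with $|\lambda|\leq 1$ one has $(\lambda^{d_1}z_1,\dots,\lambda^{d_n}z_n)\in\Omega$. Its $d$-Minkowski function is $h_{d,\Omega}(z):=\inf\{t>0:(z_1/t^{d_1},\dots,z_n/t^{d_n})\in\Omega\}$, $z\in\mathbb{C}^n$, and for $0<r\leq 1$ one sets $\Omega^d(r):=\{z\in\mathbb{C}^n:h_{d,\Omega}(z)<r\}$. $\mathcal{O}_u(X,Y)$ denotes the set of injective holomorphic maps $X\to Y$. For a bounded domain $D$ and a bounded, convex, $d$-balanced domain $\Omega$, the $d$-balanced squeezing function is $$S_{d,D}^{\Omega}(z):=\sup\{r\in(0,1]:\Omega^d(r)\subseteq f(D),\ f\in\mathcal{O}_u(D,\Omega),\ f(z)=0\},\quad z\in D.$$ Let $c_D$ be the Carathéodory pseudodistance on $D$, normalized so that on the unit disc $c_{\mathbb{D}}(0,\sigma)=\tanh^{-1}|\sigma|$, and $B_D^c(a,r)=\{w\in D:c_D(a,w)<r\}$.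 The Fridman-type invariant (depending on $\Omega$) is $$h_D^c(a):=\sup\{\tanh r: r>0,\ B_D^c(a,r)\subseteq f(\Omega),\ f\in\mathcal{O}_u(\Omega,D)\}.$$ *)

(* Defs.v *)
From HB Require Import structures.
From mathcomp Require Import all_boot all_order all_algebra complex.
From mathcomp Require Import all_classical all_reals all_analysis.

Set Implicit Arguments.
Unset Strict Implicit.
Unset Printing Implicit Defensive.

Import Order.TTheory GRing.Theory Num.Theory numFieldNormedType.Exports.

Local Open Scope classical_set_scope.
Local Open Scope ring_scope.

(* R[i] as a normed space over itself, so that 'rV[R[i]]_n is inferred to be one
   over R[i]. *)
HB.instance Definition _ (R : rcfType) := PseudoPointedMetric.copy R[i] R[i]^o.
HB.instance Definition _ (R : rcfType) := GRing.ComAlgebra.copy R[i] R[i]^o.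
HB.instance Definition _ (R : rcfType) := Vector.copy R[i] R[i]^o.
HB.instance Definition _ (R : rcfType) := NormedModule.copy R[i] R[i]^o.

Definition tanh (R : realType) (x : R) : R :=
  (expR x - expR (- x)) / (expR x + expR (- x)).

(* Meaningful for |x| < 1, and only applied to values in [0, 1). *)
Definition artanh (R : realType) (x : R) : R := ln ((1 + x) / (1 - x)) / 2.

Section SeveralComplexVariables.
Variable R : realType.
Local Notation C := R[i].

Definition is_domain (n : nat) (U : set 'rV[C]_n) : Prop :=
  [/\ open U, connected U & U !=set0].

(* The scalars of the normed modules 'rV[C]_n and C are C, so that
   [differentiable] means Frechet differentiable with a C-linear differential.
   Maps are total, but on an open U only their values on U matter. *)
Definition holomorphic_on (n : nat) (W : normedModType C)
    (U : set 'rV[C]_n) (f : 'rV[C]_n -> W) : Prop :=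
  forall z, U z -> differentiable f z.

Definition univalent_maps (n : nat) (X Y : set 'rV[C]_n) :
    set ('rV[C]_n -> 'rV[C]_n) :=
  [set f | [/\ holomorphic_on X f, f @` X `<=` Y & set_inj X f]].

(* lambda ranges over {i01 C}, the complex numbers with 0 <= lambda <= 1; these
   are real, so this is the usual convexity. *)
Definition convex_subset (n : nat) (U : set 'rV[C]_n) : Prop :=
  convex_set (U : set (convex_lmodType 'rV[C]_n)).

Section Balanced.
Variables (n : nat) (d : 'I_n -> nat) (Omega : set 'rV[C]_n).

Definition weighted_scale (lambda : C) (z : 'rV[C]_n) : 'rV[C]_n :=
  \row_i (lambda ^+ d i * z 0 i).

Definition d_balanced : Prop :=
  forall z, Omega z -> forall lambda : C,
    `|lambda| <= 1 -> Omega (weighted_scale lambda z).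

Definition minkowski (z : 'rV[C]_n) : R :=
  inf [set t : R | 0 < t /\ Omega (\row_i (z 0 i / (t%:C)%C ^+ d i))].

Definition minkowski_ball (r : R) : set 'rV[C]_n :=
  [set z | minkowski z < r].

Definition squeezing (D : set 'rV[C]_n) (z : 'rV[C]_n) : R :=
  sup [set r : R | [/\ 0 < r, r <= 1 &
    exists f, [/\ univalent_maps D Omega f, f z = 0 &
                  minkowski_ball r `<=` f @` D]]].

End Balanced.

Definition unit_disc : set C := [set s | `|s| < 1].

(* The norm of C is C-valued, whence the real part. *)
Definition poincare (s t : C) : R :=
  artanh (complex.Re `|(s - t) / (1 - conjc t * s)|).

(* Taken in the extended reals, so that no junk value can arise; the supremum
   is finite when D is a domain. *)
Definition caratheodory (n : nat) (D : set 'rV[C]_n) (z w : 'rV[C]_n) : \bar R :=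
  ereal_sup [set (poincare (f z) (f w))%:E |
    f in [set f : 'rV[C]_n -> C |
            holomorphic_on D f /\ f @` D `<=` unit_disc]].

Definition caratheodory_ball (n : nat) (D : set 'rV[C]_n) (a : 'rV[C]_n) (r : R) :
    set 'rV[C]_n :=
  [set w | D w /\ (caratheodory D a w < r%:E)%E].

Definition fridman (n : nat) (Omega D : set 'rV[C]_n) (a : 'rV[C]_n) : R :=
  sup [set tanh r | r in [set r : R | 0 < r /\
    exists2 f, univalent_maps Omega D f & caratheodory_ball D a r `<=` f @` Omega]].

End SeveralComplexVariables.

(* Main.v *)
Require Import Defs.
From HB Require Import structures.
From mathcomp Require Import all_boot all_order all_algebra complex.
From mathcomp Require Import all_classical all_reals all_analysis.
From mathcomp Require Import ring lra.
Import Order.TTheory GRing.Theory Num.Theory numFieldNormedType.Exports.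
Set Implicit Arguments.
Unset Strict Implicit.
Unset Printing Implicit Defensive.
Local Open Scope classical_set_scope.
Local Open Scope ring_scope.

(* Let f : D -> Omega be injective holomorphic with f a = 0 and Omega^d(rho) inside
   f(D).  By Osgood's theorem f^-1 is holomorphic on f(D), so for r < rho the map
   g = f^-1 o (weighted scaling by r) is univalent from Omega into D, and it
   remains to see that g(Omega) contains the Caratheodory ball of radius
   artanh (m) whenever m < r^L.

   Suppose that w in D lies outside g(Omega), i.e. that p, the point f w scaled by
   1/r, lies outside Omega.  Hahn-Banach gives a complex linear form l with
   l(p) = 1 that omits the value 1 on Omega.  For x in Omega all roots mu_j of
   Q_x(X) = X^L - sum_i l_i x_i X^(L - d_i) lie in the unit disc, because Omega is
   d-balanced, so
     F(x) = 1 - L Q_x(1) / Q_x'(1) = 1 - L / sum_j 1 / (1 - mu_j)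
   maps Omega holomorphically into the unit disc, with F(0) = 0.  As r is a root
   of Q_(f w), a maximum principle argument on an annulus produces a unimodular u
   with |F(u . f w)| > m; the function F(u . f) then shows c_D(a, w) > artanh (m).

   Osgood's theorem is proved by induction on the dimension from the inverse
   function theorem: where the Jacobian matrix is nonzero at a critical point one
   coordinate can be split off, and otherwise injectivity fails. *)

(** The origin of [F]: [Q_x(1/w) w^L = 1 - l(w . x)], so the nonzero roots of [Q_x] are the inverses
    of the [w] at which the weighted orbit of [x] meets the hyperplane [l = 1]. Each
    [1 / (1 - mu_j)] has real part above 1/2, hence so has their mean, and [A -> 1 - 1/A] takes that
    half-plane to the unit disc. Being symmetric in the roots, [F] is rational in [x]; if all
    weights are 1 it is [l] itself. The exponent [L] is the number of roots: when one root is moved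
    radially to the unit circle, [F] tends to 1 with slope at most [L], whatever the others do. This
    controls the maximum of [|F|] over a circle and not its value at [f w], hence the rotation [u],
    which preserves Omega and 0. The analysis underneath uses integrals over rectangles only and no
    power series. A maximum principle that tolerates one merely continuous point gives Cauchy
    estimates; these give Lipschitz gradients, the differentiability of directional derivatives and,
    after division by powers, the identity theorem. *)

Local Notation Re := complex.Re.
Local Notation Im := complex.Im.
Local Notation cmod z := (Normc.normc z).

(** * One complex variable: Goursat's theorem and the maximum principle *)

Section ComplexModulus.
Variable R : realType.
Local Notation C := R[i].
Implicit Types z w : C.

Lemma norm_cmod z : `|z| = (cmod z)%:C%C.
Proof. by case: z. Qed.

Lemma cmod_ge0 z : 0 <= cmod z.
Proof. by case: z => a b; exact: sqrtr_ge0. Qed.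

Lemma cmodD z w : cmod (z + w) <= cmod z + cmod w.
Proof. exact: le_normcD. Qed.

Lemma cmodN z : cmod (- z) = cmod z.
Proof. exact: normcN. Qed.

Lemma cmod_distC z w : cmod (z - w) = cmod (w - z).
Proof. by rewrite -cmodN opprB. Qed.

Lemma cmodM z w : cmod (z * w) = cmod z * cmod w.
Proof. exact: Normc.normcM. Qed.

Lemma cmodV z : cmod z^-1 = (cmod z)^-1.
Proof. exact: Normc.normcV. Qed.

Lemma cmod0 : cmod (0 : C) = 0.
Proof. exact: Normc.normc0. Qed.

Lemma cmod1 : cmod (1 : C) = 1.
Proof. exact: Normc.normc1. Qed.

Lemma cmodX z n : cmod (z ^+ n) = cmod z ^+ n.
Proof. by elim: n => [|n IH]; rewrite ?expr0 ?cmod1// !exprS cmodM IH. Qed.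

Lemma cmod_eq0 z : (cmod z == 0) = (z == 0).
Proof.
by apply/eqP/eqP => [/Normc.eq0_normc//|->]; exact: cmod0.
Qed.

Lemma cmod_gt0 z : (0 < cmod z) = (z != 0).
Proof. by rewrite lt_neqAle cmod_ge0 andbT eq_sym cmod_eq0. Qed.

Lemma cmodR (x : R) : cmod (x%:C)%C = `|x|.
Proof. by rewrite /= expr0n addr0 sqrtr_sqr. Qed.

Lemma cmod_nat n : cmod (n%:R : C) = n%:R.
Proof. by rewrite -(rmorph_nat (real_complex R)) cmodR normr_nat. Qed.

Lemma cmodB_ge z w : cmod (z - w) >= cmod z - cmod w.
Proof. by rewrite lerBlDr -{1}(subrK w z) cmodD. Qed.

Lemma cmod_dist z w : `|cmod z - cmod w| <= cmod (z - w).
Proof. by rewrite ler_norml cmodB_ge andbT lerNl opprB cmod_distC cmodB_ge. Qed.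

Lemma cmod_Re z : `|Re z| <= cmod z.
Proof.
by case: z => a b /=; rewrite -sqrtr_sqr ler_wsqrtr// lerDl sqr_ge0.
Qed.

Lemma cmod_Im z : `|Im z| <= cmod z.
Proof.
by case: z => a b /=; rewrite -sqrtr_sqr ler_wsqrtr// lerDr sqr_ge0.
Qed.

Lemma cmod_le z : cmod z <= `|Re z| + `|Im z|.
Proof.
case: z => a b /=; rewrite -(ger0_norm (addr_ge0 (normr_ge0 a) (normr_ge0 b))).
rewrite -sqrtr_sqr ler_wsqrtr// sqrrD !real_normK ?num_real//.
by rewrite addrAC lerDl mulrn_wge0// mulr_ge0.
Qed.

Lemma ReD z w : Re (z + w) = Re z + Re w.
Proof. by case: z w => [a b] [c d]. Qed.

Lemma ImD z w : Im (z + w) = Im z + Im w.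
Proof. by case: z w => [a b] [c d]. Qed.

Lemma ReN z : Re (- z) = - Re z.
Proof. by case: z. Qed.

Lemma ImN z : Im (- z) = - Im z.
Proof. by case: z. Qed.

Lemma ReM z w : Re (z * w) =
  Re z * Re w - Im z * Im w.
Proof. by case: z w => [a b] [c d]. Qed.

Lemma ImM z w : Im (z * w) =
  Re z * Im w + Im z * Re w.
Proof. by case: z w => [a b] [c d]. Qed.

Lemma cmod_sqr z : cmod z ^+ 2 = Re z ^+ 2 + Im z ^+ 2.
Proof. by case: z => a b /=; rewrite sqr_sqrtr// addr_ge0 ?sqr_ge0. Qed.

Lemma cplx_eq z w : Re z = Re w -> Im z = Im w ->
  z = w.
Proof. by case: z w => [a b] [c d] /= -> ->. Qed.

Lemma cmod_i : cmod ('i%C : C) = 1.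
Proof. by rewrite /= expr0n expr1n add0r sqrtr1. Qed.

Lemma cmodI (x : R) : cmod (0 +i* x)%C = `|x|.
Proof. by rewrite /= expr0n add0r sqrtr_sqr. Qed.

End ComplexModulus.

Arguments Normc.normc : simpl never.

(** * Integrals of complex-valued functions over real segments *)

Section SegmentIntegral.
Variable R : realType.
Local Notation C := R[i].
Local Notation mu := (@lebesgue_measure R).
Implicit Types (u v : R -> C) (a b c : R).

(** The Lebesgue integral used here is real-valued, so the two parts are integrated apart. Estimates
    lose a factor 2, which the N-th powers in [rect_maximum] absorb. *)
Definition cint u a b : C :=
  ((\int[mu]_(x in `[a, b]) Re (u x)) +i*
   (\int[mu]_(x in `[a, b]) Im (u x)))%C.

(** Continuity refers to a full neighbourhood of each point, also past the ends, because the
    integrands are restrictions of functions on the plane. *)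
Definition segment_cont u a b := forall x, a <= x <= b ->
  forall e, 0 < e -> exists d, 0 < d /\
    forall y, `|y - x| < d -> cmod (u y - u x) <= e.

Lemma segment_contM u k a b : segment_cont u a b ->
  segment_cont (fun x => k * u x) a b.
Proof.
move=> H x xab e e0.
have k1 : 0 < cmod k + 1 by rewrite ltr_wpDl// cmod_ge0.
have [d [d0 Hd]] := H x xab (e / (cmod k + 1)) (divr_gt0 e0 k1).
exists d; split=> // y /Hd h; rewrite -mulrBr cmodM.
rewrite (le_trans (ler_wpM2l (cmod_ge0 k) h))// mulrCA.
by rewrite ler_piMr ?(ltW e0)// ler_pdivrMr// mul1r lerDl.
Qed.

Lemma segment_cont_within (p : C -> R) u a b :
  (forall z w, `|p z - p w| <= cmod (z - w)) -> segment_cont u a b ->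
  {within `[a, b], continuous (p \o u : R -> R^o)}.
Proof.
move=> pL H; apply: continuous_in_subspaceT => x; rewrite inE /= in_itv /= => xab.
apply/cvgrPdist_le => e e0; have [d [d0 Hd]] := H x xab e e0.
apply/nbhs_normP; exists d => //= y; rewrite /ball_/= => xy.
by rewrite distrC (le_trans (pL _ _))// Hd// distrC.
Qed.

Lemma Re_lip z w : `|Re z - Re w| <= cmod (z - w : C).
Proof. by rewrite -ReN -ReD cmod_Re. Qed.

Lemma Im_lip z w : `|Im z - Im w| <= cmod (z - w : C).
Proof. by rewrite -ImN -ImD cmod_Im. Qed.

Lemma segment_cont_integrable (p : C -> R) u a b :
  (forall z w, `|p z - p w| <= cmod (z - w)) -> segment_cont u a b ->
  mu.-integrable `[a, b] (EFin \o (p \o u)).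
Proof.
move=> pL /(segment_cont_within pL); apply: continuous_compact_integrable.
exact: segment_compact.
Qed.

Local Notation intRe := (segment_cont_integrable Re_lip).
Local Notation intIm := (segment_cont_integrable Im_lip).

Lemma cintD u v a b : segment_cont u a b -> segment_cont v a b ->
  cint (fun x => u x + v x) a b = cint u a b + cint v a b.
Proof.
move=> cu cv; rewrite /cint; apply: cplx_eq; rewrite ?ReD ?ImD /=.
- rewrite -RintegralD//; [|exact: intRe|exact: intRe].
  by apply: eq_Rintegral => x _; rewrite ReD.
- rewrite -RintegralD//; [|exact: intIm|exact: intIm].
  by apply: eq_Rintegral => x _; rewrite ImD.
Qed.

Lemma cintM u k a b : segment_cont u a b ->
  cint (fun x => k * u x) a b = k * cint u a b.
Proof.
move=> cu; rewrite /cint; apply: cplx_eq; rewrite ?ReM ?ImM /=.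
- rewrite -!RintegralZl//; [|exact: intIm|exact: intRe].
  rewrite -RintegralB//.
  + by apply: eq_Rintegral => x _; rewrite ReM.
  + apply: (integrableZl _ _ (intRe cu)) => //.
  + apply: (integrableZl _ _ (intIm cu)) => //.
- rewrite -!RintegralZl//; [|exact: intRe|exact: intIm].
  rewrite -RintegralD//.
  + by apply: eq_Rintegral => x _; rewrite ImM.
  + apply: (integrableZl _ _ (intIm cu)) => //.
  + apply: (integrableZl _ _ (intRe cu)) => //.
Qed.

Lemma Rintegral_cat (f : R -> R) a b m : a <= m -> m <= b ->
  mu.-integrable `[a, b] (EFin \o f) ->
  \int[mu]_(x in `[a, b]) f x =
  \int[mu]_(x in `[a, m]) f x + \int[mu]_(x in `[m, b]) f x.
Proof.
move=> am mb fi.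
have fi' : mu.-integrable `]m, b] (EFin \o f).
  by apply: integrableS fi => //; apply: subset_itvr; rewrite bnd_simp.
rewrite -(@Rintegral_itv_obnd_cbnd _ m (BRight b))//.
rewrite -(Rintegral_itvB fi) ?bnd_simp//.
by rewrite [RHS]addrC subrK.
Qed.

Lemma cint_cat u a b m : a <= m -> m <= b -> segment_cont u a b ->
  cint u a b = cint u a m + cint u m b.
Proof.
move=> am mb cu; rewrite /cint; apply: cplx_eq; rewrite ?ReD ?ImD /=.
- by apply: Rintegral_cat => //; exact: intRe.
- by apply: Rintegral_cat => //; exact: intIm.
Qed.

Lemma segment_measure a b : a <= b -> fine (mu `[a, b]) = b - a.
Proof.
move=> ab; rewrite lebesgue_measure_itv /= lte_fin.
case: ltP => //= ba; suff -> : a = b by rewrite subrr.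
by apply/eqP; rewrite eq_le ab.
Qed.

Lemma le_Rintegral_segment (f g : R -> R) a b :
  mu.-integrable `[a, b] (EFin \o f) -> mu.-integrable `[a, b] (EFin \o g) ->
  (forall x, a <= x <= b -> f x <= g x) ->
  \int[mu]_(x in `[a, b]) f x <= \int[mu]_(x in `[a, b]) g x.
Proof.
move=> fi gi fg; apply: le_Rintegral => // x /=; rewrite in_itv /=; exact: fg.
Qed.

Lemma segment_cont_cst k a b : segment_cont (fun=> k) a b.
Proof.
move=> x _ e e0; exists 1; split => // y _; rewrite subrr cmod0 ltW//.
Qed.

Lemma integrable_cst_segment (k : R) a b :
  mu.-integrable `[a, b] (EFin \o (fun=> k)).
Proof. exact: (intRe (@segment_cont_cst (k%:C)%C a b)). Qed.

Lemma Rintegral_segment_ge (f : R -> R) m a b : a <= b ->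
  mu.-integrable `[a, b] (EFin \o f) -> (forall x, a <= x <= b -> m <= f x) ->
  m * (b - a) <= \int[mu]_(x in `[a, b]) f x.
Proof.
move=> ab fi mf; rewrite -segment_measure// -Rintegral_cst//.
by apply: le_Rintegral_segment => //; exact: integrable_cst_segment.
Qed.

Lemma Rintegral_segment_le (f : R -> R) m a b : a <= b ->
  mu.-integrable `[a, b] (EFin \o f) -> (forall x, a <= x <= b -> f x <= m) ->
  \int[mu]_(x in `[a, b]) f x <= m * (b - a).
Proof.
move=> ab fi mf; rewrite -segment_measure// -Rintegral_cst//.
by apply: le_Rintegral_segment => //; exact: integrable_cst_segment.
Qed.

Lemma cint_le u M a b : a <= b -> segment_cont u a b ->
  (forall x, a <= x <= b -> cmod (u x) <= M) ->
  cmod (cint u a b) <= 2 * (M * (b - a)).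
Proof.
move=> ab cu uM; rewrite (le_trans (cmod_le _))// mulr_natl mulr2n /=.
have Hp (p : C -> R) : (forall z w, `|p z - p w| <= cmod (z - w)) ->
    (forall z, `|p z| <= cmod z) ->
    `|\int[mu]_(x in `[a, b]) p (u x)| <= M * (b - a).
  move=> pL pM; rewrite ler_norml -mulNr; apply/andP; split.
    apply: Rintegral_segment_ge => //; first exact: segment_cont_integrable.
    by move=> x /uM ux; have := le_trans (pM _) ux; rewrite ler_norml => /andP[].
  apply: Rintegral_segment_le => //; first exact: segment_cont_integrable.
  by move=> x /uM ux; have := le_trans (pM _) ux; rewrite ler_norml => /andP[].
by rewrite lerD// Hp//; [exact: Re_lip|exact: cmod_Re|exact: Im_lip|exact: cmod_Im].
Qed.

Lemma cint_Im_ge u m a b : a <= b -> segment_cont u a b ->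
  (forall x, a <= x <= b -> m <= Im (u x)) ->
  m * (b - a) <= Im (cint u a b).
Proof. by move=> ab cu um; apply: Rintegral_segment_ge => //; exact: intIm. Qed.

Lemma cint_Re_ge u m a b : a <= b -> segment_cont u a b ->
  (forall x, a <= x <= b -> m <= Re (u x)) ->
  m * (b - a) <= Re (cint u a b).
Proof. by move=> ab cu um; apply: Rintegral_segment_ge => //; exact: intRe. Qed.

Lemma cint_cst k a b : a <= b -> cint (fun=> k) a b = k * ((b - a)%:C)%C.
Proof.
move=> ab; rewrite /cint !Rintegral_cst// segment_measure//.
by apply: cplx_eq; rewrite ?ReM ?ImM /= mulr0 ?subr0 ?add0r.
Qed.

Lemma eq_cint u v a b : (forall x, a <= x <= b -> u x = v x) ->
  cint u a b = cint v a b.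
Proof.
move=> uv; rewrite /cint; congr (_ +i* _)%C; apply: eq_Rintegral => x;
by rewrite inE /= in_itv /= => /uv ->.
Qed.

End SegmentIntegral.

(** * Complex differentiability at a point *)

Section ComplexDerivative.
Variable R : realType.
Local Notation C := R[i].
Implicit Types (f g : C -> C) (z w : C).

Lemma cvg_cmodP (T : Type) (F : set_system T) (FF : Filter F) (f : T -> C) (l : C) :
  f @ F --> l <->
  forall e : R, 0 < e -> \forall x \near F, cmod (f x - l) <= e.
Proof.
split=> [/cvgrPdist_le cf e e0|H].
  have e0' : 0 < (e%:C)%C :> C by rewrite (ltcR 0).
  by near do rewrite -lecR -norm_cmod distrC; exact: cf.
apply/cvgrPdist_le => e; rewrite ltcE => /andP[/eqP /= e1 e0].
have -> : e = ((Re e)%:C)%C by apply: cplx_eq.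
by near do rewrite distrC norm_cmod lecR; exact: H.
Unshelve. all: by end_near. Qed.

Lemma nbhs_cmodP z (P : set C) :
  nbhs z P <-> exists d : R, 0 < d /\ forall h, cmod h < d -> P (z + h).
Proof.
split=> [/nbhs_normP[d /= d0 Hd]|[d [d0 Hd]]].
  move: d0; rewrite ltcE => /andP[/eqP /= d1 d0].
  exists (Re d); split=> // h hd; apply: Hd; rewrite /ball_/=.
  rewrite opprD addNKr normrN norm_cmod.
  have -> : d = ((Re d)%:C)%C by apply: cplx_eq.
  by rewrite ltcR.
apply/nbhs_normP; exists (d%:C)%C => /=; first by rewrite (ltcR 0).
move=> y; rewrite /ball_/= norm_cmod ltcR cmod_distC => yd.
by rewrite -(subrKC z y); exact: Hd.
Qed.

Definition ccont f z := forall e : R, 0 < e -> exists d, 0 < d /\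
  forall h, cmod h < d -> cmod (f (z + h) - f z) <= e.

Lemma ccontP f z : ccont f z <-> f @ z --> f z.
Proof.
have E := @cvg_cmodP C (nbhs z) _ f (f z).
by split=> [H|/E H e /H /nbhs_cmodP//]; apply/E => e /H He; exact/nbhs_cmodP.
Qed.

Lemma contc_cst (k : C) z : ccont (fun _ : C => k) z.
Proof. by apply/ccontP; exact: cst_continuous. Qed.

Lemma contc_id z : ccont (fun x : C => x) z.
Proof. by move=> e e0; exists e; split=> // h /ltW; rewrite [z + h]addrC addrK. Qed.

Lemma contcD f g z : ccont f z -> ccont g z -> ccont (fun x => f x + g x) z.
Proof.
move=> /ccontP cf /ccontP cg; apply/ccontP.
exact: (@cvgD _ _ _ _ _ f g _ _ cf cg).
Qed.

Lemma contcM f g z : ccont f z -> ccont g z -> ccont (fun x => f x * g x) z.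
Proof.
move=> /ccontP cf /ccontP cg; apply/ccontP.
exact: (@cvgM _ _ _ _ f g _ _ cf cg).
Qed.

Lemma contcN f z : ccont f z -> ccont (fun x => - f x) z.
Proof. by move=> /ccontP cf; apply/ccontP; exact: (@cvgN _ _ _ _ _ f _ cf). Qed.

Lemma contcV f z : f z != 0 -> ccont f z -> ccont (fun x => (f x)^-1) z.
Proof.
by move=> fz /ccontP cf; apply/ccontP; exact: (@cvgV _ _ _ _ f _ fz cf).
Qed.

Lemma contcX f z n : ccont f z -> ccont (fun x => f x ^+ n) z.
Proof.
move=> cf; elim: n => [|n IH]; first exact: contc_cst.
rewrite (_ : (fun x => _) = fun x => f x * f x ^+ n); first exact: contcM.
by apply/funext => x; rewrite exprS.
Qed.

(* Caratheodory's characterization of differentiability, which makes the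
   algebraic rules immediate. *)
Definition cder f z (m : C) := exists q : C -> C,
  [/\ q 0 = m, ccont q 0 & forall h, f (z + h) = f z + h * q h].

Definition cdiff f z := exists m, cder f z m.

Lemma cont_shift f z : ccont f z <->
  ccont (fun h => f (z + h)) 0.
Proof.
split=> H e /H [d [d0 Hd]]; exists d; split=> // h /Hd;
by rewrite ?addr0 ?add0r.
Qed.

Lemma cder_cont f z m : cder f z m -> ccont f z.
Proof.
case=> q [_ cq fq]; apply/cont_shift.
rewrite (_ : (fun h => _) = fun h => f z + h * q h); last exact/funext.
exact: (contcD (contc_cst _ _) (contcM (contc_id _) cq)).
Qed.

Lemma cdiff_cont f z : cdiff f z -> ccont f z.
Proof. by case=> m /cder_cont. Qed.

Lemma cder_epsP f z m : cder f z m <-> forall e : R, 0 < e ->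
  exists d, 0 < d /\
    forall h, cmod h < d -> cmod (f (z + h) - f z - h * m) <= e * cmod h.
Proof.
split=> [[q [<- cq fq]] e /cq[d [d0 Hd]]|H].
  exists d; split=> // h /Hd; rewrite add0r => qh.
  by rewrite fq [f z + _]addrC addrK -mulrBr cmodM mulrC ler_wpM2r ?cmod_ge0.
exists (fun h => if h == 0 then m else (f (z + h) - f z) / h); split.
- by rewrite eqxx.
- move=> e e0; have [d [d0 Hd]] := H e e0.
  exists d; split => // h /Hd.
  rewrite add0r eqxx; case: eqVneq => [_ _|h0 hd].
    by rewrite subrr cmod0 ltW.
  have -> : (f (z + h) - f z) / h - m = (f (z + h) - f z - h * m) / h.
    by field.
  by rewrite cmodM cmodV ler_pdivrMr// cmod_gt0.
- move=> h; case: eqVneq => [->|h0]; first by rewrite mul0r !addr0.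
  by rewrite mulrC divfK// subrKC.
Qed.

Lemma cder_cst (k : C) z : cder (fun=> k) z 0.
Proof.
exists (fun=> 0); split=> // [|h]; first exact: contc_cst.
by rewrite mulr0 addr0.
Qed.

Lemma cder_id z : cder id z 1.
Proof.
exists (fun=> 1); split=> // [|h]; first exact: contc_cst.
by rewrite mulr1.
Qed.

Lemma cderD f g z a b : cder f z a -> cder g z b ->
  cder (fun x => f x + g x) z (a + b).
Proof.
move=> [q [<- cq fq]] [p [<- cp gp]]; exists (fun h => q h + p h).
split=> // [|h]; first exact: (contcD cq cp).
by rewrite fq gp; ring.
Qed.

Lemma cderM f g z a b : cder f z a -> cder g z b ->
  cder (fun x => f x * g x) z (a * g z + f z * b).
Proof.
move=> fa gb; have /cont_shift cg := cder_cont gb.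
case: fa gb => [q [<- cq fq]] [p [<- cp gp]].
exists (fun h => q h * g (z + h) + f z * p h).
split=> [||h]; first by rewrite addr0.
- exact: (contcD (contcM cq cg) (contcM (contc_cst _ _) cp)).
- by rewrite fq gp; ring.
Qed.

Lemma cderV f z a : f z != 0 -> cder f z a ->
  cder (fun x => (f x)^-1) z (- a / f z ^+ 2).
Proof.
move=> fz0 fa; have /cont_shift cf := cder_cont fa.
have cfV : ccont (fun x => (f x)^-1) z.
  exact: (contcV fz0 (cder_cont fa)).
case: fa => q [<- cq fq].
apply/cder_epsP => e e0.
have cH : ccont (fun h => - q h * (f (z + h))^-1 * (f z)^-1) 0.
  have fz1 : f (z + 0) != 0 by rewrite addr0.
  exact: (contcM (contcM (contcN cq) (contcV fz1 cf)) (contc_cst _ _)).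
have [d1 [d10 Hd1]] : exists d : R, 0 < d /\ forall h, cmod h < d -> f (z + h) != 0.
  have fz1 : 0 < cmod (f z) / 2 by rewrite divr_gt0// cmod_gt0.
  have /(_ _ fz1)[d [d0 Hd]] := cf.
  exists d; split=> // h /Hd; rewrite add0r addr0; apply: contraPneq => ->.
  by rewrite sub0r cmodN => ?; lra.
have /(_ _ e0)[d [d0 Hd]] := cH.
exists (Order.min d d1); split=> [|h]; first by rewrite lt_min d0.
rewrite lt_min => /andP[/Hd h1 /Hd1 fh0]; move: h1.
rewrite add0r addr0 => h1.
have -> : (f (z + h))^-1 - (f z)^-1 - h * (- q 0 / f z ^+ 2) =
   h * (- q h / f (z + h) / f z - - q 0 / f z / f z).
  move: fh0; rewrite fq => fh0.
  by field; rewrite fh0 fz0.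
by rewrite cmodM mulrC ler_wpM2r ?cmod_ge0.
Qed.

Lemma cdiff_cst (k : C) z : cdiff (fun=> k) z.
Proof. by exists 0; exact: cder_cst. Qed.

Lemma cdiff_id z : cdiff id z.
Proof. by exists 1; exact: cder_id. Qed.

Lemma cdiffD f g z : cdiff f z -> cdiff g z -> cdiff (fun x => f x + g x) z.
Proof. by move=> [a fa] [b gb]; exists (a + b); exact: cderD. Qed.

Lemma cdiffM f g z : cdiff f z -> cdiff g z -> cdiff (fun x => f x * g x) z.
Proof. by move=> [a fa] [b gb]; eexists; exact: (cderM fa gb). Qed.

Lemma cdiffV f z : f z != 0 -> cdiff f z -> cdiff (fun x => (f x)^-1) z.
Proof. by move=> fz0 [a fa]; eexists; exact: (cderV fz0 fa). Qed.

Lemma cdiffN f z : cdiff f z -> cdiff (fun x => - f x) z.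
Proof.
move=> fd; rewrite (_ : (fun x => _) = fun x => -1 * f x).
  by apply: cdiffM => //; exact: cdiff_cst.
by apply/funext => x; rewrite mulN1r.
Qed.

Lemma cdiffB f g z : cdiff f z -> cdiff g z -> cdiff (fun x => f x - g x) z.
Proof. by move=> fd gd; apply: cdiffD => //; exact: cdiffN. Qed.

Lemma cdiffX f z n : cdiff f z -> cdiff (fun x => f x ^+ n) z.
Proof.
move=> fd; elim: n => [|n IH]; first exact: cdiff_cst.
by rewrite (_ : (fun x => _) = fun x => f x * f x ^+ n);
  [exact: cdiffM|apply/funext => x; rewrite exprS].
Qed.

Lemma cdiff_near f g z (d : R) : 0 < d ->
  (forall h, cmod h < d -> f (z + h) = g (z + h)) -> cdiff f z -> cdiff g z.
Proof.
move=> d0 fg [m /cder_epsP fm]; exists m; apply/cder_epsP => e /fm[d' [d'0 H]].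
exists (Order.min d d'); split=> [|h]; first by rewrite lt_min d0.
rewrite lt_min => /andP[hd /H]; rewrite fg// -[in f z](addr0 z) fg ?cmod0//.
by rewrite addr0.
Qed.

Lemma cder_unique f z a b : cder f z a -> cder f z b -> a = b.
Proof.
move=> [q [<- cq fq]] [p [<- cp fp]].
apply/eqP; rewrite -subr_eq0 -cmod_eq0; apply: contraT => n0.
have {}n0 : 0 < cmod (q 0 - p 0) by rewrite lt_neqAle eq_sym n0 cmod_ge0.
have e0 : 0 < cmod (q 0 - p 0) / 4 by rewrite divr_gt0.
move: cq => /(_ _ e0)[d [d0 Hd]].
move: cp => /(_ _ e0)[d' [d'0 Hd']].
pose h : C := ((Order.min d d' / 2)%:C)%C.
have m0 : 0 < Order.min d d' by rewrite lt_min d0.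
have hm : cmod h < Order.min d d' by rewrite cmodR ger0_norm; lra.
move: (hm); rewrite lt_min => /andP[/Hd h1 /Hd' h2].
have h0 : h != 0 by rewrite -cmod_gt0 cmodR normr_gt0; lra.
have E : q h = p h.
  by apply: (mulfI h0); apply: (addrI (f z)); rewrite -fq fp.
move: h1 h2; rewrite !add0r E => h1 h2.
have := cmodD (p h - p 0) (q 0 - p h).
have -> : p h - p 0 + (q 0 - p h) = q 0 - p 0 by ring.
by rewrite [cmod (q 0 - p h)]cmod_distC => ?; lra.
Qed.

End ComplexDerivative.

(** * Goursat's theorem on rectangles *)

Section Rectangles.
Variable R : realType.
Local Notation C := R[i].
Implicit Types (f g : C -> C) (z w : C) (a b c d : R).

Definition rect a b c d : set C :=
  [set z | a <= Re z <= b /\ c <= Im z <= d].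

Definition rect_bd a b c d : set C := [set z | rect a b c d z /\
  [\/ Re z = a, Re z = b, Im z = c | Im z = d]].

(** The counterclockwise integral of [g dz]: bottom minus top, then right minus left with
    [dz = i dy]. *)
Definition rect_int g a b c d : C :=
  cint (fun x => g (x +i* c)%C) a b - cint (fun x => g (x +i* d)%C) a b +
  'i%C * (cint (fun y => g (b +i* y)%C) c d - cint (fun y => g (a +i* y)%C) c d).

Definition bd_cont g a b c d := forall z, rect_bd a b c d z -> ccont g z.

Lemma hsegment_cont g a b c : (forall x, a <= x <= b -> ccont g (x +i* c)%C) ->
  segment_cont (fun x => g (x +i* c)%C) a b.
Proof.
move=> H x /H cg e /cg [d [d0 Hd]]; exists d; split=> // y yd.
have -> : (y +i* c)%C = (x +i* c)%C + ((y - x)%:C)%C.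
  by apply: cplx_eq => /=; ring.
by apply: Hd; rewrite cmodR.
Qed.

Lemma vsegment_cont g a b c : (forall x, a <= x <= b -> ccont g (c +i* x)%C) ->
  segment_cont (fun x => g (c +i* x)%C) a b.
Proof.
move=> H x /H cg e /cg [d [d0 Hd]]; exists d; split=> // y yd.
have -> : (c +i* y)%C = (c +i* x)%C + (0 +i* (y - x))%C.
  by apply: cplx_eq => /=; ring.
by apply: Hd; rewrite cmodI.
Qed.

Section Edges.
Variables (g : C -> C) (a b c d : R).
Hypotheses (ab : a <= b) (cd : c <= d) (cg : bd_cont g a b c d).

Lemma bd_bottom : segment_cont (fun x => g (x +i* c)%C) a b.
Proof.
apply: hsegment_cont => x xab; apply: cg; split; first by split; rewrite //= lexx.
by apply: Or43.
Qed.

Lemma bd_top : segment_cont (fun x => g (x +i* d)%C) a b.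
Proof.
apply: hsegment_cont => x xab; apply: cg; split; last by apply: Or44.
by split; rewrite //= lexx andbT.
Qed.

Lemma bd_right : segment_cont (fun y => g (b +i* y)%C) c d.
Proof.
apply: vsegment_cont => x xab; apply: cg; split; last by apply: Or42.
by split; rewrite //= lexx andbT.
Qed.

Lemma bd_left : segment_cont (fun y => g (a +i* y)%C) c d.
Proof.
apply: vsegment_cont => x xab; apply: cg; split; last by apply: Or41.
by split; rewrite //= lexx.
Qed.

End Edges.

Lemma rect_intD f g a b c d : a <= b -> c <= d ->
  bd_cont f a b c d -> bd_cont g a b c d ->
  rect_int (fun z => f z + g z) a b c d = rect_int f a b c d + rect_int g a b c d.
Proof.
move=> ab cd cf cg; rewrite /rect_int.
rewrite (cintD (bd_bottom cd cf) (bd_bottom cd cg)) (cintD (bd_top cd cf) (bd_top cd cg)).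
by rewrite (cintD (bd_right ab cf) (bd_right ab cg)) (cintD (bd_left ab cf) (bd_left ab cg)); ring.
Qed.

Lemma rect_intM f k a b c d : a <= b -> c <= d -> bd_cont f a b c d ->
  rect_int (fun z => k * f z) a b c d = k * rect_int f a b c d.
Proof.
move=> ab cd cf; rewrite /rect_int (cintM _ (bd_bottom cd cf)) (cintM _ (bd_top cd cf)).
by rewrite (cintM _ (bd_right ab cf)) (cintM _ (bd_left ab cf)); ring.
Qed.

Lemma rect_int_le g M a b c d : a <= b -> c <= d -> bd_cont g a b c d ->
  (forall z, rect_bd a b c d z -> cmod (g z) <= M) ->
  cmod (rect_int g a b c d) <= 4 * (M * ((b - a) + (d - c))).
Proof.
move=> ab cd cg gM.
have h1 : cmod (cint (fun x => g (x +i* c)%C) a b) <= 2 * (M * (b - a)).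
  apply: cint_le => // [|x xab]; first exact: (bd_bottom cd cg).
  apply: gM; split; last by apply: Or43.
  by split; rewrite //= lexx.
have h2 : cmod (cint (fun x => g (x +i* d)%C) a b) <= 2 * (M * (b - a)).
  apply: cint_le => // [|x xab]; first exact: (bd_top cd cg).
  apply: gM; split; last by apply: Or44.
  by split; rewrite //= lexx andbT.
have h3 : cmod (cint (fun x => g (b +i* x)%C) c d) <= 2 * (M * (d - c)).
  apply: cint_le => // [|x xab]; first exact: (bd_right ab cg).
  apply: gM; split; last by apply: Or42.
  by split; rewrite //= lexx andbT.
have h4 : cmod (cint (fun x => g (a +i* x)%C) c d) <= 2 * (M * (d - c)).
  apply: cint_le => // [|x xab]; first exact: (bd_left ab cg).
  apply: gM; split; last by apply: Or41.
  by split; rewrite //= lexx.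
rewrite /rect_int; set A := cint _ _ _ in h1 *; set B := cint _ _ _ in h2 *.
set D := cint _ _ _ in h3 *; set E := cint _ _ _ in h4 *.
have := cmodD (A - B) ('i%C * (D - E)); have := cmodD A (- B).
have := cmodD D (- E).
rewrite !cmodN [cmod ('i%C * _)]cmodM cmod_i mul1r; lra.
Qed.

Lemma bd_cont_cst k a b c d : bd_cont (fun=> k) a b c d.
Proof. by move=> z _; exact: contc_cst. Qed.

Lemma bd_cont_id a b c d : bd_cont (fun z => z) a b c d.
Proof. by move=> z _; exact: contc_id. Qed.

Lemma rect_int_cst k a b c d : a <= b -> c <= d -> rect_int (fun=> k) a b c d = 0.
Proof. by move=> ab cd; rewrite /rect_int !cint_cst//; ring. Qed.

(** Each side integral differs from the one along the parallel axis by that of a constant, and the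
    four constants cancel; no antiderivative enters. *)
Lemma rect_int_id a b c d : a <= b -> c <= d -> rect_int (fun z => z) a b c d = 0.
Proof.
move=> ab cd.
have H (u v k : R) : u <= v -> cint (fun x => (x +i* k)%C) u v =
    cint (fun x => (x +i* 0)%C) u v + (0 +i* k)%C * ((v - u)%:C)%C.
  move=> uv; rewrite -cint_cst// -cintD.
  - by apply: eq_cint => x _; apply: cplx_eq => /=; ring.
  - by apply: (@hsegment_cont id) => x _; exact: contc_id.
  - exact: segment_cont_cst.
have V (u v k : R) : u <= v -> cint (fun x => (k +i* x)%C) u v =
    cint (fun x => (0 +i* x)%C) u v + (k%:C)%C * ((v - u)%:C)%C.
  move=> uv; rewrite -cint_cst// -cintD.
  - by apply: eq_cint => x _; apply: cplx_eq => /=; ring.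
  - by apply: (@vsegment_cont id) => x _; exact: contc_id.
  - exact: segment_cont_cst.
rewrite /rect_int (H _ _ c)// (H _ _ d)// (V _ _ b)// (V _ _ a)//.
set X := cint _ _ _; set Y := cint _ _ _.
rewrite [LHS](_ : _ = (0 +i* c)%C * ((b - a)%:C)%C - (0 +i* d)%C * ((b - a)%:C)%C
   + 'i%C * ((b%:C)%C * ((d - c)%:C)%C - (a%:C)%C * ((d - c)%:C)%C)); last by ring.
by apply: cplx_eq; rewrite ?(ReM, ImM, ReD, ImD, ReN, ImN) /=; ring.
Qed.

(** In Goursat's estimate this lets the first-order expansion of [g] at the limit point be
    subtracted. *)
Lemma rect_intB_aff g k m a b c d : a <= b -> c <= d -> bd_cont g a b c d ->
  rect_int (fun z => g z + (k + m * z)) a b c d = rect_int g a b c d.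
Proof.
move=> ab cd cg.
have cid := @bd_cont_id a b c d; have ck := @bd_cont_cst k a b c d.
have cmz : bd_cont (fun z => m * z) a b c d.
  by move=> z _; apply: contcM; [exact: contc_cst|exact: contc_id].
rewrite rect_intD//; last by move=> z zb; apply: contcD; [exact: ck|exact: cmz].
rewrite rect_intD// rect_intM// rect_int_cst// rect_int_id//.
by rewrite mulr0 !addr0.
Qed.

Lemma rect_int_vcat g a b c d m : a <= m -> m <= b -> c <= d -> bd_cont g a b c d ->
  rect_int g a b c d = rect_int g a m c d + rect_int g m b c d.
Proof.
move=> am mb cd cg; rewrite /rect_int.
rewrite (cint_cat am mb (bd_bottom cd cg)) (cint_cat am mb (bd_top cd cg)).
by ring.
Qed.

Lemma rect_int_hcat g a b c d m : c <= m -> m <= d -> a <= b -> bd_cont g a b c d ->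
  rect_int g a b c d = rect_int g a b c m + rect_int g a b m d.
Proof.
move=> am mb cd cg; rewrite /rect_int.
rewrite (cint_cat am mb (bd_right cd cg)) (cint_cat am mb (bd_left cd cg)).
by ring.
Qed.

Lemma nested_intervals (u v : nat -> R) : (forall k, u k <= u k.+1) ->
  (forall k, v k.+1 <= v k) -> (forall k, u k <= v k) ->
  exists x, forall k, u k <= x <= v k.
Proof.
move=> u1 v1 uv.
have um i j : (i <= j)%N -> u i <= u j.
  by move=> /subnK <-; elim: (j - i)%N => //= k /le_trans; apply; exact: u1.
have vm i j : (i <= j)%N -> v j <= v i.
  by move=> /subnK <-; elim: (j - i)%N => // k IH; apply: le_trans IH; exact: v1.
have uvij i j : u i <= v j.
  apply: (le_trans (um _ _ (leq_maxl i j))).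
  by apply: (le_trans (uv _)); apply: vm; exact: leq_maxr.
have ub j : ubound (range u) (v j) by move=> _ [i _ <-].
exists (sup (range u)) => k; apply/andP; split.
  by apply: ub_le_sup; [exists (v 0%N)|exists k].
by apply: sup_le_ub => //; exists (u 0%N), 0%N.
Qed.

Lemma pow2_small (s e : R) : 0 < e -> exists k, s / 2 ^+ k < e.
Proof.
move=> e0; exists (Num.truncn (s / e)).+1.
rewrite ltr_pdivrMr ?exprn_gt0// mulrC -ltr_pdivrMr//.
apply: (lt_trans (truncnS_gt _)); rewrite -natrX ltr_nat.
exact: ltn_expl.
Qed.

Lemma rect_mid a b : a <= b -> a <= (a + b) / 2 <= b.
Proof. by move=> ab; apply/andP; split; lra. Qed.

Lemma rect_sub a b c d a' b' c' d' z : a <= a' -> b' <= b -> c <= c' -> d' <= d ->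
  rect a' b' c' d' z -> rect a b c d z.
Proof.
move=> aa bb cc dd [/andP[h1 h2] /andP[h3 h4]].
by split; apply/andP; split; [exact: le_trans h1|exact: le_trans bb|
  exact: le_trans h3|exact: le_trans dd].
Qed.

Lemma half_left a b : (a + b) / 2 - a = (b - a) / 2.
Proof. by field. Qed.

Lemma half_right a b : b - (a + b) / 2 = (b - a) / 2.
Proof. by field. Qed.

Lemma quarter_bound (x y1 y2 y3 y4 : R) : x <= y1 + y2 + (y3 + y4) ->
  4 * y1 < x -> 4 * y2 < x -> 4 * y3 < x -> x <= 4 * y4.
Proof. lra. Qed.

(** Bisection: some quarter carries at least a fourth of the integral. At the common point of the
    nested rectangles [g] is affine up to [e] times the distance, so the k-th integral is of order
    [e s^2 / 4^k]. *)
Theorem goursat g a b c d : a <= b -> c <= d ->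
  (forall z, rect a b c d z -> cdiff g z) -> rect_int g a b c d = 0.
Proof.
move=> ab cd gd.
pose I (Q : R * R * R * R) := rect_int g Q.1.1.1 Q.1.1.2 Q.1.2 Q.2.
pose ok (Q : R * R * R * R) := [/\ Q.1.1.1 <= Q.1.1.2, Q.1.2 <= Q.2,
   a <= Q.1.1.1, Q.1.1.2 <= b & c <= Q.1.2 /\ Q.2 <= d].
pose nxt (Q Q' : R * R * R * R) := [/\ ok Q',
  Q.1.1.1 <= Q'.1.1.1 /\ Q'.1.1.2 <= Q.1.1.2, Q.1.2 <= Q'.1.2 /\ Q'.2 <= Q.2,
  Q'.1.1.2 - Q'.1.1.1 = (Q.1.1.2 - Q.1.1.1) / 2 /\
  Q'.2 - Q'.1.2 = (Q.2 - Q.1.2) / 2 & cmod (I Q) <= 4 * cmod (I Q')].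
(* The premise [ok Q] stands inside the existential, so that choice gives a total selection function
   to iterate. *)
have stepP Q : exists Q', ok Q -> nxt Q Q'.
  case: (pselect (ok Q)) => [okQ|nQ]; last by exists Q.
  case: Q okQ => [[[p q] r] s] [/= pq rs ap qb [cr sd]].
  have /andP[pm mq] := rect_mid pq; have /andP[rn ns] := rect_mid rs.
  set m := (p + q) / 2 in pm mq; set n := (r + s) / 2 in rn ns.
  have hl := half_left p q; have hr := half_right p q.
  have kl := half_left r s; have kr := half_right r s.
  rewrite -/m in hl hr; rewrite -/n in kl kr.
  have cQ z : rect p q r s z -> ccont g z.
    by move=> zQ; apply: cdiff_cont; apply: gd; exact: (rect_sub ap qb cr sd).
  have E : I (p, q, r, s) = I (p, m, r, n) + I (p, m, n, s)
      + (I (m, q, r, n) + I (m, q, n, s)).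
    rewrite /I /= (@rect_int_vcat _ p q r s m)//; last by move=> z [/cQ].
    by congr (_ + _); apply: rect_int_hcat => // z [zQ _];
      apply: cQ; apply: rect_sub zQ.
  have tri : cmod (I (p, q, r, s)) <= cmod (I (p, m, r, n)) + cmod (I (p, m, n, s))
      + (cmod (I (m, q, r, n)) + cmod (I (m, q, n, s))).
    by rewrite E (le_trans (cmodD _ _))// lerD// cmodD.
  have mk p' q' r' s' : p <= p' -> p' <= q' -> q' <= q -> r <= r' -> r' <= s' ->
      s' <= s -> q' - p' = (q - p) / 2 -> s' - r' = (s - r) / 2 ->
      cmod (I (p, q, r, s)) <= 4 * cmod (I (p', q', r', s')) ->
      nxt (p, q, r, s) (p', q', r', s').
    move=> h1 h2 h3 h4 h5 h6 h7 h8 h9; split=> //; split=> //=.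
    - exact: le_trans h1.
    - exact: le_trans qb.
    - by split; [exact: le_trans h4|exact: le_trans sd].
  have [i1|i1] := leP (cmod (I (p, q, r, s))) (4 * cmod (I (p, m, r, n))).
    by exists (p, m, r, n) => _; apply: mk.
  have [i2|i2] := leP (cmod (I (p, q, r, s))) (4 * cmod (I (p, m, n, s))).
    by exists (p, m, n, s) => _; apply: mk.
  have [i3|i3] := leP (cmod (I (p, q, r, s))) (4 * cmod (I (m, q, r, n))).
    by exists (m, q, r, n) => _; apply: mk.
  exists (m, q, n, s) => _; apply: mk => //.
  exact: quarter_bound tri i1 i2 i3.
have [F FP] := choice stepP.
pose Q k := iter k F (a, b, c, d).
have okQ k : ok (Q k).
  elim: k => [|k /FP[]//]; by split => //=; split.
have nQ k : nxt (Q k) (Q k.+1) by exact: FP.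
have [x Hx] : exists x, forall k, (Q k).1.1.1 <= x <= (Q k).1.1.2.
  by apply: nested_intervals => k; [case: (nQ k) => _ []|case: (nQ k) => _ []|case: (okQ k)].
have [y Hy] : exists y, forall k, (Q k).1.2 <= y <= (Q k).2.
  by apply: nested_intervals => k; [case: (nQ k) => _ _ []|case: (nQ k) => _ _ []|case: (okQ k)].
pose s := (b - a) + (d - c).
have s0 : 0 <= s by rewrite /s addr_ge0// subr_ge0.
have sides k : ((Q k).1.1.2 - (Q k).1.1.1) + ((Q k).2 - (Q k).1.2) = s / 2 ^+ k.
  elim: k => [|k IH]; first by rewrite expr0 divr1.
  case: (nQ k) => _ _ _ [-> ->] _; rewrite -mulrDl IH exprS.
  by field; rewrite expf_neq0.
have est k : cmod (I (a, b, c, d)) <= 4 ^+ k * cmod (I (Q k)).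
  elim: k => [|k IH]; first by rewrite expr0 mul1r.
  apply: (le_trans IH); rewrite exprSr -mulrA ler_wpM2l ?exprn_ge0//.
  by case: (nQ k).
have [m Hm] : cdiff g (x +i* y)%C.
  by apply: gd; split; [exact: (Hx 0%N)|exact: (Hy 0%N)].
suff H e : 0 < e -> cmod (I (a, b, c, d)) <= 4 * e * s ^+ 2.
  apply/eqP; rewrite -[rect_int _ _ _ _ _]/(I (a, b, c, d)) -cmod_eq0.
  apply/eqP/le_anti; rewrite cmod_ge0 andbT; apply/ler_addgt0Pl => e e0.
  have s2 := sqr_ge0 s.
  have s1 : 0 < 4 * (s ^+ 2 + 1) by rewrite mulr_gt0// ltr_wpDl.
  rewrite addr0; apply: (le_trans (H _ (divr_gt0 e0 s1))).
  have -> : 4 * (e / (4 * (s ^+ 2 + 1))) * s ^+ 2 = e * (s ^+ 2 / (s ^+ 2 + 1)).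
    by field; rewrite gt_eqF// ltr_wpDl.
  by rewrite ler_piMr ?(ltW e0)// ler_pdivrMr ?mul1r ?lerDl// ltr_wpDl.
move=> e0; move/cder_epsP: Hm => /(_ _ e0)[r [r0 Hr]].
have [k Hk] := pow2_small s r0.
apply: (le_trans (est k)).
move: (Hx k) (Hy k) (okQ k) (sides k); rewrite /I.
case: (Q k) => [[[a' b'] c'] d'] /= xab ycd [/= ab' cd' aa' bb' [cc' dd']] sk.
set z := (x +i* y)%C in Hr.
have cg z' : rect a' b' c' d' z' -> ccont g (z').
  by move=> zQ; apply: cdiff_cont; apply: gd; exact: (rect_sub aa' bb' cc' dd').
pose rem z' := g z' + ((m * z - g z) + (- m) * z').
have crem : bd_cont rem a' b' c' d'.
  move=> z' [/cg z'r _]; apply: contcD => //; apply: contcD; first exact: contc_cst.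
  by apply: contcM; [exact: contc_cst|exact: contc_id].
have <- : rect_int rem a' b' c' d' = rect_int g a' b' c' d'.
  by rewrite /rem rect_intB_aff// => z' [/cg].
(* The [4 ^ k] lost by choosing quarters is regained from two factors [2 ^ k], one for the perimeter
   and one for the distance to the limit point. *)
have -> : 4 * e * s ^+ 2 = 4 ^+ k * (4 * (e * (s / 2 ^+ k) * (s / 2 ^+ k))).
  have -> : (4 : R) = 2 ^+ 2 by rewrite expr2; lra.
  rewrite -exprM mulnC exprM [(2 ^+ k) ^+ 2]expr2.
  by field; rewrite expf_neq0.
rewrite ler_wpM2l ?exprn_ge0//.
rewrite -{2}sk; apply: rect_int_le => // z' [[/andP[h1 h2] /andP[h3 h4]] _].
have zz' : cmod (z' - z) <= s / 2 ^+ k.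
  rewrite (le_trans (cmod_le _))// -sk !(ReD, ImD, ReN, ImN) /=.
  rewrite lerD//.
    by move: xab h1 h2; clear => /andP[? ?] ? ?; rewrite ler_norml; lra.
  by move: ycd h3 h4; clear => /andP[? ?] ? ?; rewrite ler_norml; lra.
have -> : rem z' = g (z + (z' - z)) - g z - (z' - z) * m.
  by rewrite subrKC /rem; ring.
apply: (le_trans (Hr _ (le_lt_trans zz' Hk))).
by rewrite ler_wpM2l// ltW.
Qed.

End Rectangles.

(** * The maximum principle with one exceptional point *)

Section MaximumPrinciple.
Variable R : realType.
Local Notation C := R[i].
Implicit Types (f g : C -> C) (z w : C) (a b c d e : R).

Definition rect_in a b c d : set C :=
  [set z | a < Re z < b /\ c < Im z < d].

Lemma rect_in_bd a b c d w z : rect_in a b c d w -> rect_bd a b c d z -> z != w.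
Proof.
move=> [/andP[h1 h2] /andP[h3 h4]] [_ Hz]; apply/eqP => zw; rewrite zw in Hz.
by case: Hz => E; move: h1 h2 h3 h4; rewrite E ltxx.
Qed.

Lemma rect_in_le a b c d w : rect_in a b c d w -> a <= b /\ c <= d.
Proof.
by move=> [/andP[h1 h2] /andP[h3 h4]]; split; apply: ltW;
  [exact: lt_trans h2|exact: lt_trans h4].
Qed.

(** The four strips cut off avoid [w], so their integrals vanish by Goursat; the contour can thus be
    moved to a small square around the exceptional point. *)
Lemma rect_int_shrink g a b c d a' b' c' d' w :
  a <= a' -> b' <= b -> c <= c' -> d' <= d -> rect_in a' b' c' d' w ->
  (forall z, rect a b c d z -> z != w -> cdiff g z) ->
  rect_int g a b c d = rect_int g a' b' c' d'.
Proof.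
move=> aa bb cc dd wi gd; have [ab cd] := rect_in_le wi.
case: (wi) => /andP[h1 h2] /andP[h3 h4].
have cont p q r s : a <= p -> q <= b -> c <= r -> s <= d ->
    rect_in p q r s w -> bd_cont g p q r s.
  move=> ap qb cr sd wi' z zb; apply/cdiff_cont/gd.
    by apply: rect_sub ap qb cr sd _; case: zb.
  exact: rect_in_bd zb.
have zero p q r s : p <= q -> r <= s -> a <= p -> q <= b -> c <= r -> s <= d ->
   ~ rect p q r s w -> rect_int g p q r s = 0.
  move=> pq rs ap qb cr sd nw; apply: goursat => // z zr.
  apply: gd; first exact: (rect_sub ap qb cr sd).
  by apply/eqP => zw; apply: nw; rewrite -zw.
have ab0 : a <= b by exact: (le_trans aa (le_trans ab bb)).
have cd0 : c <= d by exact: (le_trans cc (le_trans cd dd)).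
have wi1 : rect_in a b c d w.
  split; apply/andP; split.
  - exact: le_lt_trans h1.
  - exact: lt_le_trans bb.
  - exact: le_lt_trans h3.
  - exact: lt_le_trans dd.
have wi2 : rect_in a' b c d w.
  by case: wi1 => /andP[_ ?] ?; split => //; apply/andP.
have wi3 : rect_in a' b' c d w.
  by case: wi1 => _ ?; split => //; apply/andP.
have wi4 : rect_in a' b' c' d w.
  by case: wi3 => ? /andP[? ?]; split => //; apply/andP.
have Z1 : rect_int g a a' c d = 0.
  apply: (zero a a' c d) aa cd0 (lexx a) (le_trans ab bb) (lexx c) (lexx d) _.
  by case=> /andP[_]; rewrite leNgt h1.
have Z2 : rect_int g b' b c d = 0.
  apply: (zero b' b c d) bb cd0 (le_trans aa ab) (lexx b) (lexx c) (lexx d) _.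
  by case=> /andP[+ _]; rewrite leNgt h2.
have Z3 : rect_int g a' b' c c' = 0.
  apply: (zero a' b' c c') ab cc aa bb (lexx c) (le_trans cd dd) _.
  by case=> _ /andP[_]; rewrite leNgt h3.
have Z4 : rect_int g a' b' d' d = 0.
  apply: (zero a' b' d' d) ab dd aa bb (le_trans cc cd) (lexx d) _.
  by case=> _ /andP[+ _]; rewrite leNgt h4.
have C1 := cont a b c d (lexx a) (lexx b) (lexx c) (lexx d) wi1.
have C2 := cont a' b c d aa (lexx b) (lexx c) (lexx d) wi2.
have C3 := cont a' b' c d aa bb (lexx c) (lexx d) wi3.
have C4 := cont a' b' c' d aa bb cc (lexx d) wi4.
rewrite (rect_int_vcat aa (le_trans ab bb) cd0 C1) Z1 add0r.
rewrite (rect_int_vcat ab bb cd0 C2) Z2 addr0.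
rewrite (rect_int_hcat cc (le_trans cd dd) ab C3) Z3 add0r.
by rewrite (rect_int_hcat cd dd ab C4) Z4 addr0.
Qed.

Lemma rect_square a b c d w : rect_in a b c d w -> exists e0 : R, 0 < e0 /\
  forall e, 0 < e -> e <= e0 ->
  [/\ a <= Re w - e, Re w + e <= b, c <= Im w - e &
      Im w + e <= d].
Proof.
case=> /andP[h1 h2] /andP[h3 h4].
exists (Order.min (Order.min (Re w - a) (b - Re w))
  (Order.min (Im w - c) (d - Im w))); split.
  by rewrite !lt_min !subr_gt0 h1 h2 h3 h4.
move=> e e0; rewrite !le_min => /andP[/andP[e1 e2] /andP[e3 e4]].
by split; lra.
Qed.

Lemma square_in e w : 0 < e -> rect_in (Re w - e) (Re w + e)
  (Im w - e) (Im w + e) w.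
Proof. by move=> e0; split; apply/andP; split; lra. Qed.

Lemma square_bd e w z : 0 < e -> rect_bd (Re w - e) (Re w + e)
  (Im w - e) (Im w + e) z -> e <= cmod (z - w).
Proof.
move=> e0 [_ Hz].
have h1 := cmod_Re (z - w); have h2 := cmod_Im (z - w).
move: h1 h2; rewrite ReD ImD ReN ImN => h1 h2.
have dN (x : R) : x - e - x = - e by ring.
have dP (x : R) : x + e - x = e by ring.
case: Hz => E; [apply: le_trans h1|apply: le_trans h1|apply: le_trans h2|apply: le_trans h2];
  by rewrite E ?dN ?dP ?normrN gtr0_norm.
Qed.

(** Removability: on the square of half-side [e] around [w] the perimeter is of order [e], while the
    integrand is o(1/e). *)
Lemma rect_int_exceptional g a b c d w : rect_in a b c d w ->
  (forall z, rect a b c d z -> z != w -> cdiff g z) ->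
  (forall e, 0 < e -> exists r, 0 < r /\
    forall h, h != 0 -> cmod h < r -> cmod (g (w + h)) <= e / cmod h) ->
  rect_int g a b c d = 0.
Proof.
move=> wi gd gw; have [e0 [e00 He0]] := rect_square wi.
apply/eqP; rewrite -cmod_eq0; apply/eqP/le_anti; rewrite cmod_ge0 andbT.
apply/ler_addgt0Pl => t t0; rewrite addr0.
(* [rect_int_le] contributes a factor 4 and the two sides add up to [4 e], hence 16. *)
have t1 : 0 < t / 16 by rewrite divr_gt0.
have [r [r0 Hr]] := gw _ t1.
pose e := Order.min e0 (r / 4).
have e1 : 0 < e by rewrite lt_min e00 divr_gt0.
have ee0 : e <= e0 by rewrite ge_min lexx.
have [ha hb hc hd] := He0 e e1 ee0.
rewrite (rect_int_shrink ha hb hc hd (square_in w e1) gd).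
have er : e <= r / 4 by rewrite ge_min lexx orbT.
have [sq1 sq2] := rect_in_le (square_in w e1).
have bnd : forall z, rect_bd (Re w - e) (Re w + e)
     (Im w - e) (Im w + e) z ->
   cmod (g z) <= t / 16 / e /\ rect a b c d z /\ z != w.
  move=> z zb; have zw := square_bd e1 zb.
  have zw' := rect_in_bd (square_in w e1) zb.
  have [zr _] := zb; split; last first.
    by split => //; exact: rect_sub ha hb hc hd zr.
  have zr' : cmod (z - w) < r.
    apply: (le_lt_trans (cmod_le _)); rewrite ReD ImD ReN ImN.
    case: zr => /andP[k1 k2] /andP[k3 k4].
    have l1 : `|Re z - Re w| <= e.
      by rewrite ler_norml; move: k1 k2; clear; lra.
    have l2 : `|Im z - Im w| <= e.
      by rewrite ler_norml; move: k3 k4; clear; lra.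
    by apply: (le_lt_trans (lerD l1 l2)); move: er r0; clear; lra.
  have := Hr (z - w); rewrite subr_eq0 zw' => /(_ isT zr').
  rewrite subrKC => /le_trans; apply.
  by rewrite ler_pM2l// lef_pV2// posrE// (lt_le_trans e1).
apply: (le_trans (rect_int_le sq1 sq2 _ (fun z zb => proj1 (bnd z zb)))).
  by move=> z /bnd[_ [z1 z2]]; apply/cdiff_cont/gd.
rewrite le_eqVlt; apply/orP; left; apply/eqP.
by field; rewrite gt_eqF.
Qed.

(** A lower bound in place of the exact value 2 pi: on a square centred at [w] each side contributes
    at least its length [2 e] times the minimum [1 / (2 e)] of the integrand. *)
Lemma winding_ge a b c d w : rect_in a b c d w ->
  4 <= Im (rect_int (fun z => (z - w)^-1) a b c d).
Proof.
move=> wi; have [e [e0 /(_ e e0 (lexx e))[ha hb hc hd]]] := rect_square wi.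
have gd z : z != w -> cdiff (fun z => (z - w)^-1) z.
  move=> zw; apply: cdiffV; first by rewrite subr_eq0.
  by apply: cdiffB; [exact: cdiff_id|exact: cdiff_cst].
rewrite (rect_int_shrink ha hb hc hd (square_in w e0)) => [|z _]; last exact: gd.
have [sq1 sq2] := rect_in_le (square_in w e0).
have cg : bd_cont (fun z => (z - w)^-1) (Re w - e) (Re w + e)
    (Im w - e) (Im w + e).
  by move=> z zb; apply/cdiff_cont/gd; exact: (rect_in_bd (square_in w e0) zb).
have inv (x y : R) : y ^+ 2 = e ^+ 2 -> - e <= x <= e ->
    (2 * e)^-1 <= e / (x ^+ 2 + y ^+ 2).
  move=> -> xe; have x2 : x ^+ 2 <= e ^+ 2.
    case/andP: xe => x1 x2; rewrite -subr_ge0 subr_sqr mulr_ge0 ?subr_ge0//.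
    by rewrite addrC -lerBlDr sub0r.
  have p : 0 < x ^+ 2 + e ^+ 2 by rewrite ltr_wpDl ?sqr_ge0// exprn_gt0.
  rewrite ler_pdivlMr// ler_pdivrMl ?mulr_gt0//.
  by rewrite -mulrA -expr2; move: x2; clear; lra.
have invE (z : C) : (z^-1) = ((Re z / (Re z ^+ 2 + Im z ^+ 2)) +i*
    - (Im z / (Re z ^+ 2 + Im z ^+ 2)))%C by case: z.
have len x : (2 * e)^-1 * (x + e - (x - e)) = 1.
  by field; rewrite gt_eqF.
have rng x (y : R) : y - e <= x <= y + e -> - e <= x - y <= e.
  by clear; move=> /andP[? ?]; lra.
have ImE (A B D E : C) : Im (A - B + 'i%C * (D - E)) =
    Im A - Im B + (Re D - Re E).
  by case: A B D E => [? ?] [? ?] [? ?] [? ?] /=; ring.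
rewrite /rect_int ImE.
have b1 : 1 <= Im (cint (fun x => ((x +i* (Im w - e))%C - w)^-1)
    (Re w - e) (Re w + e)).
  rewrite -(len (Re w)); apply: cint_Im_ge => //.
    exact: (bd_bottom sq2 cg).
  move=> x /rng xr; rewrite invE /= !(ReD, ImD, ReN, ImN) /=.
  have -> : Im w - e - Im w = - e by ring.
  by rewrite mulNr opprK; apply: inv => //; rewrite sqrrN.
have b2 : 1 <= Im (cint (fun x => -1 * ((x +i* (Im w + e))%C - w)^-1)
    (Re w - e) (Re w + e)).
  rewrite -(len (Re w)); apply: cint_Im_ge => //.
    by apply: segment_contM; exact: (bd_top sq2 cg).
  move=> x /rng xr; rewrite mulN1r invE ImN /= !(ReD, ImD, ReN, ImN) /= opprK.
  have -> : Im w + e - Im w = e by ring.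
  exact: inv.
have b3 : 1 <= Re (cint (fun x => (((Re w + e) +i* x)%C - w)^-1)
    (Im w - e) (Im w + e)).
  rewrite -(len (Im w)); apply: cint_Re_ge => //.
    exact: (bd_right sq1 cg).
  move=> x /rng xr; rewrite invE /= !(ReD, ImD, ReN, ImN) /=.
  have -> : Re w + e - Re w = e by ring.
  by rewrite addrC; apply: inv.
have b4 : 1 <= Re (cint (fun x => -1 * (((Re w - e) +i* x)%C - w)^-1)
    (Im w - e) (Im w + e)).
  rewrite -(len (Im w)); apply: cint_Re_ge => //.
    by apply: segment_contM; exact: (bd_left sq1 cg).
  move=> x /rng xr; rewrite mulN1r invE ReN /= !(ReD, ImD, ReN, ImN) /=.
  have -> : Re w - e - Re w = - e by ring.
  by rewrite mulNr opprK addrC; apply: inv => //; rewrite sqrrN.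
move: b2 b4; rewrite cintM; last exact: (bd_top sq2 cg).
rewrite cintM; last exact: (bd_left sq1 cg).
rewrite !mulN1r ImN ReN => b2 b4.
move: b1 b2 b3 b4.
set A := Im _; set B := Im _; set D := Re _; set E := Re _.
move: A B D E; clear => A B D E; lra.
Qed.

(** If [x > M], the powers of [x / M] grow at least linearly by Bernoulli and pass [K]. This is what
    removes multiplicative constants from estimates. *)
Lemma power_bound (x M K : R) : 0 <= x -> 0 <= M ->
  (forall N, x ^+ N <= K * M ^+ N) -> x <= M.
Proof.
move=> x0 M0 H; rewrite leNgt; apply/negP => Mx.
have xp : 0 < x by exact: le_lt_trans Mx.
(* The case [N = 1] excludes [M = 0]. *)
have := H 1%N; rewrite !expr1 => H1.
have Mp : 0 < M.
  by rewrite lt_neqAle M0 andbT; apply/eqP => E; move: H1; rewrite -E mulr0 leNgt xp.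
have tgt : 0 < x / M - 1 by rewrite subr_gt0 ltr_pdivlMr// mul1r.
have B N : 1 + N%:R * (x / M - 1) <= K.
  have : (x / M) ^+ N <= K by rewrite expr_div_n ler_pdivrMr ?exprn_gt0.
  apply: le_trans; elim: N => [|N IH]; first by rewrite mul0r addr0.
  rewrite exprS; apply: (@le_trans _ _ (x / M * (1 + N%:R * (x / M - 1)))).
    rewrite -natr1; set t := x / M - 1 in tgt *.
    have -> : x / M = 1 + t by rewrite /t subrKC.
    rewrite -subr_ge0 (_ : _ - _ = N%:R * t ^+ 2); last by ring.
    by rewrite mulr_ge0// sqr_ge0.
  by rewrite ler_wpM2l// divr_ge0.
have := B (Num.truncn (K / (x / M - 1))).+1.
apply/negP; rewrite -ltNge.
have := truncnS_gt (K / (x / M - 1)); rewrite ltr_pdivrMr// => /lt_trans; apply.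
by rewrite ltrDr.
Qed.

(** Cauchy's formula with an unspecified constant, applied to [G = g ^ N]: [(G z - G w) / (z - w)]
    integrates to 0 by [rect_int_exceptional], so [G w] times the winding integral is bounded by the
    values of [G] on the boundary. Since [w] need only be a point of continuity, the lemma applies
    to difference quotients. *)
Theorem rect_maximum g a b c d w M : rect_in a b c d w ->
  (forall z, rect a b c d z -> z != w -> cdiff g z) -> ccont g w ->
  (forall z, rect_bd a b c d z -> cmod (g z) <= M) -> cmod (g w) <= M.
Proof.
move=> wi gd gw gM.
have [ab cd] := rect_in_le wi.
have M0 : 0 <= M.
  apply: (le_trans (cmod_ge0 (g (a +i* c)%C))); apply: gM.
  by split; [split; rewrite /= lexx|apply: Or41].
have [e [e0 /(_ e e0 (lexx e))[ha hb hc hd]]] := rect_square wi.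
pose P := (b - a) + (d - c).
(* [P] is half the perimeter and [1 / e] bounds [1 / |z - w|] on the boundary; the 4 of
   [rect_int_le] cancels against the 4 of [winding_ge]. *)
apply: (@power_bound _ _ (P / e)); rewrite ?cmod_ge0// => N.
pose G z := g z ^+ N.
have Gd z : rect a b c d z -> z != w -> cdiff G z.
  by move=> zr zw; apply: cdiffX; exact: gd.
have Gw : ccont G w by exact: contcX.
pose K z := (G z - G w) * (z - w)^-1.
have iv z : z != w -> cdiff (fun z => (z - w)^-1) z.
  move=> zw; apply: cdiffV; first by rewrite subr_eq0.
  by apply: cdiffB; [exact: cdiff_id|exact: cdiff_cst].
have Kd z : rect a b c d z -> z != w -> cdiff K z.
  move=> zr zw; apply: cdiffM; last exact: iv.
  by apply: cdiffB; [exact: Gd|exact: cdiff_cst].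
have K0 : rect_int K a b c d = 0.
  apply: (rect_int_exceptional wi Kd) => t /Gw[r [r0 Hr]].
  exists r; split=> // h h0 /Hr Gh; rewrite /K.
  rewrite [w + h]addrC addrK cmodM cmodV [h + w]addrC.
  by rewrite ler_wpM2r// invr_ge0 cmod_ge0.
have bdx z : rect_bd a b c d z -> z != w by exact: rect_in_bd.
have cK : bd_cont K a b c d.
  by move=> z zb; apply/cdiff_cont/Kd; [case: zb|exact: bdx].
have cI : bd_cont (fun z => (z - w)^-1) a b c d.
  by move=> z zb; apply/cdiff_cont/iv; exact: bdx.
have cGI : bd_cont (fun z => G w * (z - w)^-1) a b c d.
  by move=> z zb; apply: contcM; [exact: contc_cst|exact: cI].
have E : rect_int (fun z => K z + G w * (z - w)^-1) a b c d =
    G w * rect_int (fun z => (z - w)^-1) a b c d.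
  by rewrite rect_intD// K0 add0r rect_intM.
have KE z : K z + G w * (z - w)^-1 = G z * (z - w)^-1.
  by rewrite /K -mulrDl subrK.
have up : cmod (rect_int (fun z => K z + G w * (z - w)^-1) a b c d) <=
    4 * (M ^+ N / e * P).
  apply: rect_int_le => // [z zb|z zb].
    by apply: contcD; [exact: cK|exact: cGI].
  rewrite KE cmodM cmodV; apply: ler_pM; rewrite ?cmod_ge0 ?invr_ge0 ?cmod_ge0//.
    by rewrite /G cmodX lerXn2r ?nnegrE ?cmod_ge0// gM.
  have zw := bdx z zb.
  rewrite lef_pV2 ?posrE ?cmod_gt0 ?subr_eq0//.
  have h1 := cmod_Re (z - w); have h2 := cmod_Im (z - w).
  move: h1 h2; rewrite ReD ImD ReN ImN => h1 h2.
  case: zb => _ [] E1; rewrite E1 in h1 h2.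
  - by apply: le_trans h1; rewrite distrC ler_normr; move: ha; clear => ?; apply/orP; left; lra.
  - by apply: le_trans h1; rewrite ler_normr; move: hb; clear => ?; apply/orP; left; lra.
  - by apply: le_trans h2; rewrite distrC ler_normr; move: hc; clear => ?; apply/orP; left; lra.
  - by apply: le_trans h2; rewrite ler_normr; move: hd; clear => ?; apply/orP; left; lra.
have wd := winding_ge wi.
rewrite E cmodM in up.
have low : 4 <= cmod (rect_int (fun z => (z - w)^-1) a b c d).
  by apply: (le_trans wd); apply: (le_trans (ler_norm _)); exact: cmod_Im.
have := le_trans (ler_wpM2l (cmod_ge0 (G w)) low) up.
rewrite mulrC ler_pM2l// /G cmodX => /le_trans; apply.
by rewrite [_ / _ * _]mulrC -!mulrA [e^-1 * _]mulrC.
Qed.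

End MaximumPrinciple.

(** * Several complex variables: differentials and Cauchy estimates *)

Section Vectors.
Variable R : realType.
Local Notation C := R[i].
Implicit Types (k t : C).

(** The maximum norm with real values; the norm of ['rV[C]_n] is the same number read in [C]
    ([norm_vmod]). *)
Definition vmod n (x : 'rV[C]_n) : R := \big[Num.max/0]_(i < n) cmod (x 0 i).

Section Norm.
Variable n : nat.
Implicit Types x y h : 'rV[C]_n.

Lemma vmod_leP x M : 0 <= M -> vmod x <= M <-> forall i, cmod (x 0 i) <= M.
Proof.
move=> M0; split=> [xM i|H]; first by apply: le_trans xM; exact: le_bigmax.
by apply/bigmax_leP; split.
Qed.

Lemma vmod_ltP x M : 0 < M -> vmod x < M <-> forall i, cmod (x 0 i) < M.
Proof.
move=> M0; split=> [xM i|H]; first by apply: le_lt_trans xM; exact: le_bigmax.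
by apply/bigmax_ltP; split.
Qed.

Lemma vmod_coord x i : cmod (x 0 i) <= vmod x.
Proof. exact: le_bigmax. Qed.

Lemma vmod_ge0 x : 0 <= vmod x.
Proof. exact: bigmax_ge_id. Qed.

Lemma vmod0 : vmod (0 : 'rV[C]_n) = 0.
Proof.
apply/le_anti; rewrite vmod_ge0 andbT; apply/vmod_leP => // i.
by rewrite mxE cmod0.
Qed.

Lemma vmodD x y : vmod (x + y) <= vmod x + vmod y.
Proof.
apply/vmod_leP => [|i]; first by rewrite addr_ge0// vmod_ge0.
by rewrite mxE (le_trans (cmodD _ _))// lerD// vmod_coord.
Qed.

Lemma vmodZ k x : vmod (k *: x) = cmod k * vmod x.
Proof.
apply/le_anti/andP; split.
  apply/vmod_leP => [|i]; first by rewrite mulr_ge0// ?cmod_ge0 ?vmod_ge0.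
  by rewrite mxE cmodM ler_wpM2l ?cmod_ge0 ?vmod_coord.
have [->|k0] := eqVneq k 0; first by rewrite cmod0 mul0r vmod_ge0.
rewrite mulrC -ler_pdivlMr ?cmod_gt0//; apply/vmod_leP => [|i].
  by rewrite divr_ge0 ?vmod_ge0 ?cmod_ge0.
rewrite ler_pdivlMr ?cmod_gt0// mulrC -cmodM.
by apply: le_trans (vmod_coord _ i); rewrite mxE.
Qed.

Lemma vmodN x : vmod (- x) = vmod x.
Proof. by rewrite -scaleN1r vmodZ cmodN cmod1 mul1r. Qed.

Lemma vmod_distC x y : vmod (x - y) = vmod (y - x).
Proof. by rewrite -vmodN opprB. Qed.

Lemma vmod_eq0 x : (vmod x == 0) = (x == 0).
Proof.
apply/eqP/eqP => [x0|->]; last exact: vmod0.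
apply/rowP => i; rewrite mxE; apply/eqP; rewrite -cmod_eq0; apply/eqP/le_anti.
by rewrite cmod_ge0 andbT -x0 vmod_coord.
Qed.

Lemma vmod_gt0 x : (0 < vmod x) = (x != 0).
Proof. by rewrite lt_neqAle vmod_ge0 andbT eq_sym vmod_eq0. Qed.

Lemma norm_vmod x : `|x| = ((vmod x)%:C)%C.
Proof.
apply/le_anti/andP; split.
  have v0 : 0 <= ((vmod x)%:C)%C by rewrite (lecR 0) vmod_ge0.
  rewrite -[leLHS]/(mx_norm x) mx_normE -[leRHS]/((NngNum v0)%:num) num_le.
  apply/bigmax_leP; split=> [|[i j] _]; first by rewrite -num_le.
  by rewrite -num_le /= ord1 norm_cmod lecR vmod_coord.
have rx : `|x| = ((Re `|x|)%:C)%C by rewrite RRe_real// normr_real.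
rewrite rx lecR; apply/vmod_leP => [|i].
  by rewrite -lecR -rx normr_ge0.
rewrite -lecR -norm_cmod -rx -[leRHS]/(mx_norm x) mx_normE.
rewrite -[leLHS]nngE num_le.
exact: (le_bigmax _ (fun ij : 'I_1 * 'I_n => `|x ij.1 ij.2|%:nng) (0, i)).
Qed.

Definition vball x (r : R) : set 'rV[C]_n := [set y | vmod (y - x) < r].

Definition vopen (U : set 'rV[C]_n) := forall x, U x ->
  exists r : R, 0 < r /\ vball x r `<=` U.

Lemma vball_center x r : 0 < r -> vball x r x.
Proof. by rewrite /vball /= subrr vmod0. Qed.

Lemma vball_sub x y r s : vmod (y - x) + s <= r -> vball y s `<=` vball x r.
Proof.
move=> yx z; rewrite /vball /= => zy.
have -> : z - x = (z - y) + (y - x) by rewrite addrA subrK.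
apply: (le_lt_trans (vmodD _ _)).
by apply: lt_le_trans yx; rewrite addrC ltrD2l.
Qed.

Lemma vopen_ball x r : vopen (vball x r).
Proof.
move=> y yx; exists (r - vmod (y - x)); split; first by rewrite subr_gt0.
by apply: vball_sub; rewrite subrKC.
Qed.

Lemma vnbhsP x (P : set 'rV[C]_n) :
  nbhs x P <-> exists r : R, 0 < r /\ vball x r `<=` P.
Proof.
split=> [/nbhs_normP[d /= d0 Hd]|[d [d0 Hd]]].
  move: d0; rewrite ltcE => /andP[/eqP /= d1 d0].
  exists (Re d); split=> // h hd; apply: Hd; rewrite /ball_/=.
  rewrite norm_vmod.
  have -> : d = ((Re d)%:C)%C by apply: cplx_eq.
  by rewrite ltcR vmod_distC.
apply/(@nbhs_normP C _ x P); exists (d%:C)%C => /=; first by rewrite (ltcR 0).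
by move=> y; rewrite /ball_/= norm_vmod ltcR vmod_distC; exact: Hd.
Qed.

Lemma vopenP (U : set 'rV[C]_n) : vopen U <-> open U.
Proof.
rewrite openE; split=> [H x /H/vnbhsP//|H x /H/vnbhsP//].
Qed.

End Norm.

Section Differential.
Variable n : nat.
Implicit Types (x y h v : 'rV[C]_n) (f g : 'rV[C]_n -> C) (G : 'cV[C]_n).

(** Linear forms are columns, so that the chain rule becomes multiplication by the Jacobian
    matrix. *)
Definition app G v : C := (v *m G) 0 0.

Lemma appE G v : app G v = \sum_i v 0 i * G i 0.
Proof. by rewrite /app mxE. Qed.

Lemma appD G v w : app G (v + w) = app G v + app G w.
Proof. by rewrite /app mulmxDl mxE. Qed.

Lemma appZ G k v : app G (k *: v) = k * app G v.
Proof. by rewrite /app -scalemxAl mxE. Qed.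

Lemma appN G v : app G (- v) = - app G v.
Proof. by rewrite /app mulNmx mxE. Qed.

Lemma app0 G : app G 0 = 0.
Proof. by rewrite /app mul0mx mxE. Qed.

Lemma appDl G H v : app (G + H) v = app G v + app H v.
Proof. by rewrite /app mulmxDr mxE. Qed.

Lemma appZl G k v : app (k *: G) v = k * app G v.
Proof. by rewrite /app -scalemxAr mxE. Qed.

Lemma appNl G v : app (- G) v = - app G v.
Proof. by rewrite -scaleN1r appZl mulN1r. Qed.

Lemma app_delta G i : app G (delta_mx 0 i) = G i 0.
Proof. by rewrite /app -rowE mxE. Qed.

Definition gmod G : R := \sum_i cmod (G i 0).

Lemma gmod_ge0 G : 0 <= gmod G.
Proof. by apply: sumr_ge0 => i _; exact: cmod_ge0. Qed.

Lemma cmod_sum (I : finType) (F : I -> C) :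
  cmod (\sum_i F i) <= \sum_i cmod (F i).
Proof.
elim/big_ind2: _ => //; first by rewrite cmod0.
by move=> a b u w au bw; apply: (le_trans (cmodD _ _)); exact: lerD.
Qed.

Lemma app_le G v : cmod (app G v) <= gmod G * vmod v.
Proof.
rewrite appE (le_trans (cmod_sum _))// mulr_suml ler_sum// => i _.
by rewrite cmodM mulrC ler_wpM2l ?cmod_ge0 ?vmod_coord.
Qed.

(** Frechet differentiability in real-valued norms, with the differential given by its coordinates;
    [differentiable_sdiff] and [sdiff_differentiable] translate. *)
Definition sder f x G := forall e : R, 0 < e -> exists d, 0 < d /\
  forall h, vmod h < d -> cmod (f (x + h) - f x - app G h) <= e * vmod h.

Definition sdiff f x := exists G, sder f x G.

Definition grad f x : 'cV[C]_n := xget 0 [set G | sder f x G].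

Lemma grad_sder f x : sdiff f x -> sder f x (grad f x).
Proof. by case=> G Gf; rewrite /grad; case: xgetP => [//|/(_ G)]. Qed.

Definition scont f x := forall e : R, 0 < e -> exists d, 0 < d /\
  forall y, vball x d y -> cmod (f y - f x) <= e.

Lemma sder_cont f x G : sder f x G -> scont f x.
Proof.
move=> fG e e0; have [d [d0 Hd]] := fG 1 ltr01.
have g0 : 0 < 1 + gmod G by rewrite ltr_pwDl// gmod_ge0.
exists (Order.min d (e / (1 + gmod G))); split.
  by rewrite lt_min d0 divr_gt0.
move=> y; rewrite /vball /= lt_min => /andP[/Hd yd ye].
move: yd; rewrite subrKC mul1r => yd.
have -> : f y - f x = (f y - f x - app G (y - x)) + app G (y - x) by ring.
apply: (le_trans (cmodD _ _)); apply: (le_trans (lerD yd (app_le _ _))).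
by rewrite -[X in X + _]mul1r -mulrDl mulrC -ler_pdivlMr// ltW.
Qed.

Lemma sdiff_cont f x : sdiff f x -> scont f x.
Proof. by case=> G /sder_cont. Qed.

Lemma scont_bounded f x : scont f x -> exists M d : R, [/\ 0 < M, 0 < d &
  forall y, vball x d y -> cmod (f y) <= M].
Proof.
move=> /(_ 1 ltr01)[d [d0 Hd]]; exists (1 + cmod (f x)), d; split=> //.
  by rewrite ltr_pwDl// cmod_ge0.
move=> y /Hd yx; rewrite -(subrK (f x) (f y)).
by rewrite (le_trans (cmodD _ _))// lerD2r.
Qed.

Lemma sder_slice f x v t G : sder f (x + t *: v) G ->
  cder (fun s => f (x + s *: v)) t (app G v).
Proof.
move=> fG; apply/cder_epsP => e e0.
have v0 : 0 < vmod v + 1 by rewrite ltr_wpDl// vmod_ge0.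
have [d [d0 Hd]] := fG _ (divr_gt0 e0 v0).
exists (d / (vmod v + 1)); split=> [|h hd]; first exact: divr_gt0.
have h1 : vmod (h *: v) < d.
  rewrite vmodZ; apply: (@le_lt_trans _ _ (cmod h * (vmod v + 1))).
    by rewrite ler_wpM2l ?cmod_ge0// lerDl.
  by rewrite -ltr_pdivlMr.
have := Hd _ h1; rewrite appZ -[x + _ + h *: v]addrA -scalerDl => /le_trans; apply.
rewrite vmodZ (_ : _ * _ = e * cmod h * (vmod v / (vmod v + 1))); last by ring.
rewrite ler_piMr//; first by rewrite mulr_ge0 ?cmod_ge0// ltW.
by rewrite ler_pdivrMr// mul1r lerDl.
Qed.

Lemma sder_unique f x G H : sder f x G -> sder f x H -> G = H.
Proof.
move=> fG fH; apply/colP => i.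
have fG' v : sder f (x + 0 *: v) G by rewrite scale0r addr0.
have fH' v : sder f (x + 0 *: v) H by rewrite scale0r addr0.
have := cder_unique (sder_slice (fG' (delta_mx 0 i))) (sder_slice (fH' (delta_mx 0 i))).
by rewrite !app_delta.
Qed.

Lemma gradE f x G : sder f x G -> grad f x = G.
Proof. by move=> fG; apply: (@sder_unique f x) => //; apply: grad_sder; exists G. Qed.

Lemma sder_near f g x r G : 0 < r -> (forall y, vball x r y -> f y = g y) ->
  sder f x G -> sder g x G.
Proof.
move=> r0 fg fG e /fG[d [d0 Hd]]; exists (Order.min d r); split.
  by rewrite lt_min d0.
move=> h; rewrite lt_min => /andP[/Hd hd hr].
rewrite -!fg//; first exact: vball_center.
by rewrite /vball /= [x + h]addrC addrK.
Qed.

Lemma sder_cst k x : sder (fun=> k) x 0.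
Proof.
move=> e e0; exists 1; split=> // h _.
by rewrite subrr /app mulmx0 mxE subrr cmod0 mulr_ge0 ?vmod_ge0// ltW.
Qed.

Lemma sder_app G x : sder (app G) x G.
Proof.
move=> e e0; exists 1; split=> // h _.
by rewrite appD [app G x + _]addrC addrK subrr cmod0 mulr_ge0 ?vmod_ge0// ltW.
Qed.

Lemma sderD f g x G H : sder f x G -> sder g x H ->
  sder (fun y => f y + g y) x (G + H).
Proof.
move=> fG gH e e0; have e2 : 0 < e / 2 by rewrite divr_gt0.
have [d [d0 Hd]] := fG _ e2; have [c [c0 Hc]] := gH _ e2.
exists (Order.min d c); split=> [|h]; first by rewrite lt_min d0.
rewrite lt_min => /andP[/Hd h1 /Hc h2]; rewrite appDl.
have -> : f (x + h) + g (x + h) - (f x + g x) - (app G h + app H h) =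
  (f (x + h) - f x - app G h) + (g (x + h) - g x - app H h) by ring.
rewrite (le_trans (cmodD _ _))// (le_trans (lerD h1 h2))// -mulrDl.
by rewrite -splitr.
Qed.

Lemma sderM f g x G H : sder f x G -> sder g x H ->
  sder (fun y => f y * g y) x (g x *: G + f x *: H).
Proof.
move=> fG gH e e0.
have cg := sder_cont gH.
have A0 : 0 < 1 + cmod (g x) + cmod (f x) + gmod G.
  by rewrite -!addrA ltr_pwDl// !addr_ge0 ?cmod_ge0 ?gmod_ge0.
(* [A] adds up the coefficients of the three error terms; [e1 <= 1] serves to bound [g (x + h)] by
   [1 + |g x|]. *)
set A := (_ + _ + _ + _) in A0; pose e1 := Order.min 1 (e / (2 * A)).
have e10 : 0 < e1 by rewrite lt_min ltr01 divr_gt0// mulr_gt0.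
have [d [d0 Hd]] := fG _ e10; have [c [c0 Hc]] := gH _ e10.
have [b [b0 Hb]] := cg _ e10.
exists (Order.min d (Order.min c b)); split=> [|h]; first by rewrite !lt_min d0 c0.
rewrite !lt_min => /andP[/Hd h1 /andP[/Hc h2 hb]]; rewrite appDl !appZl.
have h3 : cmod (g (x + h) - g x) <= e1.
  by apply: Hb; rewrite /vball /= [x + h]addrC addrK.
have -> : f (x + h) * g (x + h) - f x * g x - (g x * app G h + f x * app H h) =
  (f (x + h) - f x - app G h) * g (x + h) +
  (f x * (g (x + h) - g x - app H h) + app G h * (g (x + h) - g x)) by ring.
have v0 := vmod_ge0 h.
have e11 : e1 <= 1 by rewrite ge_min lexx.
have g1 : cmod (g (x + h)) <= 1 + cmod (g x).
  rewrite -(subrK (g x) (g (x + h))) (le_trans (cmodD _ _))// lerD2r.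
  exact: le_trans h3 e11.
have k1 : cmod ((f (x + h) - f x - app G h) * g (x + h)) <=
    e1 * vmod h * (1 + cmod (g x)).
  by rewrite cmodM ler_pM ?cmod_ge0.
have k2 : cmod (f x * (g (x + h) - g x - app H h)) <= cmod (f x) * (e1 * vmod h).
  by rewrite cmodM ler_wpM2l ?cmod_ge0.
have k3 : cmod (app G h * (g (x + h) - g x)) <= gmod G * vmod h * e1.
  by rewrite cmodM ler_pM ?cmod_ge0// app_le.
apply: (le_trans (cmodD _ _)); apply: (le_trans (lerD k1 (le_trans (cmodD _ _) (lerD k2 k3)))).
rewrite (_ : _ + _ = e1 * A * vmod h); last by rewrite /A; ring.
rewrite ler_wpM2r// -ler_pdivlMr//; apply: (@le_trans _ _ (e / (2 * A))).
  by rewrite ge_min lexx orbT.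
rewrite ler_wpM2l ?(ltW e0)// lef_pV2 ?posrE ?mulr_gt0//.
by rewrite mulr_natl mulr2n lerDl ltW.
Qed.

Lemma sder_compl f x G (u : C -> C) m : sder f x G -> cder u (f x) m ->
  sder (fun y => u (f y)) x (m *: G).
Proof.
move=> fG [q [<- cq uq]] e e0.
have A0 : 0 < 1 + cmod (q 0) + gmod G.
  by rewrite -!addrA ltr_pwDl// !addr_ge0 ?cmod_ge0 ?gmod_ge0.
set A := (_ + _) in A0; pose e1 := Order.min 1 (e / (2 * A)).
have e10 : 0 < e1 by rewrite lt_min ltr01 divr_gt0// mulr_gt0.
have e11 : e1 <= 1 by rewrite ge_min lexx.
have [c [c0 Hc]] := cq _ e10.
have c20 : 0 < c / 2 by rewrite divr_gt0.
have [b [b0 Hb]] := sder_cont fG c20.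
have [d [d0 Hd]] := fG _ e10.
exists (Order.min d b); split=> [|h]; first by rewrite lt_min d0.
rewrite lt_min => /andP[/Hd h1 hb]; rewrite appZl.
have h3 : cmod (f (x + h) - f x) < c.
  apply: (@le_lt_trans _ _ (c / 2)).
    by apply: Hb; rewrite /vball /= [x + h]addrC addrK.
  by rewrite ltr_pdivrMr// mulr_natr mulr2n ltrDl.
have := uq (f (x + h) - f x); rewrite subrKC => ->.
have {Hc}h4 := Hc _ h3; rewrite add0r in h4.
set k := f (x + h) - f x in h1 h3 h4 *.
have -> : u (f x) + k * q k - u (f x) - q 0 * app G h =
  (k - app G h) * q k + app G h * (q k - q 0) by ring.
have v0 := vmod_ge0 h.
have q1 : cmod (q k) <= 1 + cmod (q 0).
  rewrite -(subrK (q 0) (q k)) (le_trans (cmodD _ _))// lerD2r.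
  exact: le_trans h4 e11.
have k1 : cmod ((k - app G h) * q k) <= e1 * vmod h * (1 + cmod (q 0)).
  by rewrite cmodM ler_pM ?cmod_ge0.
have k2 : cmod (app G h * (q k - q 0)) <= gmod G * vmod h * e1.
  by rewrite cmodM ler_pM ?cmod_ge0// app_le.
apply: (le_trans (cmodD _ _)); apply: (le_trans (lerD k1 k2)).
rewrite (_ : _ + _ = e1 * A * vmod h); last by rewrite /A; ring.
rewrite ler_wpM2r// -ler_pdivlMr//; apply: (@le_trans _ _ (e / (2 * A))).
  by rewrite ge_min lexx orbT.
rewrite ler_wpM2l ?(ltW e0)// lef_pV2 ?posrE ?mulr_gt0//.
by rewrite mulr_natl mulr2n lerDl ltW.
Qed.

Lemma sdiff_cst k x : sdiff (fun=> k) x.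
Proof. by exists 0; exact: sder_cst. Qed.

Lemma sdiff_app G x : sdiff (app G) x.
Proof. by exists G; exact: sder_app. Qed.

Lemma sdiffD f g x : sdiff f x -> sdiff g x -> sdiff (fun y => f y + g y) x.
Proof. by move=> [G fG] [H gH]; exists (G + H); exact: sderD. Qed.

Lemma sdiffM f g x : sdiff f x -> sdiff g x -> sdiff (fun y => f y * g y) x.
Proof. by move=> [G fG] [H gH]; eexists; exact: (sderM fG gH). Qed.

Lemma sdiffZ k f x : sdiff f x -> sdiff (fun y => k * f y) x.
Proof. by move=> fx; apply: sdiffM => //; exact: sdiff_cst. Qed.

Lemma sdiffB f g x : sdiff f x -> sdiff g x -> sdiff (fun y => f y - g y) x.
Proof.
move=> fx gx; rewrite (_ : (fun y => _) = fun y => f y + (-1) * g y).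
  by apply: sdiffD => //; exact: sdiffZ.
by apply/funext => y; rewrite mulN1r.
Qed.

Lemma sdiffV f x : f x != 0 -> sdiff f x -> sdiff (fun y => (f y)^-1) x.
Proof.
move=> fx0 [G fG]; eexists; apply: (sder_compl fG).
exact: (cderV fx0 (cder_id (f x))).
Qed.

Lemma sdiff_sum (I : Type) (s : seq I) (P : pred I) (F : I -> 'rV[C]_n -> C) x :
  (forall i, P i -> sdiff (F i) x) -> sdiff (fun y => \sum_(i <- s | P i) F i y) x.
Proof.
move=> H; elim: s => [|i s IH].
  rewrite (_ : (fun y => _) = fun=> 0); first exact: sdiff_cst.
  by apply/funext => y; rewrite big_nil.
case: (boolP (P i)) => Pi.
  rewrite (_ : (fun y => _) = fun y => F i y + \sum_(i <- s | P i) F i y).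
    by apply: sdiffD => //; exact: H.
  by apply/funext => y; rewrite big_cons Pi.
rewrite (_ : (fun y => _) = fun y => \sum_(i <- s | P i) F i y) //.
by apply/funext => y; rewrite big_cons (negbTE Pi).
Qed.

Lemma sdiff_prod (I : Type) (s : seq I) (F : I -> 'rV[C]_n -> C) x :
  (forall i, sdiff (F i) x) -> sdiff (fun y => \prod_(i <- s) F i y) x.
Proof.
move=> H; elim: s => [|i s IH].
  rewrite (_ : (fun y => _) = fun=> 1); first exact: sdiff_cst.
  by apply/funext => y; rewrite big_nil.
rewrite (_ : (fun y => _) = fun y => F i y * \prod_(i <- s) F i y).
  exact: sdiffM.
by apply/funext => y; rewrite big_cons.
Qed.

Lemma sdiff_shift f x v : sdiff f (x + v) -> sdiff (fun y => f (y + v)) x.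
Proof.
case=> G fG; exists G => e /fG[d [d0 Hd]]; exists d; split=> // h /Hd H.
by rewrite [x + h + v]addrAC.
Qed.

Lemma sdiff_slice f x v t : sdiff f (x + t *: v) ->
  cdiff (fun s => f (x + s *: v)) t.
Proof. by case=> G fG; exists (app G v); exact: sder_slice. Qed.

End Differential.

End Vectors.

(** * Mean value inequality and Cauchy estimates *)

Section CauchyEstimates.
Variable R : realType.
Local Notation C := R[i].

(** Bisection again: of a segment violating the slope bound [A + e] one half violates it. The limit
    point lies in all these segments, and adding the local bounds on its two sides gives a
    contradiction. *)
Lemma mean_value (u : R -> C) (A : R) :
  (forall t, 0 <= t <= 1 -> forall e, 0 < e -> exists d, 0 < d /\
    forall s, `|s - t| < d -> cmod (u s - u t) <= (A + e) * `|s - t|) ->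
  cmod (u 1 - u 0) <= A.
Proof.
move=> H; apply/ler_addgt0Pr => e e0; rewrite leNgt; apply/negP => bad.
pose ok (Q : R * R) := [/\ 0 <= Q.1, Q.1 <= Q.2, Q.2 <= 1 &
  (A + e) * (Q.2 - Q.1) < cmod (u Q.2 - u Q.1)].
pose nxt (Q Q' : R * R) := [/\ ok Q', Q.1 <= Q'.1, Q'.2 <= Q.2 &
  Q'.2 - Q'.1 = (Q.2 - Q.1) / 2].
have stepP Q : exists Q', ok Q -> nxt Q Q'.
  case: (pselect (ok Q)) => [okQ|nQ]; last by exists Q.
  case: Q okQ => [p q] [/= p0 pq q1 bpq].
  have /andP[pm mq] := rect_mid pq.
  have hl := half_left p q; have hr := half_right p q.
  set m := (p + q) / 2 in pm mq hl hr.
  have [b1|b1] := ltP ((A + e) * (m - p)) (cmod (u m - u p)).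
    exists (p, m) => _; split=> //; split=> //=; exact: le_trans q1.
  exists (m, q) => _; split=> //; split=> //=; first exact: le_trans pm.
  have := cmodD (u q - u m) (u m - u p); rewrite subrKA => tri.
  rewrite ltNge; apply/negP => b2.
  have := lt_le_trans bpq (le_trans tri (lerD b2 b1)).
  by rewrite -mulrDr subrKA ltxx.
have [F FP] := choice stepP.
pose Q k := iter k F (0, 1).
have okQ k : ok (Q k).
  elim: k => [|k /FP[]//]; split=> //=.
  by rewrite subr0 mulr1.
have nQ k : nxt (Q k) (Q k.+1) by exact: FP.
have [x Hx] : exists x, forall k, (Q k).1 <= x <= (Q k).2.
  by apply: nested_intervals => k; [case: (nQ k)|case: (nQ k)|case: (okQ k)].
have sides k : (Q k).2 - (Q k).1 = 1 / 2 ^+ k.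
  elim: k => [|k IH]; first by rewrite expr0 divr1 /= subr0.
  case: (nQ k) => _ _ _ ->; rewrite IH exprS.
  by field; rewrite expf_neq0.
have [d [d0 Hd]] := H x (Hx 0%N) e e0.
have [k Hk] := pow2_small 1 d0.
case: (okQ k) => _ _ _; apply/negP; rewrite -leNgt.
have /andP[xa xb] := Hx k; rewrite -sides in Hk.
move: (Q k) xa xb Hk => [p q] /= px xq pqd.
have tri := cmodD (u q - u x) (u x - u p); rewrite subrKA in tri.
apply: (le_trans tri).
have h1 : cmod (u q - u x) <= (A + e) * (q - x).
  rewrite -[q - x]ger0_norm ?subr_ge0//; apply: Hd.
  by rewrite ger0_norm ?subr_ge0//; apply: le_lt_trans pqd; rewrite lerD2l lerN2.
have h2 : cmod (u x - u p) <= (A + e) * (x - p).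
  rewrite cmod_distC -[x - p]ger0_norm ?subr_ge0// distrC; apply: Hd.
  by rewrite distrC ger0_norm ?subr_ge0//; apply: le_lt_trans pqd; rewrite lerD2r.
by apply: (le_trans (lerD h1 h2)); rewrite -mulrDr subrKA.
Qed.

Lemma square_cmod (s : R) (z : C) : rect (- s) s (- s) s z -> cmod z <= 2 * s.
Proof.
case=> h1 h2; apply: (le_trans (cmod_le z)); rewrite mulr_natl mulr2n.
by rewrite lerD// ler_norml.
Qed.

Lemma square0_bd (s : R) (z : C) : 0 < s -> rect_bd (- s) s (- s) s z -> s <= cmod z.
Proof.
move=> s0 zb; rewrite -[z]subr0; apply: square_bd => //=.
by rewrite !add0r.
Qed.

Lemma square0_in (s : R) : 0 < s -> rect_in (- s) s (- s) s (0 : C).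
Proof. by move=> s0; split => /=; rewrite oppr_lt0 s0. Qed.

(** The maximum principle for the difference quotient at 0, completed by the value [m]; 0 is its
    exceptional point. On the boundary of the square its numerator is at most [2 M] and its
    denominator at least [s]. *)
Lemma cauchy_disc (f : C -> C) (m : C) (s M : R) : 0 < s ->
  (forall z, cmod z <= 2 * s -> cdiff f z) ->
  (forall z, cmod z <= 2 * s -> cmod (f z) <= M) ->
  cder f 0 m -> cmod m <= 2 * M / s.
Proof.
move=> s0 fd fM [q [<- cq fq]].
apply: (@rect_maximum _ _ (- s) s (- s) s) => //.
- exact: square0_in.
- move=> z zr z0.
  have zp : 0 < cmod z by rewrite cmod_gt0.
  apply: (@cdiff_near _ (fun h => (f h - f 0) / h) _ _ (cmod z)) => // [h hz|].
    have zh : z + h != 0.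
      by apply: contraTneq hz => /eqP; rewrite addr_eq0 => /eqP ->; rewrite cmodN ltxx.
    have := fq (z + h); rewrite add0r => ->.
    by rewrite [f 0 + _]addrC addrK mulrC mulKf.
  apply: cdiffM; last by apply: cdiffV => //; exact: cdiff_id.
  by apply: cdiffB; [exact/fd/square_cmod|exact: cdiff_cst].
- move=> z zb; have zs := square0_bd s0 zb.
  have zp : 0 < cmod z by exact: lt_le_trans zs.
  have zM : cmod z <= 2 * s by apply: square_cmod; case: zb.
  have z0 : z != 0 by rewrite -cmod_gt0.
  have -> : q z = (f z - f 0) / z.
    by have := fq z; rewrite add0r => ->; rewrite [f 0 + _]addrC addrK mulrC mulKf.
  have M0 : cmod (f 0) <= M by apply: fM; rewrite cmod0 mulr_ge0// ltW.
  rewrite cmodM cmodV; apply: ler_pM; rewrite ?cmod_ge0 ?invr_ge0 ?cmod_ge0//.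
    rewrite (le_trans (cmodD _ _))// cmodN mulr_natl mulr2n lerD//.
    exact: fM.
  by rewrite lef_pV2.
Qed.

Lemma ler_divSn (r : R) k : 0 < r -> r / k.+1%:R <= r.
Proof.
by move=> r0; rewrite ler_pdivrMr// ler_peMr ?(ltW r0)// ler1n.
Qed.

Section Several.
Variable n : nat.
Implicit Types (x y h v p : 'rV[C]_n) (f g : 'rV[C]_n -> C).

Definition bhol f p r M := (forall x, vball p r x -> sdiff f x) /\
  (forall x, vball p r x -> cmod (f x) <= M).

Lemma bhol_sub f p r M q s : vmod (q - p) + s <= r -> bhol f p r M -> bhol f q s M.
Proof. by move=> /vball_sub sb [h1 h2]; split=> x /sb; [exact: h1|exact: h2]. Qed.

Lemma bhol_ge0 f p r M : 0 < r -> bhol f p r M -> 0 <= M.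
Proof.
move=> r0 [_ /(_ p (vball_center p r0))]; apply: le_trans; exact: cmod_ge0.
Qed.

Lemma cauchy_center f p r M G v : 0 < r -> bhol f p r M -> sder f p G ->
  cmod (app G v) <= 8 * M / r * vmod v.
Proof.
move=> r0 [fd fM] fG; have [->|v0] := eqVneq v 0.
  by rewrite app0 cmod0 vmod0 mulr0.
rewrite -vmod_gt0 in v0.
(* [cauchy_disc] looks at parameters up to twice this radius, that is at points within [r / 2] of
   [p]. *)
have s0 : 0 < r / (4 * vmod v) by rewrite divr_gt0// mulr_gt0.
have inb z : cmod z <= 2 * (r / (4 * vmod v)) -> vball p r (p + z *: v).
  move=> zs; rewrite /vball /= [p + _]addrC addrK vmodZ.
  rewrite -ltr_pdivlMr//; apply: (le_lt_trans zs).
  rewrite ltr_pdivlMr//.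
  have -> : 2 * (r / (4 * vmod v)) * vmod v = r / 2 by field; rewrite gt_eqF.
  by rewrite ltr_pdivrMr// mulr_natr mulr2n ltrDl.
have fG0 : sder f (p + 0 *: v) G by rewrite scale0r addr0.
have := @cauchy_disc (fun t => f (p + t *: v)) _ _ M s0 _ _ (sder_slice fG0).
rewrite (_ : 8 * M / r * vmod v = 2 * M / (r / (4 * vmod v))); last first.
  by field; rewrite !gt_eqF.
apply=> z /inb zb; last exact: fM.
exact/sdiff_slice/fd.
Qed.

Lemma vball_convex p r x y (t : R) : vball p r x -> vball p r y -> 0 <= t <= 1 ->
  vball p r (x + (t%:C)%C *: (y - x)).
Proof.
move=> xp yp /andP[t0 t1]; rewrite /vball /=.
have -> : x + (t%:C)%C *: (y - x) - p =
    ((1 - t)%:C)%C *: (x - p) + (t%:C)%C *: (y - p).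
  by apply/rowP => i; rewrite !mxE rmorphB rmorph1; ring.
apply: (le_lt_trans (vmodD _ _)); rewrite !vmodZ !cmodR.
rewrite !ger0_norm ?subr_ge0//.
have -> : r = (1 - t) * r + t * r by ring.
have [->|tn] := eqVneq t 0; first by rewrite subr0 !mul0r !addr0 !mul1r.
rewrite ler_ltD//; first by rewrite ler_wpM2l ?subr_ge0// ltW.
by rewrite ltr_pM2l// lt_neqAle eq_sym tn.
Qed.

Lemma mean_value_segment f x y B :
  (forall t : R, 0 <= t <= 1 -> exists G, sder f (x + (t%:C)%C *: (y - x)) G /\
     cmod (app G (y - x)) <= B) ->
  cmod (f y - f x) <= B.
Proof.
move=> H.
pose u (t : R) := f (x + (t%:C)%C *: (y - x)).
have -> : f y - f x = u 1 - u 0 by rewrite /u scale1r subrKC scale0r addr0.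
apply: mean_value => t tb e e0.
have [G [fG GA]] := H _ tb.
have [q [q0 cq uq]] := sder_slice fG.
have [d [d0 Hd]] := cq e e0.
exists d; split=> // s sd.
have Es : f (x + (s%:C)%C *: (y - x)) =
    f (x + (t%:C)%C *: (y - x)) + ((s - t)%:C)%C * q ((s - t)%:C)%C.
  by have := uq ((s - t)%:C)%C; rewrite rmorphB subrKC.
rewrite /u Es [f _ + _]addrC addrK cmodM cmodR mulrC ler_wpM2r//.
have : cmod ((s - t)%:C)%C < d by rewrite cmodR.
move=> /Hd; rewrite add0r q0 => h1.
rewrite -(subrK (app G (y - x)) (q _)).
by rewrite (le_trans (cmodD _ _))// addrC lerD.
Qed.

Lemma mean_value_ball f p r A x y :
  (forall z, vball p r z -> exists G, sder f z G /\
     forall v, cmod (app G v) <= A * vmod v) ->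
  vball p r x -> vball p r y -> cmod (f y - f x) <= A * vmod (y - x).
Proof.
move=> H xp yp; apply: mean_value_segment => t tb.
have [G [fG GA]] := H _ (vball_convex xp yp tb).
by exists G; split.
Qed.

Lemma bhol_grad f p r M x v : 0 < r -> bhol f p r M -> vball p (r / 2) x ->
  cmod (app (grad f x) v) <= 16 * M / r * vmod v.
Proof.
move=> r0 fb xp.
have fx : bhol f x (r / 2) M.
  by apply: bhol_sub fb; rewrite [leRHS]splitr lerD2r ltW.
have r2 : 0 < r / 2 by rewrite divr_gt0.
have fd : sder f x (grad f x).
  by apply: grad_sder; apply: (proj1 fx); exact: vball_center.
have := cauchy_center v r2 fx fd; congr (_ <= _ * _).
by field; rewrite gt_eqF.
Qed.

Lemma bhol_lip f p r M x y : 0 < r -> bhol f p r M -> vball p (r / 2) x ->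
  vball p (r / 2) y -> cmod (f y - f x) <= 16 * M / r * vmod (y - x).
Proof.
move=> r0 fb; apply: mean_value_ball.
move=> z zb; exists (grad f z); split; last by move=> v; exact: bhol_grad fb zb.
apply/grad_sder/(proj1 fb); exact: lt_le_trans zb (ler_divSn 1 r0).
Qed.

Lemma gradB f g x : sdiff f x -> sdiff g x ->
  grad (fun y => f y - g y) x = grad f x - grad g x.
Proof.
move=> /grad_sder fx /grad_sder gx; apply: gradE.
rewrite (_ : (fun y => _) = fun y => f y + (-1) * g y); last first.
  by apply/funext => y; rewrite mulN1r.
have := sderD fx (sderM (sder_cst (-1) x) gx).
by rewrite scaler0 add0r scaleN1r.
Qed.

Lemma grad_shift f x v : sdiff f (x + v) ->
  grad (fun y => f (y + v)) x = grad f (x + v).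
Proof.
move=> /grad_sder fx; apply: gradE => e /fx[d [d0 Hd]]; exists d; split=> // h /Hd H.
by rewrite [x + h + v]addrAC.
Qed.

(** The difference of the gradients is the gradient at [x] of [f (z + (y - x)) - f z], a function
    bounded by [bhol_lip]; the Cauchy estimate for it gives a second-order bound. The constant is 8
    times 16 times 8. *)
Lemma bhol_grad_lip f p r M x y v : 0 < r -> bhol f p r M ->
  vball p (r / 4) x -> vball p (r / 4) y ->
  cmod (app (grad f y - grad f x) v) <=
    1024 * M / r ^+ 2 * vmod (y - x) * vmod v.
Proof.
move=> r0 fb xp yp.
have r8 : 0 < r / 8 by rewrite divr_gt0.
have mono (a b : R) : r * a <= r * b -> vball p (r * a) `<=` vball p (r * b).
  by move=> ab z zp; exact: lt_le_trans zp ab.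
have fd z : vball p (r / 2) z -> sdiff f z.
  move=> zp; apply: (proj1 fb); exact: lt_le_trans zp (ler_divSn 1 r0).
have sub w : vball p (r / 4) w -> vball w (r / 8) `<=` vball p (r / 2).
  move=> wp; apply: vball_sub; move: wp r0; rewrite /vball /= => wp r0.
  by move: (vmod _) wp => u; clear -r0; lra.
have mv z : vball x (r / 8) z -> vball y (r / 8) (z + (y - x)).
  by rewrite /vball /= addrCA [y + _]addrC addrK.
have psi : bhol (fun z => f (z + (y - x)) - f z) x (r / 8)
    (16 * M / r * vmod (y - x)).
  split=> z zx.
    by apply: sdiffB; [apply/sdiff_shift/fd/(sub y)=> //; exact: mv|apply/fd/(sub x)].
  have := bhol_lip r0 fb (sub x xp z zx) (sub y yp _ (mv z zx)).
  by rewrite [z + _ - z]addrAC subrr add0r.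
have fx : sdiff f x by apply/fd/(sub x xp)/vball_center.
have fy : sdiff f (x + (y - x)) by rewrite subrKC; apply/fd/(sub y yp)/vball_center.
have fxy : sdiff (fun z => f (z + (y - x))) x by exact: sdiff_shift.
have := cauchy_center v r8 psi (grad_sder (sdiffB fxy fx)).
rewrite gradB// grad_shift// subrKC; congr (_ <= _ * _).
by field; rewrite gt_eqF.
Qed.

(** The mean value inequality for [f] minus its linear part at [x], whose gradient is small by
    [bhol_grad_lip]. *)
Lemma bhol_quad f p r M x y : 0 < r -> bhol f p r M ->
  vball p (r / 4) x -> vball p (r / 4) y ->
  cmod (f y - f x - app (grad f x) (y - x)) <=
    1024 * M / r ^+ 2 * vmod (y - x) ^+ 2.
Proof.
move=> r0 fb xp yp; set K := 1024 * M / r ^+ 2.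
have K0 : 0 <= K.
  exact: divr_ge0 (mulr_ge0 (ler0n _ _) (bhol_ge0 r0 fb)) (exprn_ge0 _ (ltW r0)).
pose g z := f z - app (grad f x) z.
have -> : f y - f x - app (grad f x) (y - x) = g y - g x.
  by rewrite /g appD appN; ring.
apply: mean_value_segment => t tb.
set z := x + _; have zp : vball p (r / 4) z by exact: vball_convex.
have fz : sdiff f z.
  apply: (proj1 fb); exact: lt_le_trans zp (ler_divSn 3 r0).
exists (grad f z - grad f x); split.
  have gE : g = fun y => f y + app (- grad f x) y.
    by apply/funext => w; rewrite /g appNl.
  by rewrite gE; apply: sderD (grad_sder fz) (sder_app _ _).
apply: (le_trans (bhol_grad_lip (y - x) r0 fb xp zp)).
rewrite -/K expr2 mulrA ler_wpM2r ?vmod_ge0// ler_wpM2l//.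
case/andP: tb => t0 t1.
rewrite /z [x + _]addrC addrK vmodZ cmodR ger0_norm//.
by rewrite ler_piMl// vmod_ge0.
Qed.

End Several.
End CauchyEstimates.

(** * Higher directional derivatives and the identity theorem *)

Section Derivatives.
Variable R : realType.
Local Notation C := R[i].

Lemma le_pow2 (a b A : R) : (forall k, a <= b + A / 2 ^+ k) -> a <= b.
Proof.
move=> H; apply/ler_addgt0Pr => e e0; have [k Hk] := pow2_small A e0.
by apply: (le_trans (H k)); rewrite lerD2l ltW.
Qed.

Lemma geometric_cauchyR (x : nat -> R) (c : R) :
  (forall k, `|x k.+1 - x k| <= c / 2 ^+ k) ->
  exists l, forall k, `|x k - l| <= 2 * c / 2 ^+ k.
Proof.
move=> H; pose e k := c / 2 ^+ k.
have eS k : 2 * c / 2 ^+ k.+1 = e k.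
  by rewrite /e exprS; field; rewrite expf_neq0.
have e2 k : 2 * c / 2 ^+ k = e k + e k by rewrite /e; ring.
have [||k|l Hl] := @nested_intervals _ (fun k => x k - 2 * c / 2 ^+ k)
  (fun k => x k + 2 * c / 2 ^+ k).
- move=> k; rewrite eS e2; have := H k; rewrite -/(e k) ler_norml => /andP[h _].
  by move: h; move: (x k) (x k.+1) (e k) => a b d; clear; lra.
- move=> k; rewrite eS e2; have := H k; rewrite -/(e k) ler_norml => /andP[_ h].
  by move: h; move: (x k) (x k.+1) (e k) => a b d; clear; lra.
- have : 0 <= e k by apply: le_trans (H k); exact: normr_ge0.
  rewrite e2; move: (x k) (e k) => a d; clear; lra.
exists l => k; have /andP[] := Hl k; rewrite ler_norml.
by move: (x k) (2 * c / _) => a d; clear => h1 h2; apply/andP; split; lra.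
Qed.

Lemma geometric_cauchy (z : nat -> C) (c : R) :
  (forall k, cmod (z k.+1 - z k) <= c / 2 ^+ k) ->
  exists l, forall k, cmod (z k - l) <= 4 * c / 2 ^+ k.
Proof.
move=> H.
have [a Ha] : exists l, forall k, `|Re (z k) - l| <= 2 * c / 2 ^+ k.
  apply: geometric_cauchyR => k; apply: le_trans (H k).
  by apply: le_trans (cmod_Re _); rewrite ReD ReN.
have [b Hb] : exists l, forall k, `|Im (z k) - l| <= 2 * c / 2 ^+ k.
  apply: geometric_cauchyR => k; apply: le_trans (H k).
  by apply: le_trans (cmod_Im _); rewrite ImD ImN.
exists (a +i* b)%C => k; apply: (le_trans (cmod_le _)); rewrite ReD ImD ReN ImN /=.
apply: (le_trans (lerD (Ha k) (Hb k))).
by rewrite -mulrDl (_ : 2 * c + 2 * c = 4 * c); [exact: lexx|ring].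
Qed.

Section DirectionalDerivative.
Variable n : nat.
Implicit Types (x y h v p : 'rV[C]_n) (f g : 'rV[C]_n -> C).

Lemma scont_bhol f p r : 0 < r -> (forall x, vball p r x -> sdiff f x) ->
  exists s M : R, [/\ 0 < s, s <= r & bhol f p s M].
Proof.
move=> r0 fd.
have [M [d [M0 d0 Hd]]] := scont_bounded (sdiff_cont (fd p (vball_center p r0))).
exists (Order.min d r), M; split; first by rewrite lt_min d0.
  by rewrite ge_min lexx orbT.
split=> x; rewrite /vball /= lt_min => /andP[h1 h2]; first exact: fd.
exact: Hd.
Qed.

(** The difference quotients [psi k] with steps [tau / 2 ^ k] converge uniformly and geometrically
    to the directional derivative; Cauchy estimates carry this over to their gradients at [p]. As
    [bhol_quad] holds for all [psi k] with one constant, the limit of the gradients is the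
    derivative sought. *)
Lemma bhol_sdiff_dir f p r M v : 0 < r -> bhol f p r M ->
  sdiff (fun x => app (grad f x) v) p.
Proof.
move=> r0 fb.
have M0 := bhol_ge0 r0 fb.
(* All steps along [v] then have length below [r / 8]. *)
pose tau := r / (16 * (vmod v + 1)).
have v1 : 0 < vmod v + 1 by rewrite ltr_wpDl// vmod_ge0.
have tau0 : 0 < tau by rewrite divr_gt0// mulr_gt0.
pose t k : R := tau / 2 ^+ k.
have t0 k : 0 < t k by rewrite divr_gt0// exprn_gt0.
have tS k : t k.+1 <= t k.
  rewrite ler_pM2l// lef_pV2 ?posrE ?exprn_gt0// exprS ler_peMl ?exprn_ge0//.
  exact: ler1n.
have ttau k : t k <= tau.
  by elim: k => [|k IH]; [rewrite /t expr0 divr1|exact: le_trans IH].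
have tv k : t k * vmod v < r / 8.
  apply: (@le_lt_trans _ _ (tau * (vmod v + 1))).
    by apply: ler_pM; rewrite ?vmod_ge0 ?lerDl// ltW.
  rewrite /tau (_ : _ * _ = r / 16); last by field; rewrite gt_eqF.
  by rewrite ltr_pM2l// ltf_pV2 ?posrE// ltr_nat.
pose T k : C := ((t k)%:C)%C.
have T0 k : T k != 0 by rewrite -cmod_gt0 cmodR gtr0_norm.
have cT k : cmod (T k) = t k by rewrite cmodR gtr0_norm.
pose psi k x := (f (x + T k *: v) - f x) * (T k)^-1.
pose D x := app (grad f x) v.
pose K := 1024 * M / r ^+ 2.
have K0 : 0 <= K by exact: divr_ge0 (mulr_ge0 (ler0n _ _) M0) (exprn_ge0 _ (ltW r0)).
have r8 : 0 < r / 8 by rewrite divr_gt0.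
have in4 x : vball p (r / 8) x -> vball p (r / 4) x.
  move=> xp; apply: lt_le_trans xp _.
  by rewrite ler_pM2l// lef_pV2 ?posrE// ler_nat.
have in4v x k : vball p (r / 8) x -> vball p (r / 4) (x + T k *: v).
  rewrite /vball /= => xp.
  have -> : x + T k *: v - p = (x - p) + T k *: v by rewrite addrAC.
  apply: (le_lt_trans (vmodD _ _)); rewrite vmodZ cT.
  rewrite (_ : r / 4 = r / 8 + r / 8); last by field.
  by rewrite ltrD.
have in2 x : vball p (r / 4) x -> vball p (r / 2) x.
  move=> xp; apply: lt_le_trans xp _.
  by rewrite ler_pM2l// lef_pV2 ?posrE// ler_nat.
have fd x : vball p (r / 4) x -> sdiff f x.
  by move=> xp; apply: (proj1 fb); apply: lt_le_trans xp (ler_divSn 3 r0).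
have psiD k x : vball p (r / 8) x -> cmod (psi k x - D x) <= K * vmod v ^+ 2 * t k.
  move=> xp.
  have := bhol_quad r0 fb (in4 x xp) (in4v x k xp).
  have -> : x + T k *: v - x = T k *: v by rewrite addrAC subrr add0r.
  rewrite appZ vmodZ cT -/K => q.
  have -> : psi k x - D x = (f (x + T k *: v) - f x - T k * D x) / T k.
    by rewrite /psi; field; exact: T0.
  rewrite cmodM cmodV cT ler_pdivrMr//; apply: (le_trans q).
  by rewrite le_eqVlt; apply/orP; left; apply/eqP; ring.
pose M1 := 16 * M / r * vmod v.
have psib k : bhol (psi k) p (r / 8) M1.
  split=> x xp.
    apply: sdiffM; last exact: sdiff_cst.
    by apply: sdiffB; [apply/sdiff_shift/fd/in4v|apply/fd/in4].
  rewrite /psi cmodM cmodV cT ler_pdivrMr//.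
  have := bhol_lip r0 fb (in2 _ (in4 x xp)) (in2 _ (in4v x k xp)).
  have -> : x + T k *: v - x = T k *: v by rewrite addrAC subrr add0r.
  rewrite vmodZ cT => /le_trans; apply.
  by rewrite le_eqVlt; apply/orP; left; apply/eqP; rewrite /M1; ring.
have psid k x : vball p (r / 8) x -> sdiff (psi k) x by move=> /(proj1 (psib k)).
have pp := vball_center p r8.
pose G k := grad (psi k) p.
pose c := 128 * K * vmod v ^+ 2 * tau / r.
have Gc k u : cmod (app (G k.+1 - G k) u) <= c / 2 ^+ k * vmod u.
  have B : bhol (fun x => psi k.+1 x - psi k x) p (r / 8) (2 * (K * vmod v ^+ 2 * t k)).
    split=> x xp; first by apply: sdiffB; exact: psid.
    have -> : psi k.+1 x - psi k x = (psi k.+1 x - D x) - (psi k x - D x) by ring.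
    rewrite (le_trans (cmodD _ _))// cmodN [leRHS]mulr_natl mulr2n lerD//; last exact: psiD.
    apply: (le_trans (psiD _ _ xp)); rewrite ler_wpM2l//.
    by rewrite mulr_ge0// exprn_ge0// vmod_ge0.
  have := cauchy_center u r8 B (grad_sder (sdiffB (psid k.+1 p pp) (psid k p pp))).
  rewrite gradB; [|exact: psid|exact: psid].
  congr (_ <= _ * _); rewrite /c /t.
  by field; rewrite expf_neq0// gt_eqF.
have Hl i : exists l, forall k, cmod (G k i 0 - l) <= 4 * c / 2 ^+ k.
  apply: geometric_cauchy => k.
  have := Gc k (delta_mx 0 i); rewrite app_delta !mxE => /le_trans; apply.
  rewrite ler_piMr//; last first.
    apply/vmod_leP => // j; rewrite mxE; case: (_ && _); rewrite ?cmod1 ?cmod0//.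
  rewrite divr_ge0 ?exprn_ge0// divr_ge0 ?(ltW r0)//.
  by apply: mulr_ge0 (ltW tau0); apply: mulr_ge0; [apply: mulr_ge0 => //; exact: ler0n|
    rewrite exprn_ge0// vmod_ge0].
have [L HL] := choice Hl.
pose G0 : 'cV[C]_n := \col_i L i.
pose K1 := 1024 * M1 / (r / 8) ^+ 2.
exists G0 => e e0.
have M10 : 0 <= M1 by exact: bhol_ge0 r8 (psib 0%N).
have K10 : 0 <= K1 by exact: divr_ge0 (mulr_ge0 (ler0n _ _) M10) (exprn_ge0 _ (ltW r8)).
have K11 : 0 < K1 + 1 by rewrite ltr_wpDl.
have r32 : 0 < r / 8 / 4 by rewrite !divr_gt0.
exists (Order.min (r / 8 / 4) (e / (K1 + 1))); split.
  by rewrite lt_min r32 divr_gt0.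
move=> h; rewrite lt_min => /andP[h1 h2].
have hp : vball p (r / 8 / 4) (p + h) by rewrite /vball /= [p + h]addrC addrK.
have hp8 : vball p (r / 8) (p + h).
  exact: lt_le_trans hp (ler_divSn 3 r8).
apply: (@le_trans _ _ (K1 * vmod h ^+ 2)); last first.
  rewrite expr2 mulrA ler_wpM2r ?vmod_ge0//.
  apply: (@le_trans _ _ ((K1 + 1) * vmod h)).
    by rewrite ler_wpM2r ?vmod_ge0// lerDl.
  by rewrite mulrC -ler_pdivlMr// ltW.
(* The errors depending on [k] are of order [2 ^ -k] and vanish in the limit; the quadratic one
   stays. *)
apply: (@le_pow2 _ _ (2 * (K * vmod v ^+ 2 * tau) + (\sum_(i < n) 4 * c) * vmod h)) => k.
have -> : app (grad f (p + h)) v - app (grad f p) v - app G0 h =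
  (psi k (p + h) - psi k p - app (G k) h) - (psi k (p + h) - D (p + h))
   + (psi k p - D p) + app (G k - G0) h.
  by rewrite /D appDl appNl; ring.
have q1 := psiD k _ hp8; have q2 := psiD k _ pp.
have q3 := bhol_quad r8 (psib k) (vball_center p r32) hp.
rewrite -/K1 (_ : p + h - p = h) in q3; last by rewrite [p + h]addrC addrK.
have q4 : cmod (app (G k - G0) h) <= (\sum_(i < n) 4 * c / 2 ^+ k) * vmod h.
  apply: (le_trans (app_le _ _)); rewrite ler_wpM2r ?vmod_ge0//.
  by apply: ler_sum => i _; rewrite !mxE.
apply: (le_trans (cmodD _ _)).
apply: (le_trans (lerD (cmodD _ _) (lexx _))).
apply: (le_trans (lerD (lerD (cmodD _ _) (lexx _)) (lexx _))).
rewrite cmodN.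
apply: (le_trans (lerD (lerD (lerD q3 q1) q2) q4)).
rewrite le_eqVlt; apply/orP; left; apply/eqP.
by rewrite -mulr_suml /t; ring.
Qed.

Definition hol f (U : set 'rV[C]_n) := forall x, U x -> sdiff f x.

Lemma hol_dir f U v : vopen U -> hol f U -> hol (fun x => app (grad f x) v) U.
Proof.
move=> Uo fU x Ux; have [r [r0 rU]] := Uo x Ux.
have [s [M [s0 _ fb]]] := scont_bhol r0 (fun y yx => fU y (rU y yx)).
exact: bhol_sdiff_dir s0 fb.
Qed.

(** On a line with direction [v] these are the successive derivatives of a function of one variable
    ([dir_iter_cder]); they take the place of a power series. *)
Definition dir_iter f v k := iter k (fun g y => app (grad g y) v) f.

Lemma hol_dir_iter f U v k : vopen U -> hol f U -> hol (dir_iter f v k) U.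
Proof. by move=> Uo fU; elim: k => [//|k IH]; exact: hol_dir. Qed.

Lemma dir_iter_cder f U v k x t : vopen U -> hol f U -> U (x + t *: v) ->
  cder (fun s => dir_iter f v k (x + s *: v)) t (dir_iter f v k.+1 (x + t *: v)).
Proof.
move=> Uo fU Ux; apply: sder_slice; apply: grad_sder.
exact: (hol_dir_iter v k Uo fU).
Qed.

End DirectionalDerivative.

Section OneVariable.
Implicit Types (f g : C -> C) (z w : C).

Lemma cderX n z : cder (fun t : C => t ^+ n.+1) z (n.+1%:R * z ^+ n).
Proof.
elim: n => [|n IH].
  rewrite mulr1 (_ : (fun t => _) = id); first exact: cder_id.
  by apply/funext => t; rewrite expr1.
rewrite (_ : (fun t => _) = fun t => id t * t ^+ n.+1); last first.
  by apply/funext => t; rewrite exprS.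
have := cderM (cder_id z) IH; congr cder.
by rewrite /= -[n.+2%:R]natr1 exprS; ring.
Qed.

Lemma cmean_value f z B :
  (forall t : R, 0 <= t <= 1 -> exists m, cder f ((t%:C)%C * z) m /\
     cmod m * cmod z <= B) ->
  cmod (f z - f 0) <= B.
Proof.
move=> H; have := @mean_value _ (fun t => f ((t%:C)%C * z)) B.
rewrite rmorph1 rmorph0 mul1r mul0r; apply=> t tb e e0.
have [m [/cder_epsP fm mB]] := H t tb.
have z1 : 0 < cmod z + 1 by rewrite ltr_wpDl// cmod_ge0.
have [d [d0 Hd]] := fm _ (divr_gt0 e0 z1).
exists (d / (cmod z + 1)); split=> [|s sd]; first exact: divr_gt0.
have E : (s%:C)%C * z = (t%:C)%C * z + ((s - t)%:C)%C * z.
  by rewrite -mulrDl rmorphB subrKC.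
have hd : cmod (((s - t)%:C)%C * z) < d.
  rewrite cmodM cmodR; apply: (@le_lt_trans _ _ (`|s - t| * (cmod z + 1))).
    by rewrite ler_wpM2l// lerDl.
  by rewrite -ltr_pdivlMr.
have := Hd _ hd; rewrite -E => h1.
rewrite -(subrK (((s - t)%:C)%C * z * m) (_ - _)).
rewrite (le_trans (cmodD _ _))// addrC mulrDl lerD//.
  by rewrite !cmodM cmodR -mulrA mulrC ler_wpM2r// mulrC.
apply: (le_trans h1); rewrite cmodM cmodR.
rewrite (_ : _ * _ = e * `|s - t| * (cmod z / (cmod z + 1))); last by ring.
rewrite ler_piMr//; first by rewrite mulr_ge0// ltW.
by rewrite ler_pdivrMr// mul1r lerDl.
Qed.

(** All derivatives of [phi 0] are given as data; [dir_iter] along a line supplies them. *)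
Definition deriv_chain (phi : nat -> C -> C) (r : R) :=
  forall k z, cmod z < r -> cder (phi k) z (phi k.+1 z).

(** Induction on [N]: the expansion of [phi 1] is integrated by the mean value inequality. *)
Lemma chain_taylor (phi : nat -> C -> C) (r : R) N : 0 < r -> deriv_chain phi r ->
  (forall k, (k < N)%N -> phi k 0 = 0) ->
  forall e : R, 0 < e -> exists d, 0 < d /\ forall z, cmod z < d ->
    cmod (phi 0%N z - phi N 0 * (N`!%:R)^-1 * z ^+ N) <= e * cmod z ^+ N.
Proof.
move=> r0; elim: N phi => [|N IH] phi ch phi0 e e0.
  have := cder_cont (ch 0%N 0 _); rewrite cmod0 => /(_ r0 e e0)[d [d0 Hd]].
  exists d; split=> // z /Hd; rewrite add0r.
  by rewrite fact0 invr1 !expr0 !mulr1.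
have ch' : deriv_chain (fun k => phi k.+1) r by move=> k z; exact: ch.
have [d [d0 Hd]] := IH _ ch' (fun k kN => phi0 k.+1 kN) e e0.
exists (Order.min d r); split=> [|z]; first by rewrite lt_min d0.
rewrite lt_min => /andP[zd zr].
set c := phi N.+1 0 in Hd *.
pose g w := phi 0%N w + - (c * (N.+1`!%:R)^-1) * w ^+ N.+1.
have -> : phi 0%N z - c * (N.+1`!%:R)^-1 * z ^+ N.+1 = g z - g 0.
  by rewrite /g phi0// expr0n /= mulr0 add0r subr0 mulNr.
apply: cmean_value => t /andP[t0 t1].
have tz : cmod ((t%:C)%C * z) <= cmod z.
  by rewrite cmodM cmodR ger0_norm// ler_piMl// cmod_ge0.
eexists; split.
  apply: cderD (ch 0%N _ (le_lt_trans tz zr)) (cderM (cder_cst _ _) (cderX _ _)).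
rewrite mul0r add0r mulNr.
have -> : c / (N.+1)`!%:R * (N.+1%:R * ((t%:C)%C * z) ^+ N) =
   c * (N`!%:R)^-1 * ((t%:C)%C * z) ^+ N.
  have a0 : N.+1%:R != 0 :> C by rewrite pnatr_eq0.
  have b0 : N`!%:R != 0 :> C by rewrite pnatr_eq0 -lt0n fact_gt0.
  rewrite factS natrM; move: (N.+1%:R : C) a0 (N`!%:R : C) b0 => a a0 b b0.
  by field; rewrite a0 b0.
rewrite exprSr mulrA ler_wpM2r ?cmod_ge0//.
apply: (le_trans (Hd _ (le_lt_trans tz zd))).
by rewrite ler_wpM2l ?(ltW e0)// lerXn2r ?nnegrE ?cmod_ge0.
Qed.

(** [phi 0 z / z ^ N] is holomorphic across 0 for every [N], so the maximum principle gives [|phi 0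
    w| <= M (|w| / s) ^ N <= M / 2 ^ N]. *)
Lemma chain_identity (phi : nat -> C -> C) (s M : R) : 0 < s ->
  deriv_chain phi (4 * s) -> (forall k, phi k 0 = 0) ->
  (forall z, cmod z <= 2 * s -> cmod (phi 0%N z) <= M) ->
  forall w, cmod w <= s / 2 -> phi 0%N w = 0.
Proof.
move=> s0 ch phi0 phiM w ws.
have [->|w0] := eqVneq w 0; first exact: phi0.
have s40 : 0 < 4 * s by rewrite mulr_gt0.
have M0 : 0 <= M.
  by apply: le_trans (phiM 0 _); rewrite ?cmod_ge0// cmod0 mulr_ge0// ltW.
suff H N : cmod (phi 0%N w) <= 0 + M / 2 ^+ N.
  apply/eqP; rewrite -cmod_eq0; apply/eqP/le_anti; rewrite cmod_ge0 andbT.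
  exact: le_pow2 H.
rewrite add0r; pose G z := phi 0%N z * (z ^+ N)^-1.
have lt24 z : cmod z <= 2 * s -> cmod z < 4 * s.
  by move=> /le_lt_trans; apply; rewrite ltr_pM2r// ltr_nat.
have phid z : cmod z <= 2 * s -> cdiff (phi 0%N) z.
  by move=> zs; eexists; apply: ch; exact: lt24.
have wi : rect_in (- s) s (- s) s w.
  have sh : s / 2 < s by rewrite ltr_pdivrMr// mulr_natr mulr2n ltrDl.
  by split; rewrite -ltr_norml; apply: (le_lt_trans _ (le_lt_trans ws sh));
    [exact: cmod_Re|exact: cmod_Im].
have Gd z : rect (- s) s (- s) s z -> cdiff G z.
  move=> /square_cmod zs; have [->|z0] := eqVneq z 0.
    exists 0; apply/cder_epsP => e e0.
    (* One order more than is divided out, so that the quotient [G] has derivative 0 at 0. *)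
    have [d [d0 Hd]] := chain_taylor s40 ch (fun k _ => phi0 k) (N := N.+1) e0.
    exists d; split=> // h /Hd; rewrite phi0 !mul0r subr0 mulr0 subr0 add0r.
    rewrite /G phi0 mul0r subr0 => h1.
    have [->|h0] := eqVneq h 0; first by rewrite phi0 mul0r cmod0 mulr0.
    rewrite cmodM cmodV cmodX ler_pdivrMr ?exprn_gt0 ?cmod_gt0//.
    by apply: (le_trans h1); rewrite exprS mulrA.
  apply: cdiffM; first exact: phid.
  by apply: cdiffV; [rewrite expf_neq0|apply: cdiffX; exact: cdiff_id].
have Gw : ccont G w.
  apply/cdiff_cont/Gd; case: wi => /andP[h1 h2] /andP[h3 h4].
  by split; rewrite !ltW.
have := rect_maximum wi (fun z zr _ => Gd z zr) Gw (M := M / s ^+ N).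
have wp : 0 < cmod w by rewrite cmod_gt0.
have -> : cmod (G w) = cmod (phi 0%N w) / cmod w ^+ N.
  by rewrite /G cmodM cmodV cmodX.
rewrite ler_pdivrMr ?exprn_gt0// => H.
apply: (le_trans (H _)).
  move=> z zb; rewrite /G cmodM cmodV cmodX.
  have zs := square0_bd s0 zb; have zp : 0 < cmod z by exact: lt_le_trans zs.
  apply: ler_pM; rewrite ?cmod_ge0 ?invr_ge0 ?exprn_ge0 ?cmod_ge0//.
    by apply/phiM/square_cmod; case: zb.
  by rewrite lef_pV2 ?posrE ?exprn_gt0// lerXn2r ?nnegrE ?cmod_ge0// ltW.
rewrite -mulrA ler_wpM2l// mulrC -expr_div_n -exprVn lerXn2r ?nnegrE//.
- by rewrite divr_ge0 ?cmod_ge0// ltW.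
- by rewrite ler_pdivrMr// mulrC.
Qed.

End OneVariable.

Lemma hol_identity n (f : 'rV[C]_n -> C) p r : 0 < r -> hol f (vball p r) ->
  (forall v k, dir_iter f v k p = 0) ->
  exists s, 0 < s /\ forall x, vball p s x -> f x = 0.
Proof.
move=> r0 fd f0.
have [s [M [s0 sr fb]]] := scont_bhol r0 fd.
(* [chain_identity] is used with radius 2 on the line [p + z (x - p)]; it needs [|z| < 8] and
   reaches the parameter 1 of [x]. *)
exists (s / 8); split=> [|x xp]; first by rewrite divr_gt0.
have inb (z : C) : cmod z < 4 * 2 -> vball p s (p + z *: (x - p)).
  move=> z8; rewrite /vball /= [p + _]addrC addrK vmodZ.
  have -> : s = (4 * 2) * (s / 8) by field.
  by apply: ltr_pM; rewrite ?cmod_ge0 ?vmod_ge0.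
have hs : hol f (vball p s) by move=> y; exact: (proj1 fb).
have := @chain_identity (fun k z => dir_iter f (x - p) k (p + z *: (x - p))) 2 M.
move=> /(_ _ _ _ _ 1); rewrite scale1r subrKC; apply=> //.
- by move=> k z z8; apply: (dir_iter_cder _ _ hs); [exact: vopen_ball|exact: inb].
- by move=> k; rewrite scale0r addr0.
- move=> z z4; apply: (proj2 fb); apply: inb; apply: (le_lt_trans z4).
  by rewrite ltr_pM2r// ltr_nat.
- by rewrite cmod1 divff.
Qed.

End Derivatives.

(** * The holomorphic inverse function theorem *)

Section Compactness.
Variable R : realType.
Local Notation C := R[i].

Lemma finite_min n (P : 'I_n -> R -> Prop) :
  (forall i, exists d, 0 < d /\ P i d) ->
  (forall i d d', P i d -> d' <= d -> P i d') ->
  exists d, 0 < d /\ forall i, P i d.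
Proof.
move=> /choice[D HD] mono.
have S0 : 0 < 1 + \sum_i (D i)^-1.
  by rewrite ltr_pwDl// sumr_ge0// => i _; rewrite invr_ge0 ltW//; case: (HD i).
(* A positive number below all [D i], meaningful also for [n = 0]. *)
exists (1 + \sum_i (D i)^-1)^-1; split; first by rewrite invr_gt0.
move=> i; have [D0 PD] := HD i; apply: mono PD _.
rewrite -[leRHS]invrK lef_pV2 ?posrE ?invr_gt0//.
rewrite (bigD1 i)//= addrCA lerDl addr_ge0// sumr_ge0// => j _.
by rewrite invr_ge0 ltW//; case: (HD j).
Qed.

(** A square and not a disc: it is the image of a product of two compact intervals. *)
Definition box (s : R) : set C :=
  [set z | `|Re z| <= s /\ `|Im z| <= s].

Lemma box_compact s : compact (box s).
Proof.
have -> : box s = [set (xy.1 +i* xy.2)%C | xy in `[- s, s] `*` `[- s, s]].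
  apply/seteqP; split=> [z [h1 h2]|_ [[x y] [/= h1 h2] <-]].
    exists (Re z, Im z); last by case: z {h1 h2}.
    by split; rewrite /= in_itv /= -ler_norml.
  by split; rewrite /= ler_norml; [move: h1|move: h2]; rewrite in_itv.
apply: continuous_compact.
  apply: continuous_subspaceT => -[x y]; apply/cvg_cmodP => e e0.
  have e2 : 0 < e / 2 by rewrite divr_gt0.
  near=> xy; rewrite (le_trans (cmod_le _))// ReD ImD ReN ImN /=.
  rewrite [leRHS]splitr lerD// distrC ltW//; near: xy.
    by apply: (@cvgr_dist_lt _ _ _ _ _ (@fst R R) x) => //; exact: cvg_fst.
  by apply: (@cvgr_dist_lt _ _ _ _ _ (@snd R R) y) => //; exact: cvg_snd.
by apply: compact_setX; exact: segment_compact.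
Unshelve. all: by end_near. Qed.

Definition vbox n (p : 'rV[C]_n) (s : R) : set 'rV[C]_n :=
  [set x | forall i, box s (x 0 i - p 0 i)].

Lemma vbox_min n (p : 'rV[C]_n) (s : R) (E : 'rV[C]_n -> R) : 0 <= s ->
  (forall x, vbox p s x -> forall e, 0 < e -> exists d, 0 < d /\
     forall y, vball x d y -> `|E y - E x| <= e) ->
  exists x, vbox p s x /\ forall y, vbox p s y -> E x <= E y.
Proof.
move=> s0 HE.
have bc : compact (vbox 0 s : set 'rV[C]_n).
  have -> : vbox 0 s = [set v : 'rV[C]_n | forall i, box s (v ord0 i)].
    by apply/seteqP; split=> v H i; have := H i; rewrite mxE subr0.
  exact: (@rV_compact C n (fun=> box s) (fun=> @box_compact s)).
have [||c cb cE] := @compact_EVT_min _ _ (fun x => E (p + x)) _ _ bc.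
- by exists 0 => i; rewrite subrr; split; rewrite normr0.
- apply: continuous_in_subspaceT => x; rewrite inE => xb.
  have FF : Filter (nbhs (x : 'rV[C]_n)) by exact: nbhs_filter.
  apply/(@cvgrPdist_le _ _ _ (nbhs (x : 'rV[C]_n)) FF) => e e0.
  have [|d [d0 Hd]] := HE (p + x) _ e e0.
    by move=> i; have := xb i; rewrite !mxE addrAC subrr add0r subr0.
  apply/vnbhsP; exists d; split=> // y yx; rewrite distrC; apply: Hd.
  by rewrite /vball /= opprD addrACA subrr add0r.
exists (p + c); split=> [i|y yb].
  by move: cb; rewrite inE => /(_ i); rewrite !mxE subr0 addrAC subrr add0r.
rewrite -(subrKC p y); apply: cE; rewrite inE => i.
by have := yb i; rewrite !mxE subr0.
Qed.

Lemma vbox_vmod n (p x : 'rV[C]_n) s : 0 <= s -> vbox p s x -> vmod (x - p) <= 2 * s.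
Proof.
move=> s0 xb; apply/vmod_leP => [|i]; first by rewrite mulr_ge0.
rewrite !mxE (le_trans (cmod_le _))// mulr_natl mulr2n.
by case: (xb i) => h1 h2; rewrite lerD.
Qed.

Lemma vmod_vbox n (p x : 'rV[C]_n) s : vmod (x - p) <= s -> vbox p s x.
Proof.
move=> xs i; have := le_trans (vmod_coord (x - p) i) xs; rewrite !mxE => h.
by split; apply: le_trans h; [exact: cmod_Re|exact: cmod_Im].
Qed.

End Compactness.

(** * Jacobian matrices, strict differentiability and local inverses *)

Section VectorMaps.
Variable R : realType.
Local Notation C := R[i].

Definition fcoord n m (F : 'rV[C]_n -> 'rV[C]_m) (j : 'I_m) x : C := F x 0 j.

(** Rows belong to the variables, so the differential is multiplication on the right ([mul_Jac]). *)
Definition Jac n m (F : 'rV[C]_n -> 'rV[C]_m) x : 'M[C]_(n, m) :=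
  \matrix_(i, j) grad (fcoord F j) x i 0.

Definition vhol n m (F : 'rV[C]_n -> 'rV[C]_m) (U : set 'rV[C]_n) :=
  forall j, hol (fcoord F j) U.

Lemma mul_Jac n m (F : 'rV[C]_n -> 'rV[C]_m) x (h : 'rV[C]_n) j :
  (h *m Jac F x) 0 j = app (grad (fcoord F j) x) h.
Proof. by rewrite appE mxE; apply: eq_bigr => i _; rewrite mxE. Qed.

Lemma app_col n m (A : 'M[C]_(n, m)) j v : app (col j A) v = (v *m A) 0 j.
Proof. by rewrite appE mxE; apply: eq_bigr => i _; rewrite mxE. Qed.

Lemma mxmod_le n m (A : 'M[C]_(n, m)) :
  exists a : R, 0 < a /\ forall v, vmod (v *m A) <= a * vmod v.
Proof.
exists (1 + \sum_i \sum_j cmod (A i j)); split=> [|v].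
  by rewrite ltr_pwDl// !sumr_ge0// => i _; rewrite sumr_ge0// => j _; exact: cmod_ge0.
apply/vmod_leP => [|j].
  rewrite mulr_ge0 ?vmod_ge0// addr_ge0// !sumr_ge0// => i _.
  by rewrite sumr_ge0// => j _; exact: cmod_ge0.
rewrite mxE (le_trans (cmod_sum _))// mulrDl mul1r ler_wpDl ?vmod_ge0//.
rewrite mulr_suml ler_sum// => i _; rewrite cmodM mulrC ler_pM ?cmod_ge0//.
  by rewrite (bigD1 j)//= lerDl sumr_ge0// => k _; exact: cmod_ge0.
exact: vmod_coord.
Qed.

Lemma vhol_vder n m (F : 'rV[C]_n -> 'rV[C]_m) x :
  (forall j, sdiff (fcoord F j) x) -> forall e : R, 0 < e -> exists d, 0 < d /\
  forall h, vmod h < d -> vmod (F (x + h) - F x - h *m Jac F x) <= e * vmod h.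
Proof.
move=> Fd e e0.
have [d [d0 Hd]] := @finite_min R m (fun j d => forall h, vmod h < d ->
   cmod (fcoord F j (x + h) - fcoord F j x - app (grad (fcoord F j) x) h) <= e * vmod h)
   (fun j => grad_sder (Fd j) e0)
   (fun j d d' H dd h hd => H h (lt_le_trans hd dd)).
exists d; split=> // h hd; apply/vmod_leP => [|j].
  by rewrite mulr_ge0 ?vmod_ge0// ltW.
by have := Hd j h hd; rewrite -mul_Jac !mxE.
Qed.

Lemma sder_comp n m (F : 'rV[C]_n -> 'rV[C]_m) (g : 'rV[C]_m -> C) x H :
  (forall j, sdiff (fcoord F j) x) -> sder g (F x) H ->
  sder (fun y => g (F y)) x (Jac F x *m H).
Proof.
move=> Fd gH e e0.
have [a [a0 Ha]] := mxmod_le (Jac F x).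
have g0 := gmod_ge0 H.
have A0 : 0 < 1 + a + gmod H by rewrite ltr_wpDr// addr_gt0.
set A := (_ + _) in A0; pose e1 := Order.min 1 (e / (2 * A)).
have e10 : 0 < e1 by rewrite lt_min ltr01 divr_gt0// mulr_gt0.
have e11 : e1 <= 1 by rewrite ge_min lexx.
have [c [c0 Hc]] := gH _ e10.
have [d [d0 Hd]] := vhol_vder Fd e10.
have a10 : 0 < 1 + a by rewrite addr_gt0.
exists (Order.min d (c / (1 + a))); split=> [|h].
  by rewrite lt_min d0 divr_gt0.
rewrite lt_min => /andP[/Hd h1]; rewrite ltr_pdivlMr// => h2.
set k := F (x + h) - F x in h1.
have v0 := vmod_ge0 h.
have k1 : vmod k <= (1 + a) * vmod h.
  rewrite -(subrK (h *m Jac F x) k) (le_trans (vmodD _ _))//.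
  rewrite mulrDl; apply: lerD (Ha h); apply: (le_trans h1).
  by rewrite ler_wpM2r.
have kc : vmod k < c by apply: le_lt_trans k1 _; rewrite mulrC.
have := Hc _ kc; rewrite /k subrKC -/k => h3.
have -> : g (F (x + h)) - g (F x) - app (Jac F x *m H) h =
  (g (F (x + h)) - g (F x) - app H k) + app H (k - h *m Jac F x).
  by rewrite [app H (k - _)]appD appN [app (Jac F x *m H) h]/app mulmxA -/(app H _); ring.
apply: (le_trans (cmodD _ _)).
apply: (le_trans (lerD h3 (app_le _ _))).
apply: (@le_trans _ _ (e1 * ((1 + a) * vmod h) + gmod H * (e1 * vmod h))).
  by rewrite lerD// ler_wpM2l// ltW.
rewrite (_ : _ + _ = e1 * A * vmod h); last by rewrite /A; ring.
rewrite ler_wpM2r// -ler_pdivlMr//; apply: (@le_trans _ _ (e / (2 * A))).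
  by rewrite ge_min lexx orbT.
rewrite ler_wpM2l ?(ltW e0)// lef_pV2 ?posrE ?mulr_gt0//.
by rewrite mulr_natl mulr2n lerDl ltW.
Qed.

Lemma sdiff_comp n m (F : 'rV[C]_n -> 'rV[C]_m) (g : 'rV[C]_m -> C) x :
  (forall j, sdiff (fcoord F j) x) -> sdiff g (F x) -> sdiff (fun y => g (F y)) x.
Proof. by move=> Fd [H gH]; exists (Jac F x *m H); exact: sder_comp. Qed.

Lemma Jac_comp n m l (F : 'rV[C]_n -> 'rV[C]_m) (G : 'rV[C]_m -> 'rV[C]_l) x :
  (forall j, sdiff (fcoord F j) x) -> (forall j, sdiff (fcoord G j) (F x)) ->
  Jac (G \o F) x = Jac F x *m Jac G (F x).
Proof.
move=> Fd Gd; apply/matrixP => i j.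
rewrite mxE (gradE (sder_comp Fd (grad_sder (Gd j)))) !mxE.
by apply: eq_bigr => k _; rewrite [Jac G _ _ _]mxE.
Qed.

(** Both points move while the differential stays at [p], as the injectivity in [local_inverse]
    requires. The reason is that the gradient is Lipschitz. *)
Lemma strict_sder n (f : 'rV[C]_n -> C) p r : 0 < r -> hol f (vball p r) ->
  forall e, 0 < e -> exists d, [/\ 0 < d, d <= r &
  forall x y, vball p d x -> vball p d y ->
    cmod (f y - f x - app (grad f p) (y - x)) <= e * vmod (y - x)].
Proof.
move=> r0 fh e e0; have [s [M [s0 sr fb]]] := scont_bhol r0 fh.
pose K := 1024 * M / s ^+ 2.
have K0 : 0 <= K.
  exact: divr_ge0 (mulr_ge0 (ler0n _ _) (bhol_ge0 s0 fb)) (exprn_ge0 _ (ltW s0)).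
have K1 : 0 < K + 1 by rewrite ltr_wpDl.
have s4 : 0 < s / 4 by rewrite divr_gt0.
exists (Order.min (s / 4) (e / (K + 1))); split.
- by rewrite lt_min s4 divr_gt0.
- by rewrite ge_min (le_trans (ler_divSn 3 s0)).
move=> x y xp yp; pose g z := f z - app (grad f p) z.
have -> : f y - f x - app (grad f p) (y - x) = g y - g x.
  by rewrite /g appD appN; ring.
apply: (mean_value_ball _ xp yp) => z; rewrite /vball /= lt_min => /andP[zs ze].
have fz : sdiff f z.
  by apply: (proj1 fb); apply: lt_le_trans zs (ler_divSn 3 s0).
exists (grad f z - grad f p); split=> [|v].
  have gE : g = fun y => f y + app (- grad f p) y.
    by apply/funext => w; rewrite /g appNl.
  by rewrite gE; apply: sderD (grad_sder fz) (sder_app _ _).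
apply: (le_trans (bhol_grad_lip v s0 fb (vball_center p s4) zs)).
rewrite ler_wpM2r ?vmod_ge0//; apply: (@le_trans _ _ ((K + 1) * vmod (z - p))).
  by rewrite ler_wpM2r ?vmod_ge0// lerDl.
by rewrite mulrC -ler_pdivlMr// ltW.
Qed.

Lemma strict_vder n m (F : 'rV[C]_n -> 'rV[C]_m) p r : 0 < r -> vhol F (vball p r) ->
  forall e, 0 < e -> exists d, [/\ 0 < d, d <= r &
  forall x y, vball p d x -> vball p d y ->
    vmod (F y - F x - (y - x) *m Jac F p) <= e * vmod (y - x)].
Proof.
move=> r0 Fh e e0.
have [||d [d0 Hd]] := @finite_min R m (fun j d => d <= r /\ forall x y, vball p d x -> vball p d y ->
   cmod (fcoord F j y - fcoord F j x - app (grad (fcoord F j) p) (y - x)) <= e * vmod (y - x)).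
- move=> j; have [d [d0 dr Hd]] := strict_sder r0 (Fh j) e0.
  by exists d; split.
- move=> j d d' [dr H] dd; split; first exact: le_trans dr.
  by move=> x y xd yd; apply: H; [exact: lt_le_trans xd dd|exact: lt_le_trans yd dd].
exists (Order.min d r); split; first by rewrite lt_min d0.
  by rewrite ge_min lexx orbT.
move=> x y; rewrite /vball /= !lt_min => /andP[xd _] /andP[yd _].
apply/vmod_leP => [|j]; first by rewrite mulr_ge0 ?vmod_ge0// ltW.
by have := proj2 (Hd j) x y xd yd; rewrite -mul_Jac !mxE.
Qed.

Lemma vmod_unitmx n (J : 'M[C]_n) (b : R) : 0 < b ->
  (forall v, b * vmod v <= vmod (v *m J)) -> J \in unitmx.
Proof.
move=> b0 H; rewrite -row_free_unit -kermx_eq0.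
apply/eqP/row_matrixP => i; rewrite row0; apply/eqP; rewrite -vmod_eq0.
apply/eqP/le_anti; rewrite vmod_ge0 andbT -(ler_pM2l b0) mulr0.
apply: (le_trans (H _)).
have -> : row i (kermx J) *m J = 0 by apply/sub_kermxP; exact: row_sub.
by rewrite vmod0.
Qed.

(** The Lipschitz bound on [g] turns an error small against [g y' - g y] into one small against
    [y' - y]; the expansion of [F] at [g y] can then be solved for the increment of [g]. *)
Lemma inverse_vdiff n (F g : 'rV[C]_n -> 'rV[C]_n) y (c d : R) : 0 < d -> 0 < c ->
  (forall j, sdiff (fcoord F j) (g y)) -> Jac F (g y) \in unitmx ->
  (forall y', vball y d y' -> F (g y') = y' /\
     vmod (g y' - g y) <= c * vmod (y' - y)) ->
  forall j, sdiff (fcoord g j) y.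
Proof.
move=> d0 c0 Fd Ju Hg j; set J := Jac F (g y) in Ju.
have [a [a0 Ha]] := mxmod_le (invmx J).
exists (col j (invmx J)) => e e0.
have e1 : 0 < e / (a * c) by rewrite divr_gt0// mulr_gt0.
have [s [s0 Hs]] := vhol_vder Fd e1.
exists (Order.min d (s / c)); split=> [|k]; first by rewrite lt_min d0 divr_gt0.
rewrite lt_min => /andP[kd]; rewrite ltr_pdivlMr// => ks.
have yk : vball y d (y + k) by rewrite /vball /= [y + k]addrC addrK.
have yy : vball y d y by exact: vball_center.
have [Fk gk] := Hg _ yk; have [Fy _] := Hg _ yy.
have kk : y + k - y = k by rewrite [y + k]addrC addrK.
rewrite kk in gk; set h := g (y + k) - g y in gk.
have hs : vmod h < s by apply: le_lt_trans gk _; rewrite mulrC.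
have := Hs h hs; rewrite /h subrKC -/h Fk Fy kk -/J => h1.
have -> : fcoord g j (y + k) - fcoord g j y - app (col j (invmx J)) k =
    - (((k - h *m J) *m invmx J) 0 j).
  rewrite mulmxBl mulmxK// app_col [((k *m _) - h) 0 j]mxE [(- h) 0 j]mxE.
  by rewrite /h /fcoord [(g _ - g _) 0 j]mxE [(- g _) 0 j]mxE; ring.
rewrite cmodN (le_trans (vmod_coord _ _))// (le_trans (Ha _))//.
apply: (le_trans (ler_wpM2l (ltW a0) h1)).
have -> : a * (e / (a * c) * vmod h) = e / c * vmod h.
  by field; rewrite !gt_eqF.
rewrite mulrAC ler_pdivrMr// -mulrA ler_wpM2l ?(ltW e0)// mulrC.
exact: gk.
Qed.

(** Strict differentiability bounds [|F y - F x|] below by a multiple of [|y - x|], whence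
    injectivity. For surjectivity [|F x - y|] is minimised over a compact box: boundary values are
    too large, and at an interior point with positive value a short Newton step would decrease
    it. *)
Theorem local_inverse n (F : 'rV[C]_n -> 'rV[C]_n) p r : 0 < r ->
  vhol F (vball p r) -> Jac F p \in unitmx ->
  exists (e : R) g, [/\ 0 < e, g (F p) = p,
    forall y, vball (F p) e y -> F (g y) = y /\ vball p r (g y) &
    vhol g (vball (F p) e)].
Proof.
move=> r0 Fh Ju; set J := Jac F p in Ju.
have [a [a0 Ha]] := mxmod_le (invmx J).
(* Half of [1 / a], the factor by which the differential at least stretches vectors. *)
have e0 : 0 < (2 * a)^-1 by rewrite invr_gt0 mulr_gt0.
have [d [d0 dr Hd]] := strict_vder r0 Fh e0; rewrite -/J in Hd.
have lowJ v : a^-1 * vmod v <= vmod (v *m J).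
  by rewrite ler_pdivrMl// -{1}[v](mulmxK Ju).
have aa : a^-1 = (2 * a)^-1 + (2 * a)^-1 by field; rewrite gt_eqF.
have low x y : vball p d x -> vball p d y ->
    (2 * a)^-1 * vmod (y - x) <= vmod (F y - F x).
  move=> xp yp; have h1 := Hd x y xp yp; have h2 := lowJ (y - x).
  have := vmodD (F y - F x) (- (F y - F x - (y - x) *m J)).
  have -> : F y - F x - (F y - F x - (y - x) *m J) = (y - x) *m J.
    by rewrite opprB addrC subrK.
  rewrite vmodN => h3; move: h1 h2 h3; rewrite aa mulrDl.
  by move: (_ * _) (vmod _) (vmod (_ *m _)) (vmod _) => u1 u2 u3 u4; clear; lra.
pose s := d / 4.
have s0 : 0 < s by rewrite divr_gt0.
have s2d : 2 * s < d by rewrite /s (_ : 2 * (d / 4) = d / 2);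
  [rewrite ltr_pdivrMr// mulr_natr mulr2n ltrDl|field].
have boxd x : vbox p s x -> vball p d x.
  by move=> /(vbox_vmod (ltW s0)) h; exact: le_lt_trans h s2d.
(* At distance [s] or more from [p] the value of [F] has moved by at least [2 e], so such a point
   cannot be closer to [y] than [F p] is. *)
pose e := (4 * a)^-1 * s.
have ep : 0 < e by rewrite mulr_gt0// invr_gt0 mulr_gt0.
have pd := vball_center p d0.
have surj y : vball (F p) e y -> exists x, F x = y /\ vball p d x.
  move=> ye; pose E x := vmod (F x - y).
  have Etri x x' : `|E x' - E x| <= vmod (F x' - F x).
    have t1 : E x <= vmod (F x' - F x) + E x'.
      by rewrite /E -[F x - y](subrKA (F x')) vmod_distC (le_trans (vmodD _ _))// vmod_distC.
    have t2 : E x' <= vmod (F x' - F x) + E x.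
      by rewrite /E -[F x' - y](subrKA (F x)) vmodD.
    rewrite ler_norml; move: t1 t2; move: (E x) (E x') (vmod _) => u1 u2 u3.
    by clear => ? ?; apply/andP; split; lra.
  have [x [xb xmin]] : exists x, vbox p s x /\ forall x', vbox p s x' -> E x <= E x'.
    apply: vbox_min (ltW s0) _ => x xb t t0.
    have [b [b0 Hb]] := mxmod_le J.
    pose L := (2 * a)^-1 + b.
    have L0 : 0 < L by rewrite addr_gt0.
    exists (Order.min (d - 2 * s) (t / L)); split.
      by rewrite lt_min subr_gt0 s2d divr_gt0.
    move=> x'; rewrite /vball /= lt_min => /andP[x1 x2].
    have xd := boxd x xb.
    have x'd : vball p d x'.
      rewrite /vball /= -[x' - p](subrKA x) (le_lt_trans (vmodD _ _))//.
      rewrite -(subrK (2 * s) d) ltr_leD//.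
      exact: vbox_vmod (ltW s0) xb.
    apply: (le_trans (Etri _ _)); have h1 := Hd _ _ xd x'd; have h2 := Hb (x' - x).
    rewrite -(subrK ((x' - x) *m J) (F x' - F x)) (le_trans (vmodD _ _))//.
    apply: (le_trans (lerD h1 h2)); rewrite -mulrDl -/L mulrC -ler_pdivlMr//.
    exact: ltW.
  exists x; split; last exact: boxd.
  have xd := boxd x xb.
  have Ep : E p < e by rewrite /E vmod_distC.
  have Exp : E x <= E p by apply: xmin => i; rewrite subrr; split; rewrite normr0 ltW.
  have xs : vmod (x - p) < s.
    rewrite ltNge; apply/negP => sx.
    have h1 := low p x pd xd.
    have h2 := vmodD (F x - y) (- (F p - y)).
    rewrite vmodN opprB subrKA -/(E x) -/(E p) in h2.
    have h3 : (2 * a)^-1 * s <= (2 * a)^-1 * vmod (x - p) by rewrite ler_wpM2l// ltW.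
    have h4 : (2 * a)^-1 * s = e + e by rewrite /e; field; rewrite gt_eqF.
    have : e + e < e + e.
      rewrite -{1}h4; apply: le_lt_trans (le_trans h3 (le_trans h1 h2)) _.
      exact: ltrD (le_lt_trans Exp Ep) Ep.
    by rewrite ltxx.
  apply/eqP; rewrite -subr_eq0 -vmod_eq0; apply/negPn/negP => Ex0.
  have Ex : 0 < E x by rewrite lt_neqAle eq_sym Ex0 vmod_ge0.
  (* The Newton direction: a fraction [t] of it lowers the distance to [y] by [t E x], up to an
     error of half that size. *)
  pose h := (y - F x) *m invmx J.
  have hE : vmod h <= a * E x by rewrite /E vmod_distC; exact: Ha.
  have aE : 0 < a * E x by rewrite mulr_gt0.
  pose t := Order.min 1 ((s - vmod (x - p)) / (a * E x)).
  have t0 : 0 < t by rewrite lt_min ltr01 divr_gt0// subr_gt0.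
  have t1 : t <= 1 by rewrite ge_min lexx.
  have th : vmod ((t%:C)%C *: h) <= s - vmod (x - p).
    rewrite vmodZ cmodR gtr0_norm// (le_trans (ler_wpM2l (ltW t0) hE))//.
    by rewrite -ler_pdivlMr// ge_min lexx orbT.
  pose x' := x + (t%:C)%C *: h.
  have x'b : vbox p s x'.
    apply: vmod_vbox; rewrite /x' addrAC (le_trans (vmodD _ _))//.
    by rewrite [leLHS]addrC -lerBrDr.
  have x'x : x' - x = (t%:C)%C *: h by rewrite /x' addrAC subrr add0r.
  have h1 := Hd _ _ xd (boxd _ x'b).
  have h2 := xmin _ x'b.
  have hJ : (x' - x) *m J = (t%:C)%C *: (y - F x) by rewrite x'x -scalemxAl mulmxKV.
  have : E x' <= (1 - t) * E x + (2 * a)^-1 * (t * (a * E x)).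
    rewrite /E; have -> : F x' - y = ((1 - t)%:C)%C *: (F x - y) +
        (F x' - F x - (x' - x) *m J).
      rewrite hJ rmorphB rmorph1; apply/rowP => i; rewrite !mxE; ring.
    rewrite (le_trans (vmodD _ _))// vmodZ cmodR ger0_norm ?subr_ge0//.
    rewrite lerD2l (le_trans h1)// x'x vmodZ cmodR gtr0_norm//.
    by rewrite ler_wpM2l ?(ltW e0)// ler_wpM2l ?(ltW t0).
  have -> : (2 * a)^-1 * (t * (a * E x)) = t * E x / 2 by field; rewrite gt_eqF.
  have tE : 0 < t * E x by rewrite mulr_gt0.
  rewrite mulrBl mul1r; move: tE h2; move: (t * E x) (E x) (E x') => u1 u2 u3.
  by clear; lra.
have surj' y : exists x, vball (F p) e y -> F x = y /\ vball p d x.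
  by case: (pselect (vball (F p) e y)) => [/surj[x Hx]|ny]; [exists x|exists p].
have [g Hg] := choice surj'.
have Fp := vball_center (F p) ep.
have inj x y : vball p d x -> vball p d y -> F x = F y -> x = y.
  move=> xp yp E; have := low y x yp xp; rewrite E subrr vmod0.
  rewrite pmulr_rle0// => h; apply/eqP; rewrite -subr_eq0 -vmod_eq0.
  by apply/eqP/le_anti; rewrite h vmod_ge0.
exists e, g; split=> //.
- by have [h1 h2] := Hg _ Fp; exact: inj h2 pd h1.
- by move=> y /Hg[h1 h2]; split=> //; exact: lt_le_trans h2 dr.
move=> j y ye; have [Fgy gyd] := Hg y ye.
have Fd : forall j, sdiff (fcoord F j) (g y).
  by move=> k; apply: Fh; exact: lt_le_trans gyd dr.
have [t [t0 ty]] := vopen_ball ye.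
have a2 : 0 < 2 * a by rewrite mulr_gt0.
apply: (@inverse_vdiff _ F g y (2 * a) t) => //.
  have [u [u0 uy]] := vopen_ball gyd.
  (* The lower bound on increments of [F] passes, with half the constant, to its differential at
     [g y]. *)
  apply: (@vmod_unitmx _ _ (4 * a)^-1); first by rewrite invr_gt0 mulr_gt0.
  move=> v; have [->|v0] := eqVneq v 0; first by rewrite mul0mx !vmod0 mulr0.
  rewrite -vmod_gt0 in v0.
  have a4 : 0 < (4 * a)^-1 by rewrite invr_gt0 mulr_gt0.
  have [q [q0 Hq]] := vhol_vder Fd a4.
  pose l := Order.min q u / (2 * vmod v).
  have m0 : 0 < Order.min q u by rewrite lt_min q0.
  have l0 : 0 < l by rewrite divr_gt0// mulr_gt0.
  have lv : vmod ((l%:C)%C *: v) < Order.min q u.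
    rewrite vmodZ cmodR gtr0_norm// /l.
    have -> : Order.min q u / (2 * vmod v) * vmod v = Order.min q u / 2.
      by field; rewrite gt_eqF.
    by rewrite ltr_pdivrMr// mulr_natr mulr2n ltrDl.
  move: lv; rewrite lt_min => /andP[lq lu].
  have h1 := Hq _ lq.
  have inb : vball p d (g y + (l%:C)%C *: v).
    by apply: uy; rewrite /vball /= addrAC subrr add0r.
  have h2 := low _ _ gyd inb; rewrite [g y + _]addrC addrK in h2.
  rewrite [g y + _]addrC in h1.
  rewrite -(ler_pM2l l0).
  have Ev w : l * vmod w = vmod ((l%:C)%C *: w) by rewrite vmodZ cmodR gtr0_norm.
  rewrite mulrCA !Ev scalemxAl.
  set w := _ *: v in h1 h2 *.
  have h3 := vmodD (F (w + g y) - F (g y) - w *m Jac F (g y)) (w *m Jac F (g y)).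
  rewrite subrK in h3.
  have h4 : (2 * a)^-1 * vmod w = (4 * a)^-1 * vmod w + (4 * a)^-1 * vmod w.
    by field; rewrite gt_eqF.
  rewrite h4 in h2; have := le_trans h2 (le_trans h3 (lerD h1 (lexx _))).
  by rewrite lerD2l.
move=> y' /ty y'e; have [Fgy' gy'd] := Hg y' y'e; split=> //.
have := low _ _ gyd gy'd; rewrite Fgy Fgy'.
by rewrite ler_pdivrMl.
Qed.

End VectorMaps.

(** * Osgood's theorem *)

Section Osgood.
Variable R : realType.
Local Notation C := R[i].

(** Near 0 the remainder is at most half of the leading Taylor term. *)
Lemma chain_lower (phi : nat -> C -> C) (r : R) N : 0 < r -> deriv_chain phi r ->
  (forall k, (k < N)%N -> phi k 0 = 0) -> phi N 0 != 0 ->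
  exists c d : R, [/\ 0 < c, 0 < d &
    forall z, cmod z < d -> c * cmod z ^+ N <= cmod (phi 0%N z)].
Proof.
move=> r0 ch phi0 phiN; pose a := phi N 0 * (N`!%:R)^-1.
have a0 : 0 < cmod a.
  by rewrite cmod_gt0 mulf_neq0// invr_neq0// pnatr_eq0 -lt0n fact_gt0.
have a2 : 0 < cmod a / 2 by rewrite divr_gt0.
have [d [d0 Hd]] := chain_taylor r0 ch phi0 a2.
exists (cmod a / 2), d; split=> // z /Hd; rewrite -/a => h.
have := cmodD (phi 0%N z) (- (phi 0%N z - a * z ^+ N)).
rewrite opprB subrKC cmodM cmodX [cmod (_ - phi 0%N z)]cmod_distC => h2.
have h3 : cmod a * cmod z ^+ N = cmod a / 2 * cmod z ^+ N + cmod a / 2 * cmod z ^+ N.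
  by rewrite -mulrDl -splitr.
rewrite h3 in h2; have := le_trans h2 (lerD (lexx _) h).
by rewrite lerD2r.
Qed.

(** Persistence of zeros in the manner of Hurwitz: with no zero on the shifted line, [1 / J] would
    be at most [2 / mu] on the boundary of a square and hence at its centre, where
    [|J| <= mu / 4]. *)
Lemma zero_curve n (J : 'rV[C]_n -> C) q v w (rho c d : R) N : 0 < rho ->
  hol J (vball q rho) -> J q = 0 -> 0 < c -> 0 < d ->
  (forall t, cmod t < d -> c * cmod t ^+ N <= cmod (J (q + t *: v))) ->
  forall eps : R, 0 < eps -> exists s1 : R, 0 < s1 /\
    forall s : C, cmod s <= s1 ->
      exists t, cmod t <= eps /\ J (q + s *: w + t *: v) = 0.
Proof.
move=> rho0 Jh Jq c0 d0 low eps eps0.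
have [r [M [r0 rrho Jb]]] := scont_bhol rho0 Jh.
have v1 : 0 < vmod v + 1 by rewrite ltr_wpDl// vmod_ge0.
have w1 : 0 < vmod w + 1 by rewrite ltr_wpDl// vmod_ge0.
pose sg := Order.min (Order.min (eps / 2) (d / 4)) (r / (8 * (vmod v + 1))).
have sg0 : 0 < sg by rewrite !lt_min !divr_gt0// mulr_gt0.
have sge : 2 * sg <= eps.
  by rewrite mulrC -ler_pdivlMr// !ge_min lexx.
have sgd : 2 * sg < d.
  rewrite mulrC -ltr_pdivlMr//; apply: (@le_lt_trans _ _ (d / 4)).
    by rewrite !ge_min lexx orbT.
  by rewrite ltr_pM2l// ltf_pV2 ?posrE// ltr_nat.
have sgr : 2 * sg * vmod v <= r / 4.
  apply: (@le_trans _ _ (2 * (r / (8 * (vmod v + 1))) * (vmod v + 1))).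
    by rewrite ler_pM ?mulr_ge0 ?vmod_ge0 ?ler_pM2l ?ge_min ?lexx ?orbT ?lerDl// ltW.
  by rewrite le_eqVlt; apply/orP; left; apply/eqP; field; rewrite gt_eqF.
pose L := 16 * M / r.
have L0 : 0 <= L.
  exact: divr_ge0 (mulr_ge0 (ler0n _ _) (bhol_ge0 r0 Jb)) (ltW r0).
pose mu := c * sg ^+ N.
have mu0 : 0 < mu by rewrite mulr_gt0// exprn_gt0.
have Lw : 0 < (L + 1) * (vmod w + 1) by rewrite mulr_gt0// ltr_wpDl.
pose s1 := Order.min (r / 8 / (vmod w + 1)) (mu / (4 * ((L + 1) * (vmod w + 1)))).
exists s1; split.
  by rewrite lt_min !divr_gt0// mulr_gt0.
move=> s ss1.
have sw : vmod (s *: w) <= r / 8.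
  rewrite vmodZ; apply: (@le_trans _ _ (s1 * (vmod w + 1))).
    by rewrite ler_pM ?cmod_ge0 ?vmod_ge0// lerDl.
  by rewrite -ler_pdivlMr// ge_min lexx.
have swL : L * vmod (s *: w) <= mu / 4.
  rewrite vmodZ; apply: (@le_trans _ _ ((L + 1) * (s1 * (vmod w + 1)))).
    apply: ler_pM => //; first by rewrite mulr_ge0 ?cmod_ge0 ?vmod_ge0.
      by rewrite lerDl.
    by apply: ler_pM; rewrite ?cmod_ge0 ?vmod_ge0// lerDl.
  rewrite mulrCA -ler_pdivlMr//; apply: (@le_trans _ _ (mu / (4 * ((L + 1) * (vmod w + 1))))).
    by rewrite ge_min lexx orbT.
  by rewrite le_eqVlt invfM mulrA eqxx.
have ql t : cmod t <= 2 * sg -> vmod (t *: v) <= r / 4.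
  by move=> t2; apply: le_trans sgr; rewrite vmodZ ler_wpM2r ?vmod_ge0.
have inb t : cmod t <= 2 * sg -> vball q (r / 2) (q + t *: v).
  move=> /ql tv; rewrite /vball /= [q + _]addrC addrK; apply: (le_lt_trans tv).
  by rewrite ltr_pM2l// ltf_pV2 ?posrE// ltr_nat.
have inb' t : cmod t <= 2 * sg -> vball q (r / 2) (q + s *: w + t *: v).
  move=> /ql tv; rewrite /vball /= -[q + _ + _]addrA [q + _]addrC addrK.
  apply: (le_lt_trans (vmodD _ _)); apply: (le_lt_trans (lerD sw tv)).
  rewrite (_ : _ + _ = r * (3 / 8)); last by field.
  by rewrite ltr_pM2l//; lra.
have close t : cmod t <= 2 * sg ->
    cmod (J (q + s *: w + t *: v) - J (q + t *: v)) <= mu / 4.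
  move=> t2; apply: le_trans swL.
  have := bhol_lip r0 Jb (inb t t2) (inb' t t2).
  by rewrite (_ : _ + _ - _ = s *: w)//; apply/rowP => i; rewrite !mxE; ring.
have Jd t : cmod t <= 2 * sg -> sdiff J (q + s *: w + t *: v).
  by move=> /inb' h; apply: (proj1 Jb); apply: lt_le_trans h (ler_divSn 1 r0).
apply: contrapT => nz.
have J0 t : cmod t <= 2 * sg -> J (q + s *: w + t *: v) != 0.
  move=> t2; apply/eqP => Jt; apply: nz; exists t; split => //.
  exact: le_trans t2 sge.
have sq0 : cmod (0 : C) <= 2 * sg by rewrite cmod0 mulr_ge0// ltW.
have := @rect_maximum _ (fun t => (J (q + s *: w + t *: v))^-1) (- sg) sg (- sg) sg 0
  (mu / 2)^-1 (square0_in sg0).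
have gd z : rect (- sg) sg (- sg) sg z -> cdiff (fun t => (J (q + s *: w + t *: v))^-1) z.
  by move=> /square_cmod zs; apply: cdiffV; [exact: J0|exact/sdiff_slice/Jd].
move=> /(_ (fun z zr _ => gd z zr)) H.
suff : cmod (J (q + s *: w + 0 *: v))^-1 <= (mu / 2)^-1.
  rewrite cmodV lef_pV2 ?posrE ?divr_gt0 ?cmod_gt0 ?J0//.
  have := close 0 sq0; rewrite !scale0r !addr0 Jq subr0 => h1 h2.
  by have := le_trans h2 h1; rewrite ler_pM2l// lef_pV2 ?posrE// ler_nat.
apply: H.
  by apply/cdiff_cont/gd; split => /=; rewrite oppr_le0 !ltW.
move=> z zb; have zr := square_cmod (proj1 zb).
have zs := square0_bd sg0 zb.
rewrite cmodV lef_pV2 ?posrE ?divr_gt0 ?cmod_gt0 ?J0//.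
have h1 := close z zr; have h2 := low z (le_lt_trans zr sgd).
have h3 : mu <= cmod (J (q + z *: v)).
  apply: le_trans h2; rewrite ler_wpM2l ?(ltW c0)//.
  by rewrite lerXn2r ?nnegrE ?cmod_ge0 ?(ltW sg0).
have := cmodD (J (q + s *: w + z *: v)) (- (J (q + s *: w + z *: v) - J (q + z *: v))).
rewrite opprB subrKC [cmod (_ - J (_ + _ + _))]cmod_distC => h4.
have h5 := le_trans h3 (le_trans h4 (lerD (lexx _) h1)).
rewrite -lerBlDr in h5; apply: le_trans h5.
by move: mu0; clear; lra.
Qed.

(** By the identity theorem some iterated directional derivative at [p] is nonzero; [N] is the least
    order along that direction. *)
Lemma hol_order n (f : 'rV[C]_n -> C) p r : 0 < r -> hol f (vball p r) ->
  (forall s : R, 0 < s -> exists x, vball p s x /\ f x != 0) ->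
  exists v N, (forall k, (k < N)%N -> dir_iter f v k p = 0) /\ dir_iter f v N p != 0.
Proof.
move=> r0 fh nz.
have [v [k vk]] : exists v k, dir_iter f v k p != 0.
  apply: contrapT => H; have [|s [s0 Hs]] := hol_identity r0 fh.
    move=> v k; apply/eqP; apply: contrapT => /negP vk; apply: H.
    by exists v, k.
  by have [x [xs /eqP]] := nz s s0; apply; exact: Hs.
have exN : exists N, dir_iter f v N p != 0 by exists k.
exists v, (ex_minn exN); case: ex_minnP => N vN minN; split=> // j jN.
by apply/eqP; apply: contraTT jN => /minN; rewrite -leqNgt.
Qed.

Lemma dir_iter_lower n (f : 'rV[C]_n -> C) p r v N : 0 < r -> hol f (vball p r) ->
  (forall k, (k < N)%N -> dir_iter f v k p = 0) -> dir_iter f v N p != 0 ->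
  exists c d : R, [/\ 0 < c, 0 < d &
    forall t, cmod t < d -> c * cmod t ^+ N <= cmod (f (p + t *: v))].
Proof.
move=> r0 fh f0 fN; have v1 : 0 < vmod v + 1 by rewrite ltr_wpDl// vmod_ge0.
apply: (@chain_lower (fun k t => dir_iter f v k (p + t *: v)) (r / (vmod v + 1))).
- by rewrite divr_gt0.
- move=> k z zr; apply: (dir_iter_cder _ _ fh); first exact: vopen_ball.
  rewrite /vball /= [p + _]addrC addrK vmodZ.
  apply: (@le_lt_trans _ _ (cmod z * (vmod v + 1))).
    by rewrite ler_wpM2l ?cmod_ge0// lerDl.
  by rewrite -ltr_pdivlMr.
- by move=> k kN; rewrite scale0r addr0 f0.
- by rewrite scale0r addr0.
Qed.

Section Injective.
Variables (m : nat) (F : 'rV[C]_m.+1 -> 'rV[C]_m.+1) (p : 'rV[C]_m.+1) (r : R).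
Hypotheses (r0 : 0 < r) (Fh : vhol F (vball p r)) (Fi : set_inj (vball p r) F).

Lemma inj_near q (s : R) : vball p r q -> 0 < s ->
  exists x, [/\ vball q s x, vball p r x & F x != F q].
Proof.
move=> qp s0; have [t [t0 tq]] := vopen_ball qp.
pose u : R := Order.min s t / 2.
have mu : 0 < Order.min s t by rewrite lt_min s0.
have u0 : 0 < u by rewrite divr_gt0.
have um : u < Order.min s t by rewrite ltr_pdivrMr// mulr_natr mulr2n ltrDl.
pose x := q + const_mx ((u%:C)%C : C).
have xq : vmod (x - q) < Order.min s t.
  rewrite /x [q + _]addrC addrK; apply/vmod_ltP => // i.
  by rewrite mxE cmodR gtr0_norm.
move: xq; rewrite lt_min => /andP[xs xt]; exists x; split=> //; first exact: tq.
apply/eqP => E; have := Fi (mem_set (tq _ xt)) (mem_set qp) E.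
move/rowP => /(_ 0); rewrite !mxE => /eqP.
by rewrite -subr_eq0 addrAC subrr add0r -cmod_eq0 cmodR gtr0_norm// gt_eqF.
Qed.

(** Otherwise the mean value inequality would make [F] constant near [q], against injectivity. *)
Lemma Jac_nonzero_near q (s : R) : vball p r q -> 0 < s ->
  exists x, vball q s x /\ Jac F x != 0.
Proof.
move=> qp s0; apply: contrapT => H.
have [t [t0 tq]] := vopen_ball qp.
have mu : 0 < Order.min s t by rewrite lt_min s0.
have [x [xq _ /eqP]] := inj_near qp mu; apply; apply/rowP => j.
apply/eqP; rewrite -subr_eq0 -cmod_eq0; apply/eqP/le_anti.
rewrite cmod_ge0 andbT -(mul0r (vmod (x - q))).
apply: (@mean_value_ball _ _ (fcoord F j) q (Order.min s t)) => //; last exact: vball_center.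
move=> z; rewrite /vball /= lt_min => /andP[zs zt].
exists (grad (fcoord F j) z); split; first by apply/grad_sder/Fh/tq.
move=> v; rewrite mul0r -mul_Jac (_ : Jac F z = 0) ?mulmx0 ?mxE ?cmod0//.
by apply/eqP; apply: contrapT => /negP zJ; apply: H; exists z.
Qed.

Lemma hol_Jac i j : hol (fun x => Jac F x i j) (vball p r).
Proof.
rewrite (_ : (fun x => _) = fun x => app (grad (fcoord F j) x) (delta_mx 0 i)).
  by apply: hol_dir => //; exact: vopen_ball.
by apply/funext => x; rewrite app_delta mxE.
Qed.

Lemma hol_det : hol (fun x => \det (Jac F x)) (vball p r).
Proof.
move=> x xp; apply: sdiff_sum => s _; apply: sdiffZ.
by apply: sdiff_prod => i; exact: hol_Jac.
Qed.

End Injective.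

End Osgood.

(** * Critical points of injective holomorphic maps *)

Section OsgoodTheorem.
Variable R : realType.
Local Notation C := R[i].

(* If s is a point of nonzero derivative near a critical point 0, then
   (t - s) / (f t - f s) is holomorphic in t by injectivity, so the maximum
   principle bounds 1 / f'(s) uniformly in s; hence f' would vanish near 0. *)
Lemma injective_cder (f df : C -> C) (r : R) : 0 < r ->
  (forall t, cmod t < r -> cder f t (df t)) -> ccont df 0 ->
  (forall s t, cmod s < r -> cmod t < r -> f s = f t -> s = t) ->
  (exists c d N, [/\ 0 < c, 0 < d &
     forall t, cmod t < d -> c * cmod t ^+ N <= cmod (f t - f 0)]) ->
  df 0 != 0.
Proof.
move=> r0 fd dfc finj [c [d [N [c0 d0 low]]]]; apply/eqP => df0.
pose sg := Order.min (r / 4) (d / 4).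
have sg0 : 0 < sg by rewrite lt_min !divr_gt0.
have sgr : 2 * sg < r.
  apply: (@le_lt_trans _ _ (2 * (r / 4))); first by rewrite ler_pM2l// ge_min lexx.
  by move: r0; clear; lra.
have sgd : 2 * sg < d.
  apply: (@le_lt_trans _ _ (2 * (d / 4))).
    by rewrite ler_pM2l// ge_min lexx orbT.
  by move: d0; clear; lra.
pose mu := c * sg ^+ N.
have mu0 : 0 < mu by rewrite mulr_gt0// exprn_gt0.
have z0 : cmod (0 : C) < r by rewrite cmod0.
have mu2 : 0 < mu / 2 by rewrite divr_gt0.
have [e1 [e10 He1]] := cder_cont (fd 0 z0) mu2.
(* On the boundary of the square [|t - s| <= 4 sg] and [|f t - f s| >= mu - mu / 2], so [B] bounds
   the inverse difference quotient. *)
have [B [B0 BE]] : exists B, 0 < B /\ 4 * sg / (mu / 2) = B.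
  by eexists; split; last reflexivity; rewrite divr_gt0// mulr_gt0.
have B1 : 0 < (2 * B)^-1 by rewrite invr_gt0 mulr_gt0.
have [e2 [e20 He2]] := dfc _ B1.
pose e := Order.min (Order.min e1 e2) sg.
have e0 : 0 < e by rewrite lt_min sg0 lt_min e10 e20.
have er : e < r.
  apply: (@le_lt_trans _ _ (2 * sg)) => //.
  apply: (@le_trans _ _ sg); first by rewrite ge_min lexx orbT.
  by rewrite mulr_natl mulr2n lerDl ltW.
have dz s : cmod s < e -> df s = 0.
  move=> se; move: (se); rewrite lt_min => /andP[]; rewrite lt_min => /andP[s1 s2] ssg.
  have sr : cmod s < r by exact: lt_trans se er.
  apply/eqP; apply: contrapT => /negP dfs.
  have [q [q0 cq fq]] := fd s sr.
  have qE t : t != s -> q (t - s) = (f t - f s) / (t - s).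
    move=> ts; have := fq (t - s); rewrite subrKC => ->.
    by rewrite [f s + _]addrC addrK mulrC mulKf// subr_eq0.
  have wi : rect_in (- sg) sg (- sg) sg s.
    by split; rewrite -ltr_norml; apply: le_lt_trans ssg;
      [exact: cmod_Re|exact: cmod_Im].
  have neq t : cmod t < r -> t != s -> f t - f s != 0.
    move=> tr; apply: contra; rewrite subr_eq0 => /eqP E.
    by rewrite (finj _ _ tr sr E).
  have := @rect_maximum _ (fun t => (q (t - s))^-1) (- sg) sg (- sg) sg s B wi.
  have qs0 : q (s - s) != 0 by rewrite subrr q0.
  rewrite subrr q0 cmodV => H.
  have : (cmod (df s))^-1 <= B.
    apply: H => [t tr ts||t tb].
    - have t2 := le_lt_trans (square_cmod tr) sgr.
      have ts0 : 0 < cmod (t - s) by rewrite cmod_gt0 subr_eq0.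
      have fts := neq t t2 ts.
      apply: (@cdiff_near _ (fun t => (t - s) / (f t - f s)) _ _ (cmod (t - s))) => //.
        move=> h hs; have ths : t + h != s.
          apply: contraTneq hs => <-; rewrite opprD addNKr cmodN.
          by rewrite ltxx.
        by rewrite qE// invf_div.
      apply: cdiffM; first by apply: cdiffB; [exact: cdiff_id|exact: cdiff_cst].
      apply: cdiffV => //; apply: cdiffB; last exact: cdiff_cst.
      by exists (df t); exact: fd.
    - apply: contcV => // u /cq[x [x0 Hx]]; exists x; split=> // h /Hx.
      by rewrite add0r subrr [s + h]addrC addrK.
    - have ts := rect_in_bd wi tb.
      have tsq := square_cmod (proj1 tb); have t2 := le_lt_trans tsq sgr.
      have h1 := low t (le_lt_trans tsq sgd).
      have h2 : mu <= cmod (f t - f 0).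
        apply: le_trans h1; rewrite ler_wpM2l ?(ltW c0)//.
        by rewrite lerXn2r ?nnegrE ?cmod_ge0 ?(ltW sg0) ?square0_bd.
      have h3 : cmod (f s - f 0) <= mu / 2 by have := He1 _ s1; rewrite add0r.
      have h4 : mu / 2 <= cmod (f t - f s).
        have := cmodD (f t - f s) (f s - f 0); rewrite subrKA => h5.
        have := le_trans h2 (le_trans h5 (lerD (lexx _) h3)).
        by move: (cmod (f t - f s)) => u; clear; lra.
      rewrite qE// invf_div cmodM cmodV -BE; apply: ler_pM.
      + exact: cmod_ge0.
      + by rewrite invr_ge0 cmod_ge0.
      + rewrite (le_trans (cmodD _ _))// cmodN (_ : 4 * sg = 2 * sg + 2 * sg); last by ring.
        rewrite lerD// (le_trans (ltW ssg))// mulr_natl mulr2n lerDl ltW//.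
      + by rewrite lef_pV2 ?posrE// (lt_le_trans mu2).
  rewrite invf_ple ?posrE ?cmod_gt0//.
  have := He2 _ s2; rewrite add0r df0 subr0 => h1 h2.
  have := le_trans h2 h1; rewrite lef_pV2 ?posrE ?mulr_gt0//.
  by rewrite leNgt mulr_natl mulr2n ltrDl B0.
pose u : C := ((e / 2)%:C)%C.
have ue : cmod u < e.
  by rewrite cmodR gtr0_norm ?divr_gt0// ltr_pdivrMr// mulr_natr mulr2n ltrDl.
have : f u = f 0.
  apply/eqP; rewrite -subr_eq0 -cmod_eq0; apply/eqP/le_anti; rewrite cmod_ge0 andbT.
  apply: cmean_value => t /andP[t0 t1]; exists 0.
  have tu : cmod ((t%:C)%C * u) < e.
    by apply: le_lt_trans ue; rewrite cmodM cmodR ger0_norm// ler_piMl// cmod_ge0.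
  split; last by rewrite cmod0 mul0r.
  by rewrite -(dz _ tu); apply: fd; exact: lt_trans tu er.
move=> /(finj _ _ (lt_trans ue er) z0)/eqP; rewrite -cmod_eq0 cmodR gtr0_norm ?divr_gt0//.
by rewrite gt_eqF// divr_gt0.
Qed.

Lemma quarters_lt (x : R) : 0 < x -> x / 4 + x / 4 < x.
Proof. lra. Qed.

Lemma half_le_pos (x : R) : 0 < x -> x / 2 <= x.
Proof. lra. Qed.

Lemma double_half (x : R) : 2 * (x / 2) = x.
Proof. lra. Qed.

Section RankZero.
Variables (m : nat) (F : 'rV[C]_m.+1 -> 'rV[C]_m.+1) (p : 'rV[C]_m.+1) (r : R).
Hypotheses (r0 : 0 < r) (Fh : vhol F (vball p r)) (Fi : set_inj (vball p r) F).

Let pp : vball p r p := vball_center p r0.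

(* Minimality of the vanishing order N of J makes every zero of J near q a zero
   of the (N-1)-st derivative K of J along v, and K has a simple zero along v;
   so the zeros of J contain a Lipschitz curve, on which F is constant. *)
Lemma rank_zero_dim_gt1 : (0 < m)%N ->
  (forall x, vball p r x -> Jac F x != 0 -> Jac F x \in unitmx) -> Jac F p != 0.
Proof.
move=> m0 HJ; apply/eqP => Jp0.
pose J x := \det (Jac F x).
have Jh : hol J (vball p r) by exact: hol_det.
have JZ x : vball p r x -> J x = 0 -> Jac F x = 0.
  move=> xp Jx; apply/eqP; apply: contrapT => /negP /(HJ x xp).
  by rewrite unitmxE -/(J x) Jx unitr0.
(* Zero and direction are both free, so that minimality also constrains the zeros of [J] near the
   optimal [q]; the contradiction arises at [q] and not at [p]. *)
pose P N := exists q v, [/\ vball p r q, J q = 0 & dir_iter J v N q != 0].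
have exP : exists N, `[< P N >].
  have [|v [N [_ vN]]] := hol_order r0 Jh.
    move=> s s0.
    have sr : 0 < Order.min s r by rewrite lt_min s0.
    have [x [xs Jx]] := Jac_nonzero_near Fh Fi pp sr.
    move: xs; rewrite /vball /= lt_min => /andP[xs xr].
    exists x; split=> //; have := HJ x xr Jx.
    by rewrite unitmxE unitfE.
  exists N; apply/asboolP; exists p, v; split=> //.
  by rewrite /J Jp0 det0.
have [N /asboolP[q [v [qp Jq JvN]]] minN] := ex_minnP exP.
have minN' x w k : vball p r x -> J x = 0 -> (k < N)%N -> dir_iter J w k x = 0.
  move=> xp Jx kN; apply/eqP; apply: contraTT kN => nz; rewrite -leqNgt.
  by apply: minN; apply/asboolP; exists x, w.
(* Order 0 would say [J q != 0]; from here on the minimal order is [N.+1]. *)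
case: N JvN minN minN' => [|N] JvN minN minN'; first by move: JvN; rewrite /= Jq eqxx.
have [rq [rq0 rqp]] := vopen_ball qp.
have Jhq : hol J (vball q rq) by move=> x /rqp; exact: Jh.
have v0 : v != 0.
  apply: contraNneq JvN => v0; rewrite /= v0 app0; exact: eqxx.
pose K := dir_iter J v N.
have Kh : hol K (vball q rq) by apply: hol_dir_iter => //; exact: vopen_ball.
pose kap := cmod (app (grad K q) v).
have kap0 : 0 < kap by rewrite cmod_gt0.
have [i vi] : exists i, v 0 i != 0.
  apply: contrapT => H; move/negP: v0; apply; apply/eqP/rowP => i; rewrite mxE.
  by apply/eqP; apply: contrapT => /negP vi; apply: H; exists i.
(* Dimension at least 2 enters here: [w] is a direction independent of [v]. *)
have [j ji] : exists j : 'I_m.+1, j != i.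
  have : (1 < #|'I_m.+1|)%N by rewrite card_ord.
  move=> /card_gt1P[a [b [_ _ ab]]].
  by have [ai|ai] := eqVneq a i; [exists b; rewrite -ai eq_sym|exists a].
pose w : 'rV[C]_m.+1 := delta_mx 0 j.
have vp : 0 < vmod v by rewrite vmod_gt0.
have e0 : 0 < kap / (2 * vmod v) by rewrite divr_gt0// mulr_gt0.
have [dk [dk0 _ HK]] := strict_sder rq0 Kh e0.
pose ek := kap / (2 * vmod v).
(* The Lipschitz constant of the zero set of [K] as a graph over [w]: [ek * vmod v = kap / 2] lets
   half of the derivative along [v] absorb the error. *)
pose B := (ek * vmod w + cmod (app (grad K q) w)) / (kap / 2).
have B0 : 0 <= B.
  by rewrite !divr_ge0 ?(ltW kap0)// addr_ge0 ?cmod_ge0// mulr_ge0 ?vmod_ge0// ltW.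
have Klip (s s' t t' : C) : vball q dk (q + s *: w + t *: v) ->
    vball q dk (q + s' *: w + t' *: v) ->
    K (q + s *: w + t *: v) = 0 -> K (q + s' *: w + t' *: v) = 0 ->
    cmod (t' - t) <= B * cmod (s' - s).
  move=> xq yq Kx Ky; have := HK _ _ xq yq; rewrite Kx Ky subrr sub0r cmodN.
  have -> : q + s' *: w + t' *: v - (q + s *: w + t *: v) =
      (s' - s) *: w + (t' - t) *: v by apply/rowP => k; rewrite !mxE; ring.
  rewrite appD !appZ -/ek => h1.
  have h2 : cmod ((t' - t) * app (grad K q) v) <=
      ek * (cmod (s' - s) * vmod w + cmod (t' - t) * vmod v) +
      cmod (s' - s) * cmod (app (grad K q) w).
    rewrite -[_ * _](addKr ((s' - s) * app (grad K q) w)) addrC.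
    rewrite (le_trans (cmodD _ _))// cmodN [cmod ((s' - s) * _)]cmodM lerD2r.
    apply: (le_trans h1); rewrite ler_wpM2l ?(ltW e0)//.
    by rewrite (le_trans (vmodD _ _))// !vmodZ.
  rewrite cmodM -/kap in h2.
  have h3 : ek * (cmod (t' - t) * vmod v) = cmod (t' - t) * (kap / 2).
    by rewrite /ek; field; rewrite gt_eqF.
  rewrite /B mulrAC ler_pdivlMr ?divr_gt0//.
  rewrite mulrDr h3 in h2.
  have h4 : cmod (t' - t) * kap = cmod (t' - t) * (kap / 2) + cmod (t' - t) * (kap / 2).
    by rewrite -mulrDr -splitr.
  rewrite h4 addrAC lerD2r in h2; apply: (le_trans h2).
  by rewrite le_eqVlt; apply/orP; left; apply/eqP; ring.
have [rho [rho0 Hrho]] : exists rho : R, 0 < rho /\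
    forall j, exists M, bhol (fcoord F j) q rho M.
  apply: finite_min => [l|l a b [M aM] ba].
    have [|a [M [a0 _ aM]]] := @scont_bhol _ _ (fcoord F l) q rq rq0.
      by move=> x /rqp; exact: Fh.
    by exists a; split=> //; exists M.
  exists M; split=> x xb; [apply: (proj1 aM)|apply: (proj2 aM)];
    exact: lt_le_trans xb ba.
have w1 : vmod w <= 1.
  by apply/vmod_leP => // l; rewrite mxE; case: (_ && _); rewrite ?cmod1 ?cmod0.
pose rr := Order.min (Order.min (rho / 4) dk) rq.
have rr0 : 0 < rr by rewrite !lt_min dk0 rq0 divr_gt0.
have eps0 : 0 < rr / (4 * vmod v) by rewrite divr_gt0// mulr_gt0.
have [c [d [c0 d0 low]]] := dir_iter_lower rq0 Jhq (fun k => minN' q v k qp Jq) JvN.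
have [s1 [s10 root]] := zero_curve w rq0 Jhq Jq c0 d0 low eps0.
pose s2 := Order.min s1 (rr / 4).
have s20 : 0 < s2 by rewrite lt_min s10 divr_gt0.
have inb (s t : C) : cmod s <= s2 -> cmod t <= rr / (4 * vmod v) ->
    vball q rr (q + s *: w + t *: v).
  move=> ss tt; rewrite /vball /= -[q + _ + _]addrA [q + _]addrC addrK.
  apply: (le_lt_trans (vmodD _ _)); rewrite !vmodZ.
  have a1 : cmod s * vmod w <= rr / 4.
    rewrite (le_trans (ler_wpM2l (cmod_ge0 _) w1))// mulr1 (le_trans ss)//.
    by rewrite ge_min lexx orbT.
  have a2 : cmod t * vmod v <= rr / 4.
    rewrite -ler_pdivlMr// (le_trans tt)// le_eqVlt; apply/orP; left; apply/eqP.
    by field; rewrite gt_eqF.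
  exact: (le_lt_trans (lerD a1 a2) (quarters_lt rr0)).
have rt (s : R) : exists t : C, `|s| <= s2 -> cmod t <= rr / (4 * vmod v) /\
    J (q + (s%:C)%C *: w + t *: v) = 0.
  case: (pselect (`|s| <= s2)) => [ss|ns]; last by exists 0.
  have [|t Ht] := root (s%:C)%C.
    by rewrite cmodR (le_trans ss)// ge_min lexx.
  by exists t.
have [T HT] := choice rt.
(* The chosen root over 0 could differ from 0; this makes the curve start at [q]. *)
pose T' s := if s == 0 then 0 else T s.
have HT' s : `|s| <= s2 -> cmod (T' s) <= rr / (4 * vmod v) /\
    J (q + (s%:C)%C *: w + T' s *: v) = 0.
  rewrite /T'; case: eqVneq => [-> _|_]; last exact: HT.
  by rewrite cmod0 !scale0r !addr0; split => //; exact: ltW.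
pose X s := q + (s%:C)%C *: w + T' s *: v.
have Xr s : `|s| <= s2 -> vball q rr (X s).
  by move=> ss; have [h _] := HT' s ss; apply: inb => //; rewrite cmodR.
have Xp s : `|s| <= s2 -> vball p r (X s).
  move=> /Xr; rewrite /vball /= lt_min => /andP[_ h]; exact: rqp.
have Xk s : `|s| <= s2 -> vball q dk (X s).
  by move=> /Xr; rewrite /vball /= !lt_min => /andP[/andP[]].
have Xrho s : `|s| <= s2 -> vball q (rho / 4) (X s).
  by move=> /Xr; rewrite /vball /= !lt_min => /andP[/andP[]].
have XK s : `|s| <= s2 -> K (X s) = 0.
  by move=> ss; apply: minN' => //; [exact: Xp|case: (HT' s ss)].
have XJ s : `|s| <= s2 -> Jac F (X s) = 0.
  by move=> ss; apply: JZ; [exact: Xp|case: (HT' s ss)].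
pose A := vmod w + B * vmod v.
have A0 : 0 <= A by exact: addr_ge0 (vmod_ge0 _) (mulr_ge0 B0 (vmod_ge0 _)).
have Xlip s s' : `|s| <= s2 -> `|s'| <= s2 -> vmod (X s' - X s) <= A * `|s' - s|.
  move=> ss ss'; have tt := Klip _ _ _ _ (Xk s ss) (Xk s' ss') (XK s ss) (XK s' ss').
  have -> : X s' - X s = ((s' - s)%:C)%C *: w + (T' s' - T' s) *: v.
    by rewrite rmorphB; apply/rowP => k; rewrite !mxE; ring.
  rewrite (le_trans (vmodD _ _))// !vmodZ cmodR mulrDl mulrC lerD2l.
  rewrite mulrAC ler_wpM2r ?vmod_ge0//.
  by rewrite (le_trans tt)// -rmorphB cmodR.
(* The curve is only known to be Lipschitz, so the chain rule is replaced by [bhol_quad]: with the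
   Jacobian zero on the curve, increments of [F] are quadratic in the parameter. *)
have FX : F (X (s2 / 2)) = F (X 0).
  apply/rowP => l; have [M Mb] := Hrho l.
  pose K2 := 1024 * M / rho ^+ 2.
  have K20 : 0 <= K2.
    exact: divr_ge0 (mulr_ge0 (ler0n _ _) (bhol_ge0 rho0 Mb)) (exprn_ge0 _ (ltW rho0)).
  apply/eqP; rewrite -subr_eq0 -cmod_eq0; apply/eqP/le_anti; rewrite cmod_ge0 andbT.
  have := @mean_value R (fun t => fcoord F l (X (t * (s2 / 2)))) 0.
  rewrite mul1r mul0r; apply=> t /andP[t0 t1] e ep; rewrite add0r.
  pose D := K2 * (A * (s2 / 2)) ^+ 2.
  have D0 : 0 <= D by rewrite mulr_ge0// exprn_ge0// mulr_ge0// ltW// divr_gt0.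
  have D1 : 0 < D + 1 by rewrite ltr_wpDl.
  exists (Order.min 1 (e / (D + 1))); split; first by rewrite lt_min ltr01 divr_gt0.
  move=> s; rewrite lt_min => /andP[sl se].
  have s2h : 0 < s2 / 2 by rewrite divr_gt0.
  have tb : `|t * (s2 / 2)| <= s2.
    rewrite normrM (gtr0_norm s2h) ger0_norm// (le_trans (ler_wpM2r (ltW s2h) t1))//.
    by rewrite mul1r half_le_pos.
  have sb : `|s * (s2 / 2)| <= s2.
    rewrite normrM (gtr0_norm s2h).
    have h2 : `|s| <= 2.
      rewrite -(subrK t s) (le_trans (ler_normD _ _))// -[2]/(1 + 1).
      by apply: lerD; [exact: ltW|rewrite ger0_norm].
    by rewrite (le_trans (ler_wpM2r (ltW s2h) h2))// double_half.
  have := bhol_quad rho0 Mb (Xrho _ tb) (Xrho _ sb).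
  rewrite -[app _ _]mul_Jac XJ// mulmx0 [(0 : 'rV__) _ _]mxE subr0 -/K2 => h.
  apply: (le_trans h); apply: (@le_trans _ _ (D * `|s - t| ^+ 2)).
    rewrite /D -mulrA -exprMn ler_wpM2l// lerXn2r ?nnegrE ?vmod_ge0//.
      by rewrite mulr_ge0// mulr_ge0// ltW.
    have := Xlip _ _ tb sb; rewrite -mulrBl normrM (gtr0_norm s2h).
    by rewrite [`|s - t| * _]mulrC [A * (_ * `|_|)]mulrA.
  rewrite expr2 mulrA ler_wpM2r//.
  apply: (@le_trans _ _ ((D + 1) * `|s - t|)); first by rewrite ler_wpM2r// lerDl.
  by rewrite mulrC -ler_pdivlMr// ltW.
have s2b : `|s2 / 2| <= s2.
  by rewrite gtr0_norm ?divr_gt0// half_le_pos.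
have z2b : `|0 : R| <= s2 by rewrite normr0 ltW.
have := Fi (mem_set (Xp _ s2b)) (mem_set (Xp _ z2b)) FX.
rewrite /X {2}/T' eqxx !scale0r !addr0 => E.
have {}E k : ((s2 / 2)%:C)%C * w 0 k + T' (s2 / 2) * v 0 k = 0.
  by have := congr1 (fun x : 'rV__ => (x - q) 0 k) E; rewrite /= subrr -[q + _ + _]addrA
    [q + _]addrC addrK !mxE.
(* Coordinate [i] of [w] is 0 and that of [v] is not, so the root is 0; coordinate [j] then forces
   [s2 = 0]. *)
have := E i; rewrite !mxE eqxx /= eq_sym (negbTE ji) mulr0 add0r => /eqP.
rewrite mulf_eq0 (negbTE vi) orbF => /eqP T0.
have := E j; rewrite T0 !mxE !eqxx mulr1 mul0r addr0 => /eqP.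
by rewrite -cmod_eq0 cmodR gtr0_norm ?divr_gt0// gt_eqF// divr_gt0.
Qed.

End RankZero.
End OsgoodTheorem.

(** * Osgood's theorem by induction on the dimension *)

Section Biholomorphic.
Variable R : realType.
Local Notation C := R[i].

(** [injective_cder] on the line [p + t v]; the finite order of [F - F p] along [v] supplies the
    lower bound it asks for. *)
Lemma rank_zero_dim1 (F : 'rV[C]_1 -> 'rV[C]_1) p (r : R) : 0 < r ->
  vhol F (vball p r) -> set_inj (vball p r) F -> Jac F p != 0.
Proof.
move=> r0 Fh Fi; have pp := vball_center p r0.
pose f x := fcoord F 0 x - F p 0 0.
have fh : hol f (vball p r).
  by move=> x xp; apply: sdiffB; [exact: Fh|exact: sdiff_cst].
have fp : f p = 0 by rewrite /f subrr.
have [|v [N [vN0 vN]]] := hol_order r0 fh.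
  move=> s s0; have [x [xs xp Fx]] := inj_near Fi pp s0.
  exists x; split=> //; apply: contra Fx; rewrite subr_eq0 => /eqP E.
  by apply/eqP/rowP => j; rewrite ord1.
have [c [d [c0 d0 low]]] := dir_iter_lower r0 fh vN0 vN.
have v0 : v != 0.
  apply/eqP => v0; case: N vN {vN0 low} => [|N]; first by rewrite /= fp eqxx.
  by rewrite /= v0 app0 eqxx.
have v1 : 0 < vmod v by rewrite vmod_gt0.
have inb t : cmod t < r / vmod v -> vball p r (p + t *: v).
  by move=> tr; rewrite /vball /= [p + _]addrC addrK vmodZ -ltr_pdivlMr.
have := @injective_cder R (fun t => fcoord F 0 (p + t *: v))
  (fun t => app (grad (fcoord F 0) (p + t *: v)) v) (r / vmod v).
rewrite scale0r addr0 => H.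
suff : app (grad (fcoord F 0) p) v != 0.
  by apply: contraNneq => J0; rewrite -mul_Jac J0 mulmx0 mxE.
apply: H.
- exact: divr_gt0.
- by move=> t tr; apply: sder_slice; apply: grad_sder; exact/Fh/inb.
- have fd : sdiff (fun x => app (grad (fcoord F 0) x) v) (p + 0 *: v).
    by rewrite scale0r addr0; apply: (hol_dir v (@vopen_ball _ _ p r) (Fh 0)).
  exact: cdiff_cont (sdiff_slice fd).
- move=> s t sr tr E.
  have EF : F (p + s *: v) = F (p + t *: v) by apply/rowP => j; rewrite ord1.
  have := Fi _ _ (mem_set (inb s sr)) (mem_set (inb t tr)) EF.
  move=> /addrI/eqP; rewrite -subr_eq0 -scalerBl scaler_eq0 (negbTE v0) orbF subr_eq0.
  by move/eqP.
- by exists c, d, N; split=> // t td; exact: low.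
Qed.

Lemma unitmx_ker n (A : 'M[C]_n) : (forall v : 'rV_n, v *m A = 0 -> v = 0) ->
  A \in unitmx.
Proof.
move=> H; rewrite -row_free_unit -kermx_eq0; apply/eqP/row_matrixP => i.
by rewrite row0; apply: H; apply/sub_kermxP; exact: row_sub.
Qed.

Lemma app_coord n (i : 'I_n) (v : 'rV[C]_n) : app (delta_mx i 0) v = v 0 i.
Proof. by rewrite /app -colE mxE. Qed.

Lemma sdiff_coord n (i : 'I_n) (x : 'rV[C]_n) : sdiff (fun y => y 0 i) x.
Proof.
exists (delta_mx i 0); rewrite (_ : (fun y => _) = app (delta_mx i 0)).
  exact: sder_app.
by apply/funext => y; rewrite app_coord.
Qed.

Section RankPositive.
Variable m : nat.

Definition embed (c : C) (w : 'rV[C]_m) : 'rV[C]_m.+1 :=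
  \row_k oapp (fun k' => w 0 k') c (unlift ord0 k).

Lemma embed0 c w : embed c w 0 ord0 = c.
Proof. by rewrite mxE unlift_none. Qed.

Lemma embedS c w k : embed c w 0 (lift ord0 k) = w 0 k.
Proof. by rewrite mxE liftK. Qed.

Lemma sdiff_embed c k w : sdiff (fcoord (embed c) k) w.
Proof.
case: (unliftP ord0 k) => [k' ->|->].
  rewrite (_ : fcoord _ _ = fun y => y 0 k'); first exact: sdiff_coord.
  by apply/funext => y; exact: embedS.
rewrite (_ : fcoord _ _ = fun=> c); first exact: sdiff_cst.
by apply/funext => y; exact: embed0.
Qed.

Lemma Jac_embed c w u : u *m Jac (embed c) w = embed 0 u.
Proof.
apply/rowP => k; rewrite mul_Jac; case: (unliftP ord0 k) => [k' ->|->].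
  rewrite embedS -(app_coord k' u); congr app; apply: gradE.
  rewrite (_ : fcoord _ _ = app (delta_mx k' 0)); first exact: sder_app.
  by apply/funext => y; rewrite app_coord; exact: embedS.
rewrite embed0 (_ : fcoord _ _ = fun=> c); last by apply/funext => y; exact: embed0.
by rewrite (gradE (sder_cst c w)) /app mulmx0 mxE.
Qed.

(** By the nonzero entry, component [j0] of [F] can replace coordinate [i0] (the map [Phi]). On the
    slice where this component is constant the others form an injective map [H] of [m] variables,
    invertible by induction. A kernel vector of the Jacobian of [F] is tangent to the slice and
    yields one for [H]. *)
Lemma rank_pos (F : 'rV[C]_m.+1 -> 'rV[C]_m.+1) p (r : R) :
  (forall (H : 'rV[C]_m -> 'rV[C]_m) q (s : R), 0 < s -> vhol H (vball q s) ->
     set_inj (vball q s) H -> Jac H q \in unitmx) ->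
  0 < r -> vhol F (vball p r) -> set_inj (vball p r) F ->
  Jac F p != 0 -> Jac F p \in unitmx.
Proof.
move=> IH r0 Fh Fi J0; have pp := vball_center p r0.
have [i0 [j0 Jij]] : exists i0 j0, Jac F p i0 j0 != 0.
  apply: contrapT => H; move/eqP: J0; apply; apply/matrixP => i j; rewrite [RHS]mxE.
  by apply/eqP; apply: contrapT => /negP ij; apply: H; exists i, j.
pose rest (x : 'rV[C]_m.+1) : 'rV[C]_m := \row_k x 0 (lift i0 k).
pose Phi x := embed (F x 0 j0) (rest x).
have Phi0 : fcoord Phi ord0 = fcoord F j0.
  by apply/funext => x; exact: embed0.
have PhiS k : fcoord Phi (lift ord0 k) = app (delta_mx (lift i0 k) 0).
  by apply/funext => x; rewrite app_coord /fcoord embedS mxE.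
have Phih : vhol Phi (vball p r).
  move=> k x xp; case: (unliftP ord0 k) => [k' ->|->].
    by rewrite PhiS; exact: sdiff_app.
  by rewrite Phi0; exact: Fh.
have JPhi v : v *m Jac Phi p = embed ((v *m Jac F p) 0 j0) (rest v).
  apply/rowP => k; rewrite mul_Jac; case: (unliftP ord0 k) => [k' ->|->].
    by rewrite PhiS embedS (gradE (sder_app _ p)) app_coord mxE.
  by rewrite Phi0 embed0 mul_Jac.
have JPhiu : Jac Phi p \in unitmx.
  apply: unitmx_ker => v; rewrite JPhi => E.
  have vS k : v 0 (lift i0 k) = 0.
    by have := congr1 (fun x : 'rV__ => x 0 (lift ord0 k)) E; rewrite embedS !mxE.
  have := congr1 (fun x : 'rV__ => x 0 ord0) E; rewrite embed0 !mxE.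
  rewrite (bigD1 i0)//= big1 ?addr0 => [|k ki]; last first.
    by case: (unliftP i0 k) ki => [k' ->|->]; [rewrite vS mul0r|rewrite eqxx].
  move/eqP; rewrite mulf_eq0 (negbTE Jij) orbF => /eqP v0.
  by apply/rowP => k; rewrite mxE; case: (unliftP i0 k) => [k' ->|->].
have [e [Psi [e0 PsiP Psi1 Psih]]] := local_inverse r0 Phih JPhiu.
pose c := F p 0 j0; pose q := rest p.
have emb w : vball q e w -> vball (Phi p) e (embed c w).
  rewrite /vball /= => wq; apply/vmod_ltP => // k.
  have -> : (embed c w - Phi p) 0 k = embed c w 0 k - embed c q 0 k.
    by rewrite [LHS]mxE [X in _ + X]mxE.
  case: (unliftP ord0 k) => [k' ->|->]; last by rewrite !embed0 subrr cmod0.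
  rewrite !embedS; apply: le_lt_trans wq.
  by have := vmod_coord (w - q) k'; rewrite [X in cmod X]mxE [X in cmod (_ + X)]mxE.
pose sig w := Psi (embed c w).
have sigh : vhol sig (vball q e).
  move=> i w wq.
  apply: (@sdiff_comp _ _ _ (embed c) (fcoord Psi i)).
    by move=> k; exact: sdiff_embed.
  exact/Psih/emb.
have sigr w : vball q e w -> vball p r (sig w) by move=> /emb/Psi1[].
have Phisig w : vball q e w -> Phi (sig w) = embed c w by move=> /emb/Psi1[].
have qq := vball_center q e0.
have sigq : sig q = p by exact: PsiP.
pose H w : 'rV[C]_m := \row_k F (sig w) 0 (lift j0 k).
have HE k : fcoord H k = fun w => fcoord F (lift j0 k) (sig w).
  by apply/funext => w; rewrite /fcoord mxE.
have Hh : vhol H (vball q e).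
  move=> k w wq; rewrite HE; apply: (@sdiff_comp _ _ _ sig (fcoord F (lift j0 k))).
    by move=> i; exact: sigh.
  exact/Fh/sigr.
have Hi : set_inj (vball q e) H.
  move=> w w' /set_mem wq /set_mem wq' HH.
  have FF : F (sig w) = F (sig w').
    apply/rowP => j; case: (unliftP j0 j) => [k ->|->].
      by have := congr1 (fun x : 'rV__ => x 0 k) HH; rewrite !mxE.
    have := congr1 (fun x : 'rV__ => x 0 ord0) (Phisig w wq).
    have := congr1 (fun x : 'rV__ => x 0 ord0) (Phisig w' wq').
    by rewrite !embed0 => -> ->.
  have ss := Fi _ _ (mem_set (sigr w wq)) (mem_set (sigr w' wq')) FF.
  have := Phisig w wq; rewrite ss (Phisig w' wq') => E.
  by apply/rowP => k; have := congr1 (fun x : 'rV__ => x 0 (lift ord0 k)) E;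
    rewrite !embedS.
have JH := IH H q e e0 Hh Hi.
apply: unitmx_ker => v vJ; pose u := rest v.
have sd j : sdiff (fcoord sig j) q by exact: sigh.
have uJ : u *m Jac (Phi \o sig) q = embed 0 u.
  rewrite -(Jac_embed c q); apply/rowP => k; rewrite !mul_Jac; congr app.
  apply: gradE; apply: (@sder_near _ _ (fcoord (embed c) k) _ _ e) => //.
    by move=> y yq; rewrite /fcoord /= Phisig.
  exact/grad_sder/sdiff_embed.
(* Component [j0] of [v *m Jac F p] is 0, so [v] is the image of [u] under the parametrisation [sig]
   of the slice. *)
have vE : v = u *m Jac sig q.
  apply: (can_inj (mulmxK JPhiu)); rewrite JPhi vJ mxE -/u.
  rewrite -uJ Jac_comp// ?sigq ?mulmxA// => j; exact: Phih.
suff u0 : u = 0 by rewrite vE u0 mul0mx.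
apply: (can_inj (mulmxK JH)); rewrite mul0mx; apply/rowP => k.
rewrite mul_Jac HE.
have Fd : sdiff (fcoord F (lift j0 k)) (sig q) by rewrite sigq; exact: Fh.
rewrite (gradE (sder_comp sd (grad_sder Fd))) /app mulmxA -vE sigq -/(app _ v).
by rewrite -mul_Jac vJ !mxE.
Qed.

End RankPositive.

Theorem osgood n (F : 'rV[C]_n -> 'rV[C]_n) p (r : R) : 0 < r ->
  vhol F (vball p r) -> set_inj (vball p r) F -> Jac F p \in unitmx.
Proof.
elim: n F p r => [|m IH] F p r r0 Fh Fi.
  by rewrite unitmxE det_mx00 unitr1.
(* On the whole ball the Jacobian matrix is thus zero or invertible, the dichotomy that the case of
   a zero matrix builds on. *)
have HJ x : vball p r x -> Jac F x != 0 -> Jac F x \in unitmx.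
  move=> xp; have [t [t0 tx]] := vopen_ball xp.
  apply: (@rank_pos m F x t IH t0).
    by move=> j y /tx; exact: Fh.
  by move=> y z /set_mem/tx/mem_set yp /set_mem/tx/mem_set; exact: Fi.
apply: (HJ p (vball_center p r0)).
case: m IH F p Fh Fi HJ => [|m] _ F p Fh Fi HJ; first exact: rank_zero_dim1 r0 Fh Fi.
exact: rank_zero_dim_gt1 r0 Fh Fi _ HJ.
Qed.

(** Near [F x] the set-theoretic inverse coincides with the local one, since the latter takes values
    in [D]. *)
Theorem injective_hol_inverse n (F : 'rV[C]_n -> 'rV[C]_n) (D : set 'rV[C]_n) :
  vopen D -> vhol F D -> set_inj D F ->
  exists g, forall x, D x -> g (F x) = x /\ forall j, sdiff (fcoord g j) (F x).
Proof.
move=> Do Fh Fi.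
pose g y := xget 0 [set x | D x /\ F x = y].
have gF x : D x -> g (F x) = x.
  move=> Dx; rewrite /g; case: xgetP => [z _ [Dz Fz]|/(_ x)]; last by case.
  exact: Fi (mem_set Dz) (mem_set Dx) Fz.
exists g => x Dx; split=> [|j]; first exact: gF.
have [r [r0 rD]] := Do x Dx.
have Fhr : vhol F (vball x r) by move=> k y /rD; exact: Fh.
have Fir : set_inj (vball x r) F.
  by move=> y z /set_mem/rD/mem_set yp /set_mem/rD/mem_set; exact: Fi.
have [e [h [e0 _ hP hh]]] := local_inverse r0 Fhr (osgood r0 Fhr Fir).
have [G hG] := hh j _ (vball_center (F x) e0).
exists G; apply: sder_near e0 _ hG => y ye; rewrite /fcoord.
by have [Fhy /rD hyD] := hP y ye; rewrite -{2}Fhy gF.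
Qed.

End Biholomorphic.

(** * Translation to and from Frechet differentiability *)

Section Differentiable.
Variable R : realType.
Local Notation C := R[i].

Lemma littleo_vmodP n m (f g : 'rV[C]_n -> 'rV[C]_m) :
  (f = g +o_ (0 : 'rV[C]_n) id) <-> forall e : R, 0 < e -> exists d, 0 < d /\
    forall h, vmod h < d -> vmod (f h - g h) <= e * vmod h.
Proof.
split=> [/eqaddoP H e e0|H].
  have e0' : 0 < (e%:C)%C :> C by rewrite (ltcR 0).
  have /vnbhsP[d [d0 Hd]] := H _ e0'.
  exists d; split=> // h hd; have := Hd h.
  rewrite /vball /= subr0 => /(_ hd).
  rewrite [`|(f - g) h|]norm_vmod [`|id h|]norm_vmod -rmorphM lecR.
  exact.
apply/eqaddoP => e; rewrite ltcE => /andP[/eqP /= e1 e0].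
have -> : e = ((Re e)%:C)%C by apply: cplx_eq.
have [d [d0 Hd]] := H _ e0.
apply/vnbhsP; exists d; split=> // h; rewrite /vball /= subr0 => /Hd h1.
by rewrite [`|(f - g) h|]norm_vmod [`|id h|]norm_vmod -rmorphM lecR.
Qed.

Lemma row_continuous n m (J : 'M[C]_(n, m)) :
  continuous (mulmxr J : 'rV[C]_n -> 'rV[C]_m).
Proof.
have [a [a0 Ha]] := mxmod_le J.
move=> x; have FF : Filter (nbhs (x : 'rV[C]_n)) by exact: nbhs_filter.
apply/(@cvgrPdist_le _ _ _ (nbhs (x : 'rV[C]_n)) FF) => e; rewrite ltcE => /andP[/eqP /= e1 e0].
have -> : e = ((Re e)%:C)%C by apply: cplx_eq.
apply/vnbhsP; exists (Re e / a); split=> [|y]; first exact: divr_gt0.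
rewrite /vball /= ltr_pdivlMr// => yx.
rewrite -mulmxBl norm_vmod lecR (le_trans (Ha _))// vmod_distC mulrC ltW//.
Qed.

Lemma sdiff_differentiable n m (f : 'rV[C]_n -> 'rV[C]_m) x :
  (forall j, sdiff (fcoord f j) x) -> differentiable f x.
Proof.
move=> fd; have cJ := @row_continuous n m (Jac f x).
have E : f \o shift x = cst (f x) + mulmxr (Jac f x) +o_ (0 : 'rV[C]_n) id.
  apply/littleo_vmodP => e e0; have [d [d0 Hd]] := vhol_vder fd e0.
  exists d; split=> // h /Hd; rewrite [x + h]addrC.
  by rewrite /= [(_ + _) h]/(f x + h *m Jac f x) opprD addrA.
apply/diff_locallyP; rewrite (diff_unique cJ E); split=> //.
Qed.

Lemma app_linear n m (df : {linear 'rV[C]_n -> 'rV[C]_m}) j h :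
  app (\col_i (df (delta_mx 0 i)) 0 j) h = df h 0 j.
Proof.
rewrite appE [in RHS](row_sum_delta h) linear_sum summxE.
by apply: eq_bigr => i _; rewrite linearZ !mxE.
Qed.

Lemma differentiable_sdiff n m (f : 'rV[C]_n -> 'rV[C]_m) x j :
  differentiable f x -> sdiff (fcoord f j) x.
Proof.
move=> /diff_locallyP[dc /littleo_vmodP H].
exists (\col_i ('d f x (delta_mx 0 i)) 0 j) => e e0.
have [d [d0 Hd]] := H e e0; exists d; split=> // h /Hd.
apply: le_trans; apply: le_trans (vmod_coord _ j).
rewrite app_linear /fcoord /=.
rewrite [(_ + _) h]/(f x + 'd f x h) opprD addrA !mxE [h + x]addrC.
exact: lexx.
Qed.

Lemma sdiff_differentiable1 n (f : 'rV[C]_n -> C) x : sdiff f x -> differentiable f x.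
Proof.
(* A scalar function is treated as a map into ['rV[C]_1] followed by a coordinate. *)
move=> fd; pose F y : 'rV[C]_1 := const_mx (f y).
have Fd : differentiable F x.
  apply: sdiff_differentiable => j.
  rewrite (_ : fcoord F j = f)//; apply/funext => y; rewrite /fcoord mxE//.
rewrite (_ : f = (fun M : 'rV[C]_1 => M 0 0 : C) \o F); last first.
  by apply/funext => y; rewrite /= mxE.
apply: differentiable_comp => //; exact: differentiable_coord.
Qed.

End Differentiable.

(** * Separation of a point from an open convex set *)

Section HahnBanach.
Variables (R : realType) (n : nat).
Local Notation C := R[i].
Local Notation V := 'rV[C]_n.
Implicit Types (q g : V -> R) (x y v w : V) (s t : R).

Local Notation "s *r x" := ((s%:C)%C *: x) (at level 40).

Definition sublinear q := (forall x y, q (x + y) <= q x + q y) /\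
  (forall s x, 0 <= s -> q (s *r x) = s * q x).

Lemma sublinear0 q : sublinear q -> q 0 = 0.
Proof. by move=> [_ H]; rewrite -(scale0r 0) -(rmorph0 (real_complex R)) H// mul0r. Qed.

Lemma sublinearN q x : sublinear q -> - q (- x) <= q x.
Proof.
move=> qs; have := proj1 qs x (- x); rewrite subrr sublinear0//.
by rewrite -lerBlDr sub0r.
Qed.

Lemma homogeneous_of_le q : (forall s x, 0 < s -> q (s *r x) <= s * q x) -> q 0 = 0 ->
  forall s x, 0 <= s -> q (s *r x) = s * q x.
Proof.
move=> H q0 s x; rewrite le_eqVlt => /orP[/eqP <-|s0].
  by rewrite rmorph0 scale0r mul0r.
apply/le_anti; rewrite H//= -ler_pdivlMl//.
have si : 0 < s^-1 by rewrite invr_gt0.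
have := H s^-1 (s *r x) si; rewrite scalerA -rmorphM mulVf ?gt_eqF//.
by rewrite scale1r.
Qed.

(* Passing to x |-> inf_(s >= 0) q (x + s v) - s q v keeps sublinearity and makes
   q linear on the real line of v; doing so along a basis gives a dominated
   linear functional. *)
Lemma sublinear_step q v : sublinear q -> exists q', [/\ sublinear q',
  forall x, q' x <= q x & q' (- v) <= - q v].
Proof.
move=> qs; have [qD qZ] := qs.
pose A x := [set q (x + s *r v) - s * q v | s in [set s | 0 <= s]].
have lbA x : lbound (A x) (- q (- x)).
  move=> _ [s /= s0 <-]; rewrite lerBrDr addrC lerBlDr -qZ//.
  by have := qD (x + s *r v) (- x); rewrite [x + _]addrC addrK [s *r v + x]addrC.
have A0 x : A x !=set0 by exists (q (x + 0 *r v) - 0 * q v); exists 0 => //=.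
have hiA x : has_inf (A x) by split; [exact: A0|exists (- q (- x)); exact: lbA].
have infle x s : 0 <= s -> inf (A x) <= q (x + s *r v) - s * q v.
  move=> s0; apply: ge_inf; first by exists (- q (- x)); exact: lbA.
  by exists s.
have le : forall x, inf (A x) <= q x.
  by move=> x; have := infle x 0 (lexx 0); rewrite rmorph0 scale0r addr0 mul0r subr0.
have z0 : inf (A 0) = 0.
  apply/le_anti/andP; split; first by have := le 0; rewrite sublinear0.
  by apply: lb_le_inf => //; have := lbA 0; rewrite oppr0 sublinear0// oppr0.
exists (fun x => inf (A x)); split=> //; last first.
  by have := infle (- v) 1 ler01; rewrite rmorph1 scale1r addNr sublinear0// mul1r sub0r.
split=> [x y|]; last first.
  apply: homogeneous_of_le => // s x s0.
  rewrite -ler_pdivrMl//; apply: lb_le_inf => // _ [t /= t0 <-].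
  rewrite ler_pdivrMl//; have := infle (s *r x) (s * t) (mulr_ge0 (ltW s0) t0).
  rewrite rmorphM -scalerA -scalerDr qZ ?(ltW s0)//.
  by rewrite mulrBr mulrA.
rewrite -lerBlDr; apply: lb_le_inf => // _ [s /= s0 <-].
rewrite lerBlDr -lerBlDl; apply: lb_le_inf => // _ [t /= t0 <-].
rewrite lerBlDl; apply: (le_trans (infle (x + y) (s + t) (addr_ge0 s0 t0))).
by rewrite rmorphD scalerDl [x + y + _]addrACA mulrDl opprD [leRHS]addrACA lerD2r.
Qed.

(** For a sublinear [q] this means that [q] is linear on the real line through [v] ([linealZ]). *)
Definition lineal q v := q (- v) = - q v.

Lemma lineal_le q q' v : sublinear q' -> (forall x, q' x <= q x) ->
  lineal q v -> q' v = q v /\ lineal q' v.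
Proof.
move=> q's le qv; have h := sublinearN v q's.
have h1 := le v; have h2 := le (- v); rewrite qv in h2.
by rewrite /lineal; split; move: h h1 h2;
  move: (q' v) (q v) (q' (- v)) => a b c; clear; lra.
Qed.

(** Directions already treated are not spoilt: a sublinear function below [q] agrees with [q]
    wherever [q] is lineal. *)
Lemma sublinear_lineal (l : seq V) q : sublinear q -> exists q', [/\ sublinear q',
  forall x, q' x <= q x & forall v, v \in l -> lineal q' v].
Proof.
elim: l q => [|v l IH] q qs; first by exists q.
have [q1 [q1s q1q q1v]] := sublinear_step v qs.
have [q2 [q2s q2q q2l]] := IH q1 q1s.
exists q2; split=> // [x|w]; first exact: le_trans (q1q x).
rewrite inE => /orP[/eqP ->|]; last exact: q2l.
have l1 : lineal q1 v.
  have h := sublinearN v q1s; have h1 := q1q v.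
  by rewrite /lineal; move: h h1 q1v; move: (q1 v) (q v) (q1 (- v)) => a b c; clear; lra.
by have [] := lineal_le q2s q2q l1.
Qed.

Lemma linealD q v w : sublinear q -> lineal q v -> lineal q w ->
  q (v + w) = q v + q w /\ lineal q (v + w).
Proof.
move=> qs lv lw; have [qD _] := qs.
have h1 := qD v w; have h2 := qD (- v) (- w); rewrite -opprD lv lw in h2.
have h3 := sublinearN (v + w) qs.
rewrite /lineal; split; move: h1 h2 h3;
  move: (q v) (q w) (q (v + w)) (q (- (v + w))) => a b c d; clear; lra.
Qed.

Lemma linealZ q v s : sublinear q -> lineal q v ->
  q (s *r v) = s * q v /\ lineal q (s *r v).
Proof.
move=> qs lv; have [_ qZ] := qs; have [s0|s0] := leP 0 s.
  by rewrite /lineal -scalerN !qZ// lv mulrN.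
have ns0 : 0 <= - s by rewrite oppr_ge0 ltW.
have E : s *r v = (- s) *r (- v) by rewrite rmorphN scaleNr scalerN opprK.
have E' : - (s *r v) = (- s) *r v by rewrite rmorphN scaleNr.
by rewrite /lineal E' E !qZ// lv !mulrN !mulNr !opprK.
Qed.

Lemma lineal_sum q (I : Type) (r : seq I) (F : I -> V) : sublinear q ->
  (forall i, lineal q (F i)) -> q (\sum_(i <- r) F i) = \sum_(i <- r) q (F i).
Proof.
move=> qs lF.
suff [] : q (\sum_(i <- r) F i) = \sum_(i <- r) q (F i) /\ lineal q (\sum_(i <- r) F i) by [].
elim: r => [|i r [IH1 IH2]]; first by rewrite /lineal !big_nil oppr0 sublinear0// oppr0.
rewrite /lineal !big_cons; have [h1 h2] := linealD qs (lF i) IH2.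
by rewrite h1 IH1; split => //; rewrite h2 h1 IH1.
Qed.

(** The first step is made along [p], which freezes the value there; the others run through the real
    basis formed by [e i] and [ie i]. *)
Lemma dominated_linear q p : sublinear q -> exists G : 'cV[C]_n,
  Re (app G p) = q p /\ forall x, Re (app G x) <= q x.
Proof.
move=> qs; have [q1 [q1s q1q q1p]] := sublinear_step p qs.
pose e (i : 'I_n) : V := delta_mx 0 i; pose ie i : V := 'i%C *: e i.
have [q2 [q2s q2q q2l]] := sublinear_lineal
  ([seq e i | i <- enum 'I_n] ++ [seq ie i | i <- enum 'I_n]) q1s.
have le i : lineal q2 (e i).
  by apply: q2l; rewrite mem_cat map_f ?mem_enum.
have lie i : lineal q2 (ie i).
  by apply: q2l; rewrite mem_cat orbC map_f ?mem_enum.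
(* The complex linear form with real part [q2] is [q2 x - i q2 (i x)]. *)
pose G : 'cV[C]_n := \col_i (q2 (e i) +i* - q2 (ie i))%C.
have GE x : Re (app G x) = q2 x.
  have xE : x = \sum_i (Re (x 0 i) *r e i + Im (x 0 i) *r ie i).
    rewrite [LHS]row_sum_delta; apply: eq_bigr => i _.
    rewrite /ie scalerA -scalerDl; congr (_ *: _).
    by apply: cplx_eq; rewrite ?(ReD, ImD, ReM, ImM) /=; ring.
  rewrite [in RHS]xE lineal_sum// => [|i]; last first.
    by have [_ l1] := linealZ (Re (x 0 i)) q2s (le i);
       have [_ l2] := linealZ (Im (x 0 i)) q2s (lie i);
       have [] := linealD q2s l1 l2.
  rewrite appE (big_morph (@Re R) (@ReD R) erefl).
  apply: eq_bigr => i _; rewrite mxE ReM /=.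
  have [e1 l1] := linealZ (Re (x 0 i)) q2s (le i).
  have [e2 l2] := linealZ (Im (x 0 i)) q2s (lie i).
  have [-> _] := linealD q2s l1 l2; rewrite e1 e2; ring.
exists G; split=> [|x]; last by rewrite GE; exact: le_trans (q1q x).
rewrite GE; have h1 := q1q p; have h2 := q2q p; have h3 := q2q (- p).
have h4 := sublinearN p q2s; move: h1 h2 h3 h4 q1p.
by move: (q p) (q1 p) (q2 p) (q1 (- p)) (q2 (- p)) => a b c d f; clear; lra.
Qed.

(** For the ordinary gauge [g], a dominated form has real part [g p >= 1] at [p] and below 1 on
    Omega, so it omits on Omega its value at [p]; division by that value normalises it. *)
Theorem convex_separation (Omega : set V) p : vopen Omega -> Omega 0 ->
  (forall x y t, Omega x -> Omega y -> 0 <= t <= 1 ->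
     Omega ((1 - t) *r x + t *r y)) ->
  ~ Omega p -> exists G : 'cV[C]_n, app G p = 1 /\ forall x, Omega x -> app G x != 1.
Proof.
move=> Oo O0 Ocv np.
pose A x := [set t : R | 0 < t /\ Omega (t^-1 *r x)].
have [r [r0 rO]] := Oo 0 O0.
have smallO x : vmod x < r -> Omega x by move=> xr; apply: rO; rewrite /vball /= subr0.
have A0 x : A x !=set0.
  have x1 : 0 < vmod x + 1 by rewrite ltr_wpDl// vmod_ge0.
  exists ((vmod x + 1) / r); split; first exact: divr_gt0.
  apply: smallO; rewrite vmodZ cmodR gtr0_norm ?invr_gt0 ?divr_gt0// invf_div.
  by rewrite mulrAC ltr_pdivrMr// ltr_pM2l// ltrDl.
have lbA x : lbound (A x) 0 by move=> t [/ltW].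
pose g x := inf (A x).
have gle x t : 0 < t -> Omega (t^-1 *r x) -> g x <= t.
  by move=> t0 xt; apply: ge_inf; [exists 0; exact: lbA|split].
have g_ge0 x : 0 <= g x by apply: lb_le_inf => //; exact: lbA.
have g0 : g 0 = 0.
  apply/le_anti; rewrite g_ge0 andbT; apply/ler_addgt0Pr => e e0; rewrite add0r.
  by apply: gle => //; rewrite scaler0.
have gs : sublinear g.
  split=> [x y|]; last first.
    apply: homogeneous_of_le => // s x s0.
    rewrite -ler_pdivrMl//; apply: lb_le_inf => // t [t0 xt].
    rewrite ler_pdivrMl//; apply: gle; first exact: mulr_gt0.
    by rewrite scalerA -rmorphM invfM mulrAC mulVf ?mul1r ?gt_eqF.
  rewrite -lerBlDr; apply: lb_le_inf => // t [t0 xt].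
  rewrite lerBlDr -lerBlDl; apply: lb_le_inf => // s [s0 ys].
  rewrite lerBlDl; have ts : 0 < t + s by exact: addr_gt0.
  apply: gle => //.
  have sts : 0 <= s / (t + s) <= 1.
    rewrite divr_ge0 ?(ltW s0) ?(ltW ts)//= ler_pdivrMr// mul1r lerDr ltW//.
  have := Ocv _ _ _ xt ys sts; rewrite !scalerA -!rmorphM.
  congr (Omega _); rewrite scalerDr; congr (_%:C%C *: _ + _%:C%C *: _).
    by field; rewrite !gt_eqF.
  by field; rewrite !gt_eqF.
have gp : 1 <= g p.
  apply: lb_le_inf => // t [t0 pt]; rewrite leNgt; apply/negP => t1; apply: np.
  have tb : 0 <= t <= 1 by rewrite !ltW.
  have := Ocv _ _ _ O0 pt tb; rewrite scaler0 add0r scalerA -rmorphM.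
  by rewrite divff ?gt_eqF// scale1r.
have gO x : Omega x -> g x < 1.
  move=> Ox; have [e [e0 eO]] := Oo x Ox.
  have x1 : 0 < vmod x + 1 by rewrite ltr_wpDl// vmod_ge0.
  (* By openness [(1 + k) x] is still in Omega, which makes the gauge strictly less than 1. *)
  pose k := e / (vmod x + 1); have k0 : 0 < k by exact: divr_gt0.
  have k1 : 0 < 1 + k by exact: addr_gt0.
  apply: (@le_lt_trans _ _ (1 + k)^-1); last by rewrite invf_lt1// ltrDl.
  apply: gle; first by rewrite invr_gt0.
  apply: eO; rewrite invrK rmorphD scalerDl rmorph1 scale1r /vball /= addrAC subrr add0r.
  rewrite vmodZ cmodR gtr0_norm// /k mulrAC ltr_pdivrMr// ltr_pM2l//.
  by rewrite ltrDl.
have [G [Gp Gg]] := dominated_linear p gs.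
have Gp0 : app G p != 0.
  by apply: contraTneq gp => E; rewrite -Gp E /= -ltNge ltr01.
exists ((app G p)^-1 *: G); split=> [|x Ox]; first by rewrite appZl mulVf.
rewrite appZl; apply/eqP => E.
have {}E : app G x = app G p by rewrite -[LHS](mulVKf Gp0) E mulr1.
have := le_lt_trans (Gg x) (gO x Ox); rewrite E Gp.
by rewrite ltNge gp.
Qed.

End HahnBanach.

(** * A holomorphic function from Omega to the unit disc *)

Section Annulus.
Variable R : realType.
Local Notation C := R[i].
Implicit Types (g : C -> C) (z w : C).

(** If [g] were not constant near [w], a suitable [t] would make the leading term [a t^N] of
    [g - g w] a positive multiple of [g w] and so increase [|g|]. *)
Lemma local_maximum g w (r : R) : 0 < r ->
  (forall h, cmod h < r -> cdiff g (w + h)) ->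
  (forall h, cmod h < r -> cmod (g (w + h)) <= cmod (g w)) ->
  exists s : R, 0 < s /\ forall h, cmod h < s -> g (w + h) = g w.
Proof.
move=> r0 gd gM; have [gw0|gw0] := eqVneq (g w) 0.
  exists r; split=> // h /gM; rewrite gw0 cmod0 => h0.
  by apply/eqP; rewrite -cmod_eq0; apply/eqP/le_anti; rewrite h0 cmod_ge0.
(* The function is moved to ['rV[C]_1] to make [hol_order] applicable. *)
pose f (x : 'rV[C]_1) := g (w + x 0 0) - g w.
have xr (x : 'rV[C]_1) (s : R) : vball 0 s x -> cmod (x 0 0) < s.
  by rewrite /vball /= subr0; apply: le_lt_trans; exact: vmod_coord.
have fh : hol f (vball 0 r).
  move=> x /xr x0; apply: sdiffB; last exact: sdiff_cst.
  have [G xG] : sdiff (fun y : 'rV[C]_1 => w + y 0 0) x.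
    by apply: sdiffD; [exact: sdiff_cst|exact: sdiff_coord].
  have [m gm] := gd _ x0.
  by exists (m *: G); exact: (sder_compl xG gm).
case: (pselect (forall s : R, 0 < s -> exists x, vball 0 s x /\ f x != 0)); last first.
  move=> nz; have [s [s0 Hs]] : exists s : R, 0 < s /\ forall x, vball 0 s x -> f x = 0.
    apply: contrapT => H; apply: nz => s s0; apply: contrapT => H'; apply: H.
    exists s; split=> // x xs; apply/eqP; apply: contrapT => /negP fx.
    by apply: H'; exists x.
  exists s; split=> // h hs; apply/eqP; rewrite -subr_eq0; apply/eqP.
  have := Hs (const_mx h); rewrite /f mxE; apply.
  by rewrite /vball /= subr0; apply/vmod_ltP => // i; rewrite mxE.
move=> /(hol_order r0 fh)[v [N [vN0 vN]]]; exfalso.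
have v1 : 0 < vmod v + 1 by rewrite ltr_wpDl// vmod_ge0.
pose phi k t := dir_iter f v k (0 + t *: v).
have ch : deriv_chain phi (r / (vmod v + 1)).
  move=> k z zr; apply: (dir_iter_cder _ _ fh); first exact: vopen_ball.
  rewrite /vball /= add0r subr0 vmodZ.
  apply: (@le_lt_trans _ _ (cmod z * (vmod v + 1))).
    by rewrite ler_wpM2l ?cmod_ge0// lerDl.
  by rewrite -ltr_pdivlMr.
have phi0 k : (k < N)%N -> phi k 0 = 0 by move=> kN; rewrite /phi scale0r addr0 vN0.
have phiN : phi N 0 != 0 by rewrite /phi scale0r addr0.
have N0 : (0 < N)%N.
  by rewrite lt0n; apply: contraNneq vN => ->; rewrite /= /f mxE addr0 subrr.
pose a := phi N 0 * (N`!%:R)^-1.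
have a0 : a != 0.
  by rewrite mulf_neq0// invr_neq0// pnatr_eq0 -lt0n fact_gt0.
have a2 : 0 < cmod a / 2 by rewrite divr_gt0// cmod_gt0.
have r1 : 0 < r / (vmod v + 1) by exact: divr_gt0.
have [d [d0 Hd]] := chain_taylor r1 ch phi0 a2; rewrite -/a in Hd.
(* With [t = s u] one gets [a t^N = s^N g w]. *)
pose u : C := N.-root (g w / a).
have uN : u ^+ N = g w / a by rewrite rootCK.
have u1 : 0 < cmod u + 1 by rewrite ltr_wpDl// cmod_ge0.
have m0 : 0 < Order.min d (r / (vmod v + 1)) by rewrite lt_min d0.
pose s := Order.min d (r / (vmod v + 1)) / (cmod u + 1) / 2.
have s0 : 0 < s by rewrite !divr_gt0.
pose t : C := (s%:C)%C * u.
have tm : cmod t < Order.min d (r / (vmod v + 1)).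
  rewrite /t cmodM cmodR gtr0_norm//; apply: (@le_lt_trans _ _ (s * (cmod u + 1))).
    by rewrite ler_wpM2l ?(ltW s0)// lerDl.
  rewrite /s mulrAC divfK ?gt_eqF//.
  by rewrite ltr_pdivrMr// mulr_natr mulr2n ltrDl.
move: tm; rewrite lt_min => /andP[/Hd h1 tr].
have tv : cmod ((0 + t *: v) 0 0) < r.
  apply: (le_lt_trans (vmod_coord _ _)); rewrite add0r vmodZ.
  apply: (@le_lt_trans _ _ (cmod t * (vmod v + 1))).
    by rewrite ler_wpM2l ?cmod_ge0// lerDl.
  by rewrite -ltr_pdivlMr.
have := gM _ tv; apply/negP; rewrite -ltNge.
have atN : a * t ^+ N = ((s ^+ N)%:C)%C * g w.
  by rewrite /t exprMn uN rmorphXn; field.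
rewrite atN in h1.
have sN : 0 < s ^+ N by rewrite exprn_gt0.
have h2 : cmod a / 2 * cmod t ^+ N = s ^+ N / 2 * cmod (g w).
  have E : cmod a * cmod t ^+ N = s ^+ N * cmod (g w).
    by rewrite -cmodX -cmodM atN cmodM cmodR gtr0_norm.
  by rewrite mulrAC E mulrAC.
rewrite h2 in h1.
have gE : g (w + (0 + t *: v) 0 0) = phi 0%N t + g w.
  by rewrite /phi /dir_iter /= /f subrK.
rewrite gE.
have := cmodD (phi 0%N t + g w) (- (phi 0%N t - ((s ^+ N)%:C)%C * g w)).
have -> : phi 0%N t + g w - (phi 0%N t - ((s ^+ N)%:C)%C * g w) =
    ((1 + s ^+ N)%:C)%C * g w by rewrite rmorphD rmorph1; ring.
rewrite cmodN cmodM cmodR gtr0_norm ?addr_gt0// => h3.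
have g1 : 0 < s ^+ N * cmod (g w) by rewrite mulr_gt0// cmod_gt0.
have h4 := le_trans h3 (lerD (lexx _) h1).
rewrite [s ^+ N / 2 * _]mulrAC mulrDl mul1r in h4.
move: g1 h4; move: (s ^+ N * cmod (g w)) (cmod (g w)) (cmod (phi 0%N t + g w)).
by clear => x1 x2 x3; lra.
Qed.

Lemma closed_cmod (A : set C) :
  (forall z, ~ A z -> exists d : R, 0 < d /\ forall h, cmod h < d -> ~ A (z + h)) ->
  closed A.
Proof.
move=> H; rewrite -openC openE => z /= /H[d [d0 Hd]].
by apply/nbhs_cmodP; exists d.
Qed.

Lemma ccont_cmod_within g (A : set C) : (forall z, A z -> ccont g z) ->
  {within A, continuous (fun z => cmod (g z))}.
Proof.
move=> gc; apply: continuous_in_subspaceT => z; rewrite inE => /gc cz.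
have FF : Filter (nbhs (z : C)) by exact: nbhs_filter.
apply/(@cvgrPdist_le _ _ _ (nbhs (z : C)) FF) => e e0; have [d [d0 Hd]] := cz e e0.
apply/nbhs_cmodP; exists d; split=> // h /Hd; apply: le_trans.
by rewrite distrC cmod_dist.
Qed.

(** Among the points where [|g|] is maximal one of greatest modulus is taken. Were it interior, [g]
    would be constant around it, and a radial step outwards would give another maximum of greater
    modulus. *)
Lemma annulus_maximum g (r B : R) : 1 <= r ->
  (forall z, 1 <= cmod z <= r -> cdiff g z) ->
  (forall z, cmod z = 1 -> cmod (g z) <= B) ->
  (forall z, cmod z = r -> cmod (g z) <= B) ->
  forall z, 1 <= cmod z <= r -> cmod (g z) <= B.
Proof.
move=> r1 gd g1 gr z zK; rewrite leNgt; apply/negP => Bz.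
pose K := [set w : C | 1 <= cmod w <= r].
have sh (w h : C) : `|cmod (w + h) - cmod w| <= cmod h.
  by apply: (le_trans (cmod_dist _ _)); rewrite [w + h]addrC addrK.
have Kc : compact K.
  apply: (@subclosed_compact _ _ (box r)); last 2 first.
  - exact: box_compact.
  - by move=> w /andP[_ wr]; split; apply: le_trans wr; [exact: cmod_Re|exact: cmod_Im].
  apply: closed_cmod => w /negP; rewrite negb_and -!ltNge => /orP[w1|w1].
    exists (1 - cmod w); split; first by rewrite subr_gt0.
    move=> h hd /andP[h1 _]; have := sh w h; rewrite ler_norml => /andP[_].
    by move: h1 hd; move: (cmod (w + h)) (cmod h) (cmod w) => x y t; clear; lra.
  exists (cmod w - r); split; first by rewrite subr_gt0.
  move=> h hd /andP[_ h1]; have := sh w h; rewrite ler_norml => /andP[+ _].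
  by move: h1 hd; move: (cmod (w + h)) (cmod h) (cmod w) => x y t; clear; lra.
have K0 : K !=set0 by exists z.
have gc w : K w -> ccont g w by move=> /gd /cdiff_cont.
have [w0] := compact_EVT_max K0 Kc (ccont_cmod_within gc).
rewrite inE => w0K w0max.
pose T := [set w | K w /\ cmod (g w) = cmod (g w0)].
have Bw0 : B < cmod (g w0) by apply: lt_le_trans Bz _; apply: w0max; rewrite inE.
have Tc : compact T.
  apply: (@subclosed_compact _ _ K) => //; last by move=> w [].
  have Kcl : closed K by apply: compact_closed => //; exact: norm_hausdorff.
  apply: closed_cmod => w nT; case: (pselect (K w)) => Kw; last first.
    have : nbhs w (~` K) by apply: open_nbhs_nbhs; split=> //; exact: closed_openC.
    by move=> /nbhs_cmodP[d [d0 Hd]]; exists d; split=> // h /Hd nK [].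
  have gw : cmod (g w) < cmod (g w0).
    rewrite lt_neqAle w0max ?inE// andbT; apply/eqP => E; exact: nT.
  have e0 : 0 < (cmod (g w0) - cmod (g w)) / 2 by rewrite divr_gt0// subr_gt0.
  have [d [d0 Hd]] := gc w Kw _ e0; exists d; split=> // h /Hd hd [_ E].
  have := cmodD (g w) (g (w + h) - g w); rewrite subrKC E => h1.
  have := le_trans h1 (lerD (lexx _) hd); move: gw.
  by move: (cmod (g w0)) (cmod (g w)) => x y; clear; lra.
have T0 : T !=set0 by exists w0.
have [w1] := compact_EVT_max T0 Tc (ccont_cmod_within (fun w _ => @contc_id R w)).
rewrite inE => -[w1K gw1] w1max.
have [w1a w1b] := andP w1K.
have w1a' : 1 < cmod w1.
  rewrite lt_neqAle w1a andbT; apply/eqP => E.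
  by have := g1 w1 (esym E); rewrite gw1 leNgt Bw0.
have w1b' : cmod w1 < r.
  rewrite lt_neqAle w1b andbT; apply/eqP => E.
  by have := gr w1 E; rewrite gw1 leNgt Bw0.
pose rho := Order.min (cmod w1 - 1) (r - cmod w1).
have rho0 : 0 < rho by rewrite lt_min !subr_gt0 w1a'.
have inK h : cmod h < rho -> K (w1 + h).
  rewrite lt_min => /andP[h1 h2]; have := sh w1 h; rewrite ler_norml => /andP[h3 h4].
  by apply/andP; split; move: h1 h2 h3 h4; move: (cmod (w1 + h)) (cmod h) (cmod w1) => x y t; clear; lra.
have [|h|s [s0 Hs]] := @local_maximum g w1 rho rho0.
- by move=> h /inK/gd.
- by move=> /inK hK; rewrite gw1; apply: w0max; rewrite inE.
have mm : 0 < Order.min rho s by rewrite lt_min rho0.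
pose c := Order.min rho s / 2 / cmod w1.
have w1p : 0 < cmod w1 by exact: lt_trans w1a'.
have c0 : 0 < c by rewrite !divr_gt0.
have cw : cmod ((c%:C)%C * w1) < Order.min rho s.
  rewrite cmodM cmodR gtr0_norm// divfK ?gt_eqF//.
  by rewrite ltr_pdivrMr// mulr_natr mulr2n ltrDl.
move: cw; rewrite lt_min => /andP[cr cs].
have wT : w1 + (c%:C)%C * w1 \in T.
  by rewrite inE; split; [exact: inK|rewrite Hs].
have := w1max _ wT; rewrite leNgt => /negP; apply.
have -> : w1 + (c%:C)%C * w1 = ((1 + c)%:C)%C * w1 by rewrite rmorphD rmorph1; ring.
by rewrite cmodM cmodR gtr0_norm ?addr_gt0// ltr_pMl// ltrDl.
Qed.

End Annulus.

(** * The disc-valued function defined by the roots *)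

Section Extremal.
Variables (R : realType) (n : nat).
Local Notation C := R[i].
Variables (d : 'I_n -> nat) (L : nat) (G : 'cV[C]_n).
Hypotheses (L0 : (0 < L)%N) (d0 : forall i, (0 < d i)%N) (dL : forall i, (d i <= L)%N).
Implicit Types (x z : 'rV[C]_n) (w s : C) (rs : seq C).

Local Notation scale := (weighted_scale d).

(** By [root_poly_horner], its nonzero roots are the inverses of the [w] with
    [app G (scale w x) = 1]. *)
Definition root_poly x : {poly C} :=
  'X^L - \sum_i (G i 0 * x 0 i) *: 'X^(L - d i).

(** The derivative of [app G (scale w x)] with respect to [w] at 1. *)
Definition num_fun x : C := \sum_i (d i)%:R * (G i 0 * x 0 i).

Definition den_fun x : C := L%:R - \sum_i (L - d i)%:R * (G i 0 * x 0 i).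

(* With Q = root_poly x, this is 1 - L Q(1) / Q'(1). *)
Definition disc_fun x : C := num_fun x / den_fun x.

Lemma app_scale w x : app G (scale w x) = \sum_i w ^+ d i * (G i 0 * x 0 i).
Proof. by rewrite appE; apply: eq_bigr => i _; rewrite mxE; ring. Qed.

Lemma root_poly_factor x : exists rs,
  size rs = L /\ root_poly x = \prod_(m <- rs) ('X - m%:P).
Proof.
have sz : size (root_poly x) = L.+1.
  rewrite size_polyDl size_polyXn// size_polyN ltnS.
  apply: (leq_trans (size_sum _ _ _)); apply/bigmax_leqP => i _.
  apply: (leq_trans (size_scale_leq _ _)); rewrite size_polyXn.
  by rewrite ltn_subrL d0 L0.
have lc : lead_coef (root_poly x) = 1.
  rewrite lead_coefE sz /= coefB coefXn eqxx coef_sum big1 ?subr0// => i _.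
  by rewrite coefZ coefXn gtn_eqF ?mulr0// ltn_subrL d0 L0.
have [rs E] := closed_field_poly_normal (root_poly x).
rewrite lc scale1r in E; exists rs; split=> //.
by move: sz; rewrite E size_prod_XsubC => -[].
Qed.

Lemma root_poly_horner x w : w != 0 ->
  (root_poly x).[w^-1] * w ^+ L = 1 - app G (scale w x).
Proof.
move=> w0; rewrite app_scale hornerD hornerN hornerXn horner_sum mulrBl -exprMn mulVf// expr1n.
congr (_ - _); rewrite mulr_suml; apply: eq_bigr => i _.
rewrite hornerZ hornerXn -{2}(subnK (dL i)) exprD exprVn.
by field; rewrite expf_neq0.
Qed.

Lemma root_poly_deriv x w : w != 0 ->
  (root_poly x)^`().[w^-1] * w ^+ L.-1 = den_fun (scale w x).
Proof.
move=> w0; rewrite /den_fun derivB derivXn hornerD hornerN hornerMn hornerXn.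
rewrite raddf_sum horner_sum mulrBl mulrnAl -exprMn mulVf// expr1n.
congr (_ - _); rewrite mulr_suml; apply: eq_bigr => i _.
rewrite /= derivZ derivXn hornerZ hornerMn hornerXn mxE.
case E : (L - d i)%N => [|k]; first by rewrite mulr0n mulr0 !mul0r.
have -> : L.-1 = (k + d i)%N.
  by rewrite -[in LHS](subnK (dL i)) E addSn.
by rewrite /= -mulr_natl exprD exprVn; field; rewrite expf_neq0.
Qed.

Lemma deriv_prod_XsubC rs s : (forall m, m \in rs -> s - m != 0) ->
  (\prod_(m <- rs) ('X - m%:P))^`().[s] =
  (\prod_(m <- rs) ('X - m%:P)).[s] * \sum_(m <- rs) (s - m)^-1.
Proof.
elim: rs => [|m rs IH] H; first by rewrite !big_nil derivC horner0 mulr0.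
have sm : s - m != 0 by apply: H; rewrite mem_head.
rewrite !big_cons derivM derivXsubC mul1r hornerD !hornerM hornerXsubC.
rewrite IH => [|k ks]; last by apply: H; rewrite inE ks orbT.
by field.
Qed.

Lemma sum_inv_scale rs w : w != 0 ->
  \sum_(m <- rs) (w^-1 - m)^-1 = w * \sum_(m <- rs) (1 - w * m)^-1.
Proof.
move=> w0; rewrite mulr_sumr; apply: eq_bigr => m _.
by rewrite -(mulKf w0 (w^-1 - m)) mulrBr mulfV// invfM invrK.
Qed.

Lemma den_funE x rs w : root_poly x = \prod_(m <- rs) ('X - m%:P) -> w != 0 ->
  (forall m, m \in rs -> 1 - w * m != 0) ->
  den_fun (scale w x) = (1 - app G (scale w x)) * \sum_(m <- rs) (1 - w * m)^-1.
Proof.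
move=> E w0 H; rewrite -root_poly_deriv// -root_poly_horner// E.
rewrite deriv_prod_XsubC => [|m mrs]; last first.
  apply: contra (H m mrs) => /eqP e.
  by rewrite -[1](mulfV w0) -mulrBr e mulr0.
by rewrite sum_inv_scale// -[in RHS](prednK L0) exprS; ring.
Qed.

Lemma num_funE x : num_fun x = den_fun x - L%:R * (1 - app G x).
Proof.
have -> : num_fun x = L%:R * app G x - \sum_i (L - d i)%:R * (G i 0 * x 0 i).
  rewrite /num_fun appE mulr_sumr -sumrB; apply: eq_bigr => i _.
  by rewrite natrB//; ring.
by rewrite /den_fun; ring.
Qed.

(** [disc_fun] along [w -> scale w x] in terms of the roots [rs] for [x]. Written so, it stays
    holomorphic with values in the unit disc while all [|w m| < 1], even if [scale w x] has left
    Omega. *)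
Definition ray_fun rs w : C := 1 - L%:R * (\sum_(m <- rs) (1 - w * m)^-1)^-1.

Lemma disc_funE x rs w : root_poly x = \prod_(m <- rs) ('X - m%:P) -> w != 0 ->
  (forall m, m \in rs -> 1 - w * m != 0) -> app G (scale w x) != 1 ->
  \sum_(m <- rs) (1 - w * m)^-1 != 0 ->
  den_fun (scale w x) != 0 /\ disc_fun (scale w x) = ray_fun rs w.
Proof.
move=> E w0 H a1 S0.
have P0 : 1 - app G (scale w x) != 0 by rewrite subr_eq0 eq_sym.
have D := den_funE E w0 H.
have D0 : den_fun (scale w x) != 0 by rewrite D mulf_neq0.
split=> //; rewrite /disc_fun num_funE /ray_fun mulrBl mulfV//; congr (_ - _).
by rewrite D; field; rewrite S0 P0.
Qed.

Lemma Re_inv_gt (u : C) : cmod u < 1 -> 1 / 2 < Re (1 - u)^-1.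
Proof.
move=> u1; have u2 : cmod u ^+ 2 < 1 by rewrite expr_lt1// cmod_ge0.
rewrite cmod_sqr in u2.
have E : Re (1 - u)^-1 = (1 - Re u) /
    ((1 - Re u) ^+ 2 + Im u ^+ 2).
  by case: u {u1 u2} => a b /=; rewrite sub0r sqrrN.
have p : 0 < (1 - Re u) ^+ 2 + Im u ^+ 2.
  rewrite -[X in _ + X]sqrrN -(_ : Re (1 - u) = 1 - Re u); last first.
    by rewrite ReD ReN.
  rewrite -(_ : Im (1 - u) = - Im u); last by rewrite ImD ImN add0r.
  rewrite -cmod_sqr exprn_gt0// cmod_gt0 subr_eq0.
  by apply: contraTneq u1 => <-; rewrite cmod1 ltxx.
rewrite E ltr_pdivlMr//; move: u2; move: (Re u) (Im u) => a b.
rewrite sqrrB; move: (a ^+ 2) (b ^+ 2) => a2 b2; lra.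
Qed.

Lemma Re_sum_inv_gt rs w : (0 < size rs)%N -> (forall m, m \in rs -> cmod (w * m) < 1) ->
  (size rs)%:R / 2 < Re (\sum_(m <- rs) (1 - w * m)^-1).
Proof.
case: rs => // m rs _; elim: rs m => [|k rs IH] m H.
  by rewrite big_seq1; apply: Re_inv_gt; apply: H; rewrite mem_head.
rewrite big_cons ReD /= -natr1 addrC mulrDl ltrD//.
  by apply: Re_inv_gt; apply: H; rewrite mem_head.
by apply: IH => j jrs; apply: H; rewrite inE jrs orbT.
Qed.

(** The condition says that [A] is nearer to [l] than to 0. *)
Lemma cmod_one_sub_lt1 (A : C) (l : R) : 0 < l -> l / 2 < Re A ->
  cmod (1 - (l%:C)%C * A^-1) < 1.
Proof.
move=> l0 lA; have A0 : A != 0.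
  by apply: contraTneq lA => -> /=; rewrite -leNgt divr_ge0// ltW.
have -> : 1 - (l%:C)%C * A^-1 = (A - (l%:C)%C) / A by field.
rewrite cmodM cmodV ltr_pdivrMr ?cmod_gt0// mul1r.
rewrite -(@ltr_pXn2r _ 2)// ?nnegrE ?cmod_ge0// !cmod_sqr ReD ImD ReN ImN /= subr0.
rewrite ltrD2r sqrrB; move: lA l0; move: (Re A) => a lA l0.
rewrite -subr_gt0 (_ : _ - _ = 2 * l * (a - l / 2)); last by field.
by rewrite !mulr_gt0// subr_gt0.
Qed.

Lemma cplx_natr k : (k%:R : C) = ((k%:R : R)%:C)%C.
Proof. by rewrite rmorph_nat. Qed.

Lemma ray_fun_lt1 rs w : size rs = L -> (forall m, m \in rs -> cmod (w * m) < 1) ->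
  cmod (ray_fun rs w) < 1.
Proof.
move=> sL H; rewrite /ray_fun cplx_natr; apply: cmod_one_sub_lt1; first by rewrite ltr0n.
by rewrite -sL; apply: Re_sum_inv_gt => //; rewrite sL.
Qed.

Lemma sum_inv_neq0 rs w : size rs = L -> (forall m, m \in rs -> cmod (w * m) < 1) ->
  \sum_(m <- rs) (1 - w * m)^-1 != 0.
Proof.
move=> sL H; have := @Re_sum_inv_gt rs w; rewrite sL => /(_ L0 H).
by apply: contraTneq => -> /=; rewrite -leNgt divr_ge0.
Qed.

Lemma one_sub_neq0 w (m : C) : cmod (w * m) < 1 -> 1 - w * m != 0.
Proof.
by move=> H; rewrite subr_eq0; apply: contraTneq H => <-; rewrite cmod1 ltxx.
Qed.

Lemma cdiff_ray_fun rs w : size rs = L -> (forall m, m \in rs -> cmod (w * m) < 1) ->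
  cdiff (ray_fun rs) w.
Proof.
move=> sL H; apply: cdiffB; first exact: cdiff_cst.
apply: cdiffM; first exact: cdiff_cst.
apply: cdiffV; first exact: sum_inv_neq0.
elim: rs {sL} H => [|m rs IH] H.
  rewrite (_ : (fun w => _) = fun=> 0); first exact: cdiff_cst.
  by apply/funext => t; rewrite big_nil.
rewrite (_ : (fun w => _) = fun w => (1 - w * m)^-1 + \sum_(m <- rs) (1 - w * m)^-1).
  apply: cdiffD.
    apply: cdiffV; first by apply: one_sub_neq0; apply: H; rewrite mem_head.
    apply: cdiffB; first exact: cdiff_cst.
    by apply: cdiffM; [exact: cdiff_id|exact: cdiff_cst].
  by apply: IH => k krs; apply: H; rewrite inE krs orbT.
by apply/funext => t; rewrite big_cons.
Qed.

(** This and [bernoulli_upper] take the place of logarithms in comparing slopes at [x = 0]. *)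
Lemma bernoulli_lower (x : R) k : 0 <= x <= 1 -> 1 - k%:R * x <= (1 - x) ^+ k.
Proof.
move=> /andP[x0 x1]; elim: k => [|k IH]; first by rewrite mul0r subr0 expr0.
rewrite exprS -natr1.
have x1' : 0 <= 1 - x by rewrite subr_ge0.
apply: le_trans (ler_wpM2l x1' IH).
rewrite -subr_ge0 (_ : _ - _ = k%:R * x ^+ 2); last by ring.
by rewrite mulr_ge0// sqr_ge0.
Qed.

Lemma bernoulli_upper (x : R) k : 0 <= x <= 1 -> (1 - x) ^+ k * (1 + k%:R * x) <= 1.
Proof.
move=> /andP[x0 x1]; elim: k => [|k IH]; first by rewrite mul0r addr0 mulr1 expr0.
have x1' : 0 <= 1 - x by rewrite subr_ge0.
apply: le_trans IH; rewrite exprSr -mulrA ler_wpM2l ?exprn_ge0// -natr1.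
rewrite -subr_ge0 (_ : _ - _ = (k%:R + 1) * x ^+ 2); last by ring.
by rewrite mulr_ge0 ?addr_ge0// sqr_ge0.
Qed.

Lemma pow_small (x y : R) : 0 <= x < 1 -> 0 < y -> exists b, x ^+ b <= y.
Proof.
move=> /andP[x0 x1] y0; apply: contrapT => H; move: x1; apply/negP; rewrite -leNgt.
apply: (@power_bound _ _ _ y^-1) => // N; rewrite expr1n ler_pdivlMl// mulr1.
by rewrite leNgt; apply/negP => xN; apply: H; exists N; exact: ltW.
Qed.

Lemma seq_cmod_max rs : rs != [::] -> exists m0, m0 \in rs /\
  forall m, m \in rs -> cmod m <= cmod m0.
Proof.
elim: rs => // k rs IH _; case: (eqVneq rs [::]) => [->|/IH[m0 [m0rs H]]].
  by exists k; rewrite inE eqxx; split=> // m; rewrite inE => /eqP ->.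
have [km|mk] := leP (cmod k) (cmod m0).
  exists m0; rewrite inE m0rs orbT; split=> // m; rewrite inE => /orP[/eqP ->//|].
  exact: H.
exists k; rewrite inE eqxx; split=> // m; rewrite inE => /orP[/eqP ->//|/H].
by move=> /le_trans; apply; exact: ltW.
Qed.

Lemma Re_sum_ge rs (F : C -> C) m0 : m0 \in rs ->
  (forall m, m \in rs -> 0 <= Re (F m)) ->
  Re (F m0) <= Re (\sum_(m <- rs) F m).
Proof.
move=> m0rs H; rewrite (big_rem m0)//= ReD lerDl.
rewrite (big_morph (@Re R) (@ReD R) erefl) big_seq_cond.
by apply: sumr_ge0 => m /andP[/mem_rem /H].
Qed.

(** The term of [m0] equals [1 / h] and the others have positive real part, so the sum has modulus
    at least [1 / h]. *)
Lemma ray_fun_ge rs m0 w (h : R) : m0 \in rs -> 0 < h < 1 ->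
  (forall m, m \in rs -> cmod (w * m) < 1) -> w * m0 = ((1 - h)%:C)%C ->
  1 - L%:R * h <= cmod (ray_fun rs w).
Proof.
move=> m0rs /andP[h0 h1] H wm.
set A := \sum_(m <- rs) (1 - w * m)^-1.
have Ah : h^-1 <= cmod A.
  apply: le_trans (le_trans (ler_norm _) (cmod_Re A)).
  have <- : Re (1 - w * m0)^-1 = h^-1.
    by rewrite wm rmorphB rmorph1 subKr -fmorphV.
  apply: (@Re_sum_ge rs (fun m => (1 - w * m)^-1)) => // m /H mH.
  by apply: ltW; apply: lt_trans (Re_inv_gt mH); rewrite divr_gt0.
rewrite /ray_fun -/A.
have := cmodB_ge 1 (L%:R * A^-1); apply: le_trans.
rewrite cmod1 lerD2l lerN2 cmodM cmod_nat ler_wpM2l// cmodV.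
have A0 : 0 < cmod A by apply: lt_le_trans Ah; rewrite invr_gt0.
by rewrite invf_ple.
Qed.

Section Domain.
Variable Omega : set 'rV[C]_n.
Hypotheses (balO : forall z, Omega z -> forall l : C, cmod l <= 1 -> Omega (scale l z))
  (GO : forall x, Omega x -> app G x != 1).

Lemma scale1 x : scale 1 x = x.
Proof. by apply/rowP => i; rewrite mxE expr1n mul1r. Qed.

Lemma scaleA s w x : scale s (scale w x) = scale (s * w) x.
Proof. by apply/rowP => i; rewrite !mxE exprMn mulrA. Qed.

(** The inverse of a root of modulus at least 1 would scale [x] to a point of Omega on the omitted
    hyperplane. *)
Lemma roots_lt1 x rs m : Omega x -> root_poly x = \prod_(m <- rs) ('X - m%:P) ->
  m \in rs -> cmod m < 1.
Proof.
move=> Ox E mrs; rewrite ltNge; apply/negP => m1.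
have m0 : m != 0 by rewrite -cmod_gt0 (lt_le_trans ltr01).
have mv : m^-1 != 0 by rewrite invr_eq0.
have := root_poly_horner x mv; rewrite invrK.
have /rootP -> : root (root_poly x) m by rewrite E root_prod_XsubC.
rewrite mul0r => /esym/eqP; rewrite subr_eq0 eq_sym; apply/negP/GO/balO => //.
by rewrite cmodV invf_le1// cmod_gt0.
Qed.

Lemma disc_fun_unit x rs w : Omega x -> size rs = L ->
  root_poly x = \prod_(m <- rs) ('X - m%:P) -> cmod w = 1 ->
  den_fun (scale w x) != 0 /\ disc_fun (scale w x) = ray_fun rs w.
Proof.
move=> Ox sL E w1.
have w0 : w != 0 by rewrite -cmod_gt0 w1.
have H m : m \in rs -> cmod (w * m) < 1.
  by move=> mrs; rewrite cmodM w1 mul1r; exact: roots_lt1 Ox E mrs.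
apply: disc_funE => // [m /H||]; first exact: one_sub_neq0.
- by apply/GO/balO; rewrite ?w1.
- exact: sum_inv_neq0.
Qed.

Lemma disc_fun_domain x : Omega x -> den_fun x != 0 /\ cmod (disc_fun x) < 1.
Proof.
move=> Ox; have [rs [sL E]] := root_poly_factor x.
have [] := disc_fun_unit Ox sL E (@cmod1 R); rewrite scale1 => h ->; split=> //.
by apply: ray_fun_lt1 => // m mrs; rewrite mul1r; exact: roots_lt1 Ox E mrs.
Qed.

Lemma sdiff_disc_fun x : Omega x -> sdiff disc_fun x.
Proof.
move=> /disc_fun_domain[D0 _]; apply: sdiffM.
  apply: sdiff_sum => i _; apply: sdiffZ; apply: sdiffZ; exact: sdiff_coord.
apply: sdiffV => //; apply: sdiffB; first exact: sdiff_cst.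
apply: sdiff_sum => i _; apply: sdiffZ; apply: sdiffZ; exact: sdiff_coord.
Qed.

Lemma disc_fun0 : disc_fun 0 = 0.
Proof.
rewrite /disc_fun /num_fun big1 ?mul0r// => i _.
by rewrite mxE mulr0 mulr0.
Qed.

(* On the rays ending at a root of maximal modulus, [ray_fun] tends to 1 with
   slope at most L in log |w|.  If it were at most m < r^L on the unit circle,
   the maximum principle for [ray_fun ^ b / w ^ a] (a three-circle argument) would
   force a slope a / b > L there. *)
Lemma disc_fun_large z (rho m : R) : Omega z -> 0 < rho -> 0 < m -> m < rho ^+ L ->
  app G (scale ((rho^-1)%:C)%C z) = 1 ->
  exists w, cmod w = 1 /\ m < cmod (disc_fun (scale w z)).
Proof.
move=> Oz rho0 mp mrho Gz; apply: contrapT => H.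
have {}H w : cmod w = 1 -> cmod (disc_fun (scale w z)) <= m.
  by move=> w1; rewrite leNgt; apply/negP => wm; apply: H; exists w.
have [rs [sL E]] := root_poly_factor z.
have rho_root : (rho%:C)%C \in rs.
  rewrite -root_prod_XsubC -E; apply/rootP.
  have r0 : (((rho^-1)%:C)%C : C) != 0 by rewrite -cmod_gt0 cmodR normr_gt0 invr_neq0// gt_eqF.
  have := root_poly_horner z r0; rewrite Gz subrr -fmorphV invrK => /eqP.
  by rewrite mulf_eq0 (negbTE (expf_neq0 _ r0)) orbF => /eqP.
have rs0 : rs != [::] by apply: contraTneq rho_root => ->.
have [m0 [m0rs m0max]] := seq_cmod_max rs0.
have m01 : cmod m0 < 1 by exact: roots_lt1 Oz E m0rs.
have rhom : rho <= cmod m0 by have := m0max _ rho_root; rewrite cmodR gtr0_norm.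
have m0p : 0 < cmod m0 by exact: lt_le_trans rhom.
have m0n : m0 != 0 by rewrite -cmod_gt0.
set r := cmod m0 in m01 rhom m0p m0max.
have mr : m < r ^+ L.
  by apply: (lt_le_trans mrho); rewrite lerXn2r ?nnegrE// ltW.
have rL : 0 < r ^+ L by rewrite exprn_gt0.
have mrb : 0 <= m / r ^+ L < 1 by rewrite divr_ge0 ?ltW//= ltr_pdivrMr// mul1r.
(* [b] is so large that the gap between [m] and [r ^ L] pays for one more factor [r]; hence
   [m ^ b <= r ^ a] with [a = L b + 1]. *)
have [b mb] := pow_small mrb m0p.
pose a := (L * b).+1.
have mba : m ^+ b <= r ^+ a.
  move: mb; rewrite expr_div_n ler_pdivrMr ?exprn_gt0// -exprM => /le_trans; apply.
  by rewrite /a exprS.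
have inr w : cmod w < r^-1 -> forall k, k \in rs -> cmod (w * k) < 1.
  move=> wr k /m0max kr; rewrite cmodM; apply: (@le_lt_trans _ _ (cmod w * r)).
    by rewrite ler_wpM2l ?cmod_ge0.
  by rewrite -ltr_pdivlMr// mul1r.
(* On the circle of radius [1 / r] some [1 - w m0] vanishes, so the annulus ends at radius [s / r]
   and [s] tends to 1 afterwards. *)
have key (h s : R) : 0 < h -> h <= 1 - r -> L%:R * h <= 1 -> 1 - h < s < 1 ->
    s ^+ a * (1 - L%:R * h) ^+ b <= (1 - h) ^+ a.
  move=> h0 hr Lh /andP[hs s1].
  have rh : r <= 1 - h by rewrite lerBrDr addrC -lerBrDr.
  have t0 : 0 < 1 - h by exact: lt_le_trans rh.
  have s0 : 0 < s by exact: lt_trans hs.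
  have h1 : h < 1 by rewrite -subr_gt0.
  have R1 : 1 <= s / r by rewrite ler_pdivlMr// mul1r ltW// (le_lt_trans rh).
  have R2 : s / r < r^-1 by rewrite -[ltRHS]mul1r ltr_pM2r ?invr_gt0.
  pose g w := ray_fun rs w ^+ b * (w ^+ a)^-1.
  pose w : C := ((1 - h)%:C)%C / m0.
  have wE : cmod w = (1 - h) / r by rewrite cmodM cmodV cmodR gtr0_norm.
  have wK : 1 <= cmod w <= s / r.
    rewrite wE ler_pdivlMr// mul1r rh /= ler_wpM2r ?invr_ge0 ?ltW//.
  have gw : cmod (g w) <= ((s / r) ^+ a)^-1.
    apply: (annulus_maximum R1) wK => u.
    - move=> /andP[u1 us].
      have u0 : u != 0 by rewrite -cmod_gt0 (lt_le_trans ltr01).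
      apply: cdiffM; last first.
        by apply: cdiffV; [exact: expf_neq0|apply: cdiffX; exact: cdiff_id].
      by apply: cdiffX; apply: cdiff_ray_fun => // k; apply: inr; exact: le_lt_trans R2.
    - move=> u1; rewrite /g cmodM cmodV !cmodX u1 expr1n invr1 mulr1.
      have [_ e1] := disc_fun_unit Oz sL E u1; rewrite -e1.
      apply: (@le_trans _ _ (m ^+ b)).
        by apply: lerXn2r; rewrite ?nnegrE ?cmod_ge0 ?(ltW mp)//; exact: H.
      apply: (le_trans mba); rewrite -exprVn invf_div lerXn2r ?nnegrE ?divr_ge0 ?ltW//.
      by rewrite ltr_pdivlMr// gtr_pMr.
    - move=> us; rewrite /g cmodM cmodV !cmodX us ler_piMl//.
        by rewrite invr_ge0 exprn_ge0// divr_ge0 ?ltW.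
      rewrite exprn_ile1 ?cmod_ge0// ltW//; apply: ray_fun_lt1 => // k; apply: inr.
      by rewrite us.
  have hb : 0 < h < 1 by rewrite h0 h1.
  have wm : w * m0 = ((1 - h)%:C)%C by rewrite /w divfK.
  have wr : cmod w < r^-1 by have /andP[_] := wK; move=> /le_lt_trans; apply.
  have low := ray_fun_ge m0rs hb (inr w wr) wm.
  move: gw; rewrite /g cmodM cmodV !cmodX wE => gw.
  have {}low : (1 - L%:R * h) ^+ b <= cmod (ray_fun rs w) ^+ b.
    by rewrite lerXn2r ?nnegrE ?cmod_ge0 ?subr_ge0.
  have sr0 : 0 < (s / r) ^+ a by rewrite exprn_gt0// divr_gt0.
  have tr0 : 0 < ((1 - h) / r) ^+ a by rewrite exprn_gt0// divr_gt0.
  move: gw; rewrite ler_pdivrMr// => /(le_trans low).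
  rewrite ler_pdivlMl// !expr_div_n => h2.
  rewrite -(ler_pM2r (_ : 0 < (r ^+ a)^-1)) ?invr_gt0 ?exprn_gt0//.
  by rewrite mulrAC.
(* Bernoulli on both sides of [(1 - L h)^b <= (1 - h)^a] gives [(1 - b L h)(1 + a h) <= 1], that is
   [h (1 - Q h) <= 0] because [a - L b = 1]; a small [h] refutes it. *)
pose Q : R := L%:R * b%:R * a%:R.
have Q0 : 0 <= Q by rewrite !mulr_ge0.
pose h := Order.min (1 - r) (Order.min L%:R^-1 (2 * (Q + 1))^-1).
have L0' : 0 < (L%:R : R) by rewrite ltr0n.
have Q1 : 0 < 2 * (Q + 1) by rewrite mulr_gt0// ltr_wpDl.
have h0 : 0 < h by rewrite !lt_min subr_gt0 m01 !invr_gt0 L0' Q1.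
have hr : h <= 1 - r by rewrite ge_min lexx.
have hL : L%:R * h <= 1.
  by rewrite -ler_pdivlMl// mulr1 !ge_min lexx orbT.
have hQ : Q * h < 1.
  apply: (@le_lt_trans _ _ (Q * (2 * (Q + 1))^-1)).
    by rewrite ler_wpM2l// !ge_min lexx !orbT.
  by rewrite ltr_pdivrMr// mul1r mulr_natl mulr2n ltr_wpDr ?addr_ge0// ltrDl.
have h1 : h < 1 by apply: (le_lt_trans hr); rewrite ltrBlDr ltrDl.
have hb : 0 <= h <= 1 by rewrite !ltW.
have Lhb : 0 <= L%:R * h <= 1 by rewrite hL mulr_ge0 ?ltW.
have X1 : (1 - L%:R * h) ^+ b <= 1.
  by rewrite exprn_ile1 ?subr_ge0// lerBlDr lerDl mulr_ge0// ltW.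
have final : (1 - L%:R * h) ^+ b <= (1 - h) ^+ a.
  apply/ler_addgt0Pr => e e0.
  have a1 : 0 < (a%:R : R) by rewrite ltr0n.
  pose k := Order.min (h / 2) (e / a%:R).
  have k0 : 0 < k by rewrite lt_min !divr_gt0.
  have kh : k < h.
    apply: (@le_lt_trans _ _ (h / 2)); first by rewrite ge_min lexx.
    by rewrite ltr_pdivrMr// mulr_natr mulr2n ltrDl.
  have ke : a%:R * k <= e by rewrite mulrC -ler_pdivlMr// ge_min lexx orbT.
  have kb : 0 <= k <= 1 by rewrite ltW//= ltW// (lt_trans kh).
  have := @key h (1 - k) h0 hr hL.
  rewrite ltrD2l ltrN2 kh ltrBlDr ltrDl k0 => /(_ isT) h2.
  have X0 : 0 <= (1 - L%:R * h) ^+ b by rewrite exprn_ge0// subr_ge0.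
  have h3 := ler_wpM2r X0 (bernoulli_lower a kb).
  have h4 := le_trans h3 h2; rewrite mulrBl mul1r lerBlDr in h4.
  apply: (le_trans h4); rewrite lerD2l; apply: le_trans ke.
  by rewrite ler_piMr// mulr_ge0// ltW.
have h5 := le_trans (bernoulli_lower b Lhb) final.
have ah0 : 0 <= 1 + a%:R * h by rewrite addr_ge0// mulr_ge0// ltW.
have h6 := le_trans (ler_wpM2r ah0 h5) (bernoulli_upper a hb).
have aE : (a%:R : R) = L%:R * b%:R + 1 by rewrite /a -natr1 natrM.
have : h * (1 - Q * h) <= 0.
  have -> : h * (1 - Q * h) = (1 - b%:R * (L%:R * h)) * (1 + a%:R * h) - 1.
    by rewrite /Q aE; ring.
  by rewrite subr_le0.
by rewrite pmulr_rle0// leNgt subr_gt0 hQ.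
Qed.

End Domain.

End Extremal.

(** * Comparison of the two invariants *)

Section Tanh.
Variable R : realType.
Implicit Types x y : R.

Lemma expR_artanh x : 0 <= x < 1 -> expR (artanh x *+ 2) = (1 + x) / (1 - x).
Proof.
move=> /andP[x0 x1]; rewrite -mulr_natr divfK ?lnK// posrE divr_gt0 ?subr_gt0//.
by rewrite ltr_wpDr.
Qed.

Lemma tanhK x : 0 <= x < 1 -> tanh (artanh x) = x.
Proof.
move=> x01; have := expR_artanh x01; move: x01 => /andP[x0 x1].
rewrite mulr2n expRD /tanh expRN; have := expR_gt0 (artanh x).
move: (expR _) => E E0 EE.
have -> : (E - E^-1) / (E + E^-1) = (E * E - 1) / (E * E + 1).
  field; rewrite (gt_eqF E0) andbT.
  by rewrite gt_eqF// addr_gt0 ?mulr_gt0.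
rewrite EE; have X0 : 1 - x != 0 by rewrite gt_eqF ?subr_gt0.
field; rewrite X0 /=.
suff -> : 1 + x + (1 - x) = 2 by rewrite pnatr_eq0.
by ring.
Qed.

Lemma artanh_lt x y : 0 <= x < 1 -> 0 <= y < 1 -> artanh x < artanh y -> x < y.
Proof.
move=> x01 y01 h.
have : expR (artanh x *+ 2) < expR (artanh y *+ 2) by rewrite ltr_expR ltrMn2r.
rewrite !expR_artanh//.
move: x01 y01 => /andP[_ x1] /andP[_ y1].
rewrite ltr_pdivrMr ?subr_gt0// mulrAC ltr_pdivlMr ?subr_gt0//.
by move: x1 y1; clear; lra.
Qed.

Lemma artanh_gt0 x : 0 < x < 1 -> 0 < artanh x.
Proof.
move=> /andP[x0 x1]; rewrite /artanh divr_gt0// ln_gt0// ltr_pdivlMr ?subr_gt0//.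
by move: x0; clear; lra.
Qed.

Lemma tanh_ge0 x : 0 < x -> 0 <= tanh x.
Proof.
move=> x0; apply: divr_ge0; last by rewrite addr_ge0 ?expR_ge0.
rewrite subr_ge0 ler_expR.
by apply/ltW; rewrite (lt_trans _ x0)// oppr_lt0.
Qed.

Lemma tanh_le1 x : tanh x <= 1.
Proof.
rewrite ler_pdivrMr ?addr_gt0 ?expR_gt0// mul1r lerD2l -subr_ge0 opprK.
by rewrite addr_ge0 ?expR_ge0.
Qed.

Lemma poincare0 (t : R[i]) : poincare 0 t = artanh (cmod t).
Proof. by rewrite /poincare mulr0 subr0 divr1 sub0r normrN norm_cmod. Qed.

(** The supremum in [squeezing] may not be attained, so the final bound is obtained below it;
    Bernoulli at [s (1 - h)] carries it to [s]. *)
Lemma exprn_le_lim s y L : (0 < L)%N -> 0 <= s -> 0 <= y ->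
  (forall x, 0 < x < s -> x ^+ L <= y) -> s ^+ L <= y.
Proof.
move=> L0; rewrite le_eqVlt => /predU1P[<-|s0] y0 H; first by rewrite expr0n gtn_eqF.
apply/ler_addgt0Pr => e e0.
have L1 : 0 < (L%:R : R) by rewrite ltr0n.
have sL : 0 < s ^+ L by rewrite exprn_gt0.
have [h [h0 h1 hL]] : exists h, [/\ 0 < h, h < 1 & s ^+ L * (L%:R * h) <= e].
  exists (Order.min 2^-1 (e / (s ^+ L * L%:R))); split.
  - by rewrite lt_min invr_gt0 ltr0n divr_gt0 ?mulr_gt0.
  - by rewrite gt_min invf_lt1 ?ltr0n ?ltr1n.
  - by rewrite mulrA mulrC -ler_pdivlMr ?mulr_gt0// ge_min lexx orbT.
have hs : 0 < s * (1 - h) < s.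
  by rewrite mulr_gt0 ?subr_gt0//= gtr_pMr// ltrBlDr ltrDl.
have := H _ hs; rewrite exprMn => /(le_trans _) h2.
have hb : 0 <= h <= 1 by rewrite !ltW.
have := h2 _ (ler_wpM2l (ltW sL) (bernoulli_lower L hb)).
by rewrite mulrBr mulr1 lerBlDr => /le_trans; apply; rewrite lerD2l.
Qed.

End Tanh.

(** * Comparison of the two invariants *)

Section Fridman.
Variables (R : realType) (n : nat).
Local Notation C := R[i].
Variables (d : 'I_n -> nat) (D Omega : set 'rV[C]_n) (a : 'rV[C]_n).
Local Notation scale := (weighted_scale d).

(** Without an upper bound the real [sup] would be a default value and no admissible radius could be
    compared with it. *)
Lemma fridman_has_ubound :
  has_ubound [set tanh r | r in [set r : R | 0 < r /\
    exists2 f, univalent_maps Omega D f & caratheodory_ball D a r `<=` f @` Omega]].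
Proof. by exists 1 => _ [r _ <-]; exact: tanh_le1. Qed.

Lemma fridman_ge0 : 0 <= fridman Omega D a.
Proof.
rewrite /fridman; set A := (X in sup X).
(* The supremum of the empty set is 0 by default. *)
have [[x Ax]|A0] := pselect (A !=set0); last by rewrite sup_out// => -[].
case: (Ax) => r [r0 _] xE.
by apply: (@le_trans _ _ x); [rewrite -xE tanh_ge0|exact: ub_le_sup fridman_has_ubound _ Ax].
Qed.

Lemma convex_segment : convex_subset Omega -> forall x y (t : R),
  Omega x -> Omega y -> 0 <= t <= 1 ->
  Omega (((1 - t)%:C)%C *: x + (t%:C)%C *: y).
Proof.
move=> cvx x y t Ox Oy /andP[t0 t1].
have u0 : (0 : C) <= ((1 - t)%:C)%C by rewrite lecR subr_ge0.
have u1 : ((1 - t)%:C)%C <= (1 : C) by rewrite lecR lerBlDr lerDl.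
have := cvx x y (Itv01 u0 u1); rewrite !inE => /(_ Ox Oy).
rewrite /conv /=.
suff -> : unstable.onem (((1 - t)%:C)%C : C) = (t%:C)%C by [].
by rewrite /unstable.onem rmorphB/= opprB addrC subrK.
Qed.

Lemma minkowski_le z (t : R) : 0 < t -> Omega z -> Defs.minkowski d Omega (scale (t%:C)%C z) <= t.
Proof.
move=> t0 Oz; apply: ge_inf; first by exists 0 => s [/ltW].
split=> //; suff -> : \row_i (scale (t%:C)%C z 0 i / (t%:C)%C ^+ d i) = z by [].
apply/rowP => i; rewrite !mxE mulrAC mulfV ?mul1r// expf_neq0//.
by rewrite -cmod_gt0 cmodR normr_gt0 gt_eqF.
Qed.


(** The strict [r < rho] is essential: [minkowski_le] gives only [<= r] on the scaled Omega, while
    [minkowski_ball] is defined by a strict inequality. *)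
Lemma univalent_inverse f (rho r : R) :
  vopen D -> univalent_maps D Omega f -> minkowski_ball d Omega rho `<=` f @` D ->
  0 < r < rho ->
  exists2 g, univalent_maps Omega D g &
    forall w, D w -> g (scale ((r^-1)%:C)%C (f w)) = w.
Proof.
move=> oD [holf fO inj] ballf /andP[r0 rrho].
have rn : ((r%:C)%C : C) != 0 by rewrite -cmod_gt0 cmodR normr_gt0 gt_eqF.
have rV (z : 'rV[C]_n) : scale (r%:C)%C (scale ((r^-1)%:C)%C z) = z.
  by rewrite scaleA fmorphV divff// scale1.
have rK (z : 'rV[C]_n) : scale ((r^-1)%:C)%C (scale (r%:C)%C z) = z.
  by rewrite scaleA fmorphV mulVf// scale1.
have vhf : vhol f D by move=> j x /holf; exact: differentiable_sdiff.
have [g gP] := injective_hol_inverse oD vhf inj.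
have inf_ z : Omega z -> exists2 x, D x & f x = scale (r%:C)%C z.
  by move=> Oz; apply: ballf; apply: le_lt_trans rrho; exact: minkowski_le.
exists (fun z => g (scale (r%:C)%C z)); last first.
  by move=> w Dw; rewrite rV (proj1 (gP _ Dw)).
split.
- move=> z /inf_[x Dx xE]; apply: sdiff_differentiable => j.
  apply: (@sdiff_comp _ _ _ (scale (r%:C)%C) (fcoord g j)); last first.
    by rewrite -xE; exact: (proj2 (gP _ Dx)).
  move=> i; rewrite (_ : fcoord _ i = (fun y : 'rV[C]_n => (r%:C)%C ^+ d i * y 0 i)).
    by apply: sdiffM; [exact: sdiff_cst|exact: sdiff_coord].
  by apply/funext => y; rewrite /fcoord mxE.
- by move=> _ [z /inf_[x Dx xE] <-]; rewrite -xE (proj1 (gP _ Dx)).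
- move=> z z' /[!inE] /inf_[x Dx xE] /inf_[x' Dx' xE'].
  rewrite -xE -xE' (proj1 (gP _ Dx)) (proj1 (gP _ Dx')) => E.
  by rewrite -(rK z) -(rK z') -xE -xE' E.
Qed.

Lemma fridman_ge f (L : nat) (rho r m : R) :
  (0 < L)%N -> (forall i, (0 < d i)%N) -> (forall i, (d i <= L)%N) ->
  vopen D -> vopen Omega -> Omega !=set0 -> convex_subset Omega -> d_balanced d Omega ->
  D a -> univalent_maps D Omega f -> f a = 0 ->
  minkowski_ball d Omega rho `<=` f @` D ->
  0 < r < rho -> r <= 1 -> 0 < m < r ^+ L -> m <= fridman Omega D a.
Proof.
move=> L0 d0 dL oD oO [z0 Oz0] cvx bal Da uf fa ballf rrho r1 /andP[m0 mr].
have balO z : Omega z -> forall l, cmod l <= 1 -> Omega (scale l z).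
  by move=> Oz l l1; apply: bal => //; rewrite norm_cmod lecR.
have O0 : Omega 0.
  have := balO _ Oz0 0; rewrite cmod0 => /(_ ler01).
  suff -> : scale 0 z0 = 0 by [].
  by apply/rowP => i; rewrite !mxE expr0n gtn_eqF// mul0r.
have r0 : 0 < r by case/andP: rrho.
have m1 : 0 < m < 1 by rewrite m0 (lt_le_trans mr)// exprn_ile1// ltW.
have m1' : 0 <= m < 1 by case/andP: m1 => /ltW -> ->.
have [g ug gf] := univalent_inverse oD uf ballf rrho.
(* The competitor in the supremum is the radius [artanh m] with the map [g]. *)
rewrite -(tanhK m1'); apply: (ub_le_sup fridman_has_ubound).
exists (artanh m) => //; split; first exact: artanh_gt0.
exists g => // w [Dw cw].
have [Op|nOp] := pselect (Omega (scale ((r^-1)%:C)%C (f w))).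
  by exists (scale ((r^-1)%:C)%C (f w)) => //; exact: gf.
have [G [Gp GO]] := convex_separation oO O0 (convex_segment cvx) nOp.
case: uf => holf fO inj.
have Ofw x : D x -> Omega (f x) by move=> Dx; apply: fO; exists x.
have [u [u1 mu]] := disc_fun_large L0 d0 dL balO GO (Ofw _ Dw) r0 m0 mr Gp.
have Ou x : D x -> Omega (scale u (f x)) by move=> /Ofw/balO; apply; rewrite u1.
(* The rotation [u] depends on [w] but is fixed here, so [F] is one holomorphic function on all of
   [D]. *)
pose F x := disc_fun d L G (scale u (f x)).
have F1 x : D x -> cmod (F x) < 1.
  by move=> /Ou/(disc_fun_domain L0 d0 dL balO GO)[].
have Fa : F a = 0.
  rewrite /F fa (_ : scale u 0 = 0) ?disc_fun0//.
  by apply/rowP => i; rewrite !mxE mulr0.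
exfalso.
have : ((poincare (F a) (F w))%:E <= caratheodory D a w)%E.
  apply: ereal_sup_ubound; exists F => //; split; last first.
    by move=> _ [x Dx <-]; rewrite /unit_disc /= norm_cmod ltcR F1.
  move=> x Dx; apply: sdiff_differentiable1.
  apply: (@sdiff_comp _ _ _ (fun y => scale u (f y))); last first.
    by apply: (sdiff_disc_fun L0 d0 dL balO GO); exact: Ou.
  move=> i; rewrite (_ : fcoord _ i = (fun y : 'rV[C]_n => u ^+ d i * fcoord f i y)).
    by apply: sdiffM; [exact: sdiff_cst|apply: differentiable_sdiff; exact: holf].
  by apply/funext => y; rewrite /fcoord mxE.
move=> /le_lt_trans/(_ cw); rewrite lte_fin Fa poincare0 => /artanh_lt.
rewrite cmod_ge0 (F1 _ Dw) => /(_ isT m1'); apply/negP.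
by rewrite -leNgt ltW.
Qed.

End Fridman.

Theorem theorem5p1 (R : realType) (n : nat) (hn : (2 <= n)%N)
    (d : 'I_n -> nat) (hd : forall i, (0 < d i)%N)
    (D Omega : set 'rV[R[i]]_n)
    (domD : is_domain D) (bndD : bounded_set D)
    (domO : is_domain Omega) (bndO : bounded_set Omega)
    (cvxO : convex_subset Omega) (balO : d_balanced d Omega)
    (a : 'rV[R[i]]_n) (Da : D a) :
  squeezing d Omega D a ^+ (\max_(i < n) d i)%N <= fridman Omega D a.
Proof.
have dL i : (d i <= \max_(i < n) d i)%N by exact: leq_bigmax.
have L0 : (0 < \max_(i < n) d i)%N.
  by apply: leq_trans (dL (Ordinal (ltnW hn))); exact: hd.
case: domD domO => /vopenP oD _ _ [/vopenP oO _ neO].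
rewrite /squeezing; set S := (X in sup X).
(* Without a competitor [squeezing] is the default 0, and [0 ^ L = 0] because [L] is positive. *)
have [[t St]|S0] := pselect (S !=set0); last first.
  by rewrite sup_out ?expr0n ?gtn_eqF ?fridman_ge0// => -[].
have hS : has_sup S by split; [exists t|exists 1 => x []].
apply: exprn_le_lim => //; [|exact: fridman_ge0|].
  by case: (St) => /ltW t0 _ _; apply: le_trans t0 _; exact: ub_le_sup hS.2 _ St.
move=> x /andP[x0 /(sup_gt hS.1)[rho [rho0 rho1 [f [uf fa ballf]]] xrho]].
(* Two strict gaps are wanted: [r < rho] for the inverse map and [x < r] for [m = x ^ L < r ^ L]. *)
have [r /andP[xr rrho]] : exists r, x < r < rho by exists ((x + rho) / 2); rewrite !midf_lt.
have r0 := lt_trans x0 xr.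
apply: (@fridman_ge _ _ d D Omega a f _ rho r _ L0 hd dL oD oO neO) => //.
- by rewrite r0.
- by rewrite ltW// (lt_le_trans rrho).
- by rewrite exprn_gt0//= ltrXn2r ?gtn_eqF// ltW.
Qed.
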